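(* Suppose that the choice functions $C_f$, $f\in F$, satisfy the gapless condition (C). Then the map $x\mapsto\omega(x)$ establishes an isomorphism between the lattice $(\mathcal S,\prec_F)$ of stable g-allocations and the lattice $(\Xi,<)$ of closed functions for the weighted poset of rotations $(\mathcal R,\tau,\lessdot)$.
   Context: Setting. $G=(V,E)$ is a finite connected bipartite graph without multiple edges, $V$ partitioned into independent sets $W$ (workers) and $F$ (firms). $E_v$ is the set of edges incident to $v$; $wf$ denotes the edge joining $w\in W$, $f\in F$. There are capacities $b:E\to\mathbb Z_+$ and quotas $q:W\to\mathbb Z_+$. $\mathcal B=\{x\in\mathbb Z_+^E: x\le b\}$; $\mathcal B_v$ is the set of restrictions of members of $\mathcal B$ to $E_v$; $x_v$ is the restriction of $x$ to $E_v$. For $z\ge 0$, $|z|=\sum_e z(e)$. $\wedge,\vee$ are coordinatewise min and max; $\mathbf 1^e$ is the unit vector of $e$; $\mathrm{supp}(z)=\{e: z(e)\neq 0\}$. Choice functions $C_v:\mathcal B_v\to\mathcal B_v$. Each $w\in W$ has a strict linear order $>_w$ on $E_w$ ($e>_w e'$: $e$ is preferred to $e'$), and $C_w(z)=z$ if $|z|\le q(w)$; if $|z|>q(w)$, number $E_w$ as $e_1>_we_2>_w\cdots$, take the maximal $j$ with $r:=\sum_{i\le j}z(e_i)\le q(w)$ and let $C_w(z)=(z(e_1),\ldots,z(e_j),q(w)-r,0,\ldots,0)$. Each $f\in F$ has a $C_f$ with $C_f(z)\le z$ such that for all $z\ge z'$ in $\mathcal B_f$: (A1) $z'\ge C_f(z)$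 implies $C_f(z')=C_f(z)$; (A2) $C_f(z)\wedge z'\le C_f(z')$; (A3) $|C_f(z)|\ge|C_f(z')|$. $\mathcal A_v=\{z\in\mathcal B_v: C_v(z)=z\}$ (acceptable). For distinct $z,z'\in\mathcal A_v$: $z'\prec_v z$ iff $C_v(z\vee z')=z$. A g-allocation is $x\in\mathcal B$ with $x_v\in\mathcal A_v$ for all $v\in V$. For distinct g-allocations, $x\prec_F y$ iff $x_f\preceq_f y_f$ for all $f\in F$. For $z\in\mathcal A_v$, $e\in E_v$ is interesting for $v$ under $z$ if there is $z'\in\mathcal B_v$ with $z'(e)>z(e)$, $z'(e')=z(e')$ for $e'\ne e$, and $C_v(z')(e)>z(e)$; ''interesting for $v$ under $x$'' means under $x_v$. An edge $wf$ blocks $x$ if it is interesting under $x$ for both $w$ and $f$. A g-allocation is stable if no edge blocks it; $\mathcal S$ is the set of stable g-allocations. It is known that $(\mathcal S,\prec_F)$ is a nonempty distributive lattice (with minimal and maximal elements $x^{\min},x^{\max}$), that $x\prec_F y$ in $\mathcal S$ implies $C_w(x_w\vee y_w)=x_w$ for all $w\in W$, and that $|x_v|$ is the same for all $x\in\mathcal S$, for each $v\in V$. Rotations. Let $x\in\mathcal S$ and $W^==\{w\in W:|x_w|=q(w)\}$. For $w\in W^=$ let $\ell_w(x)$ be the least preferred edge (under $>_w$) of $\mathrm{supp}(x_w)$. The most preferred edge (if any) among the edges $e=wf\in E_w$ with $e\le_w\ell_w(x)$ and $e$ interesting for $f$ under $x$ is called $W$-admissible and denoted $a_w(x)$ (there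 is none if $x_w=0$). For a $W$-admissible $a=wf$, $C_f(x_f+\mathbf 1^a)$ equals $x_f+\mathbf 1^a$ or $x_f+\mathbf 1^a-\mathbf 1^c$ for some $c\in E_f\setminus\{a\}$; in the latter case $c$ is called $F$-admissible, associated with $a$, and $(a,c)$ is a tandem for $x$ passing $f$. $D(x)$ is the directed graph on $V$ whose edges are the $W$-admissible edges directed from $W$ to $F$ and the $F$-admissible edges directed from $F$ to $W$. Cleaning: while some $w\in W$ has a leaving edge $a=(w,f)$ but no entering edge, delete $a$, and also delete the edge $c$ associated with $a$ (if exists) when $c$ is in no other tandem passing $f$ in the current graph; remove isolated vertices. The final graph is the active graph $\Gamma(x)$. In it each vertex of $W$ has exactly one entering and one leaving edge, and at each vertex $f\in F$ the tandems passing $f$ are edge-disjoint and partition the edges of $\Gamma(x)$ at $f$. Hence $\Gamma(x)$ decomposes uniquely into edge-disjoint directed edge-simple cycles in which consecutive edges at each $f\in F$ form a tandem; these cycles are the rotations generated by (applicable to) $x$, and $\mathcal L(x)$ is their set. Rotations for different $x$ are compared as directed cycles (cyclic edge sequences). For a rotation $L$, $L^+$ (resp. $L^-$) is the set of its edges directed from $W$ to $F$ (resp. from $F$ to $W$), identified with the underlying edges of $G$. $\chi^A\in\mathbb R^E$ is the 0/1 incidence vector of $A\subseteq E$. Weights and routes. $\lambda\in\mathbb Z_{>0}$ is feasible for $L\in\mathcal L(x)$ if $\lambda\le x(e)$ for all $e\in L^-$, $\lambda\le b(e)-x(e)$ for all $e\in L^+$, and $C_f(x_f+\lambda\mathbf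 1^a)=x_f+\lambda\mathbf 1^a-\lambda\mathbf 1^c$ for each $f\in F$ and each tandem $(a,c)$ in $L$ passing $f$. Shifting $x$ along $L$ with weight $\lambda$ means replacing $x$ by $x+\lambda(\chi^{L^+}-\chi^{L^-})$ (which is again in $\mathcal S$ for feasible $\lambda$). For $x,y\in\mathcal S$ with $x\prec_F y$, a route from $x$ to $y$ is a sequence $x=x^1,x^2,\ldots,x^N=y$ in $\mathcal S$ where each $x^{i+1}$ is obtained from $x^i$ by shifting along some $L^i\in\mathcal L(x^i)$ with a feasible weight $\lambda_i$; the rotations $L^i$ are used in the route with weights $\lambda_i$. (For $x=y$ the route is the trivial one.) The route is non-excessive if at each step $\lambda_i$ is the maximal possible weight, i.e. the largest feasible weight $\lambda$ for $L^i$ at $x^i$ such that $x^i+\lambda(\chi^{L^{i+}}-\chi^{L^{i-}})\preceq_F y$. A full route is a non-excessive route from $x^{\min}$ to $x^{\max}$. Gapless condition (C). For $f\in F$ and $z\in\mathcal A_f$, a pair $(a,c)$ in $E_f$ is an (abstract) tandem for $z$ if $z(a)<b(a)$, $z(c)>0$ and $C_f(z+\mathbf 1^a)=z+\mathbf 1^a-\mathbf 1^c$. Condition (C): for each $f\in F$, if $z^1,z^2,z^3\in\mathcal A_f$ and $a,c^1,c^2,c^3\in E_f$ are such that $z^1\prec_f z^2\prec_f z^3$, $(a,c^i)$ is a tandem for $z^i$ ($i=1,2,3$), and $c^1=c^3$, then $c^1=c^2$. Poset of rotations (under (C)). Under (C), each rotation is used at most once in a non-excessive route, and for given $x\preceq_F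 y$ the set $\Pi(\mathcal T)$ of pairs $(L,\lambda)$ (rotation used, its weight) is the same for all non-excessive routes $\mathcal T$ from $x$ to $y$. $\mathcal R$ is the set of rotations used in a full route (equivalently all rotations applicable to stable g-allocations), and $\tau_L$ is the weight with which $L\in\mathcal R$ is used in full routes. $L\lessdot L'$ iff in all full routes $L$ is used earlier than $L'$. A function $\xi:\mathcal R\to\mathbb Z_+$ with $\xi(L)\le\tau_L$ for all $L$ is closed if $L\lessdot L'$ and $\xi(L')>0$ imply $\xi(L)=\tau_L$. $\Xi$ is the set of closed functions, ordered coordinatewise (meet $\wedge$, join $\vee$). For $x\in\mathcal S$, $\omega(x)$ is the function $\xi$ on $\mathcal R$ with $\xi(L)=\lambda$ if $(L,\lambda)\in\Pi(\mathcal T)$ and $\xi(L)=0$ if $L$ is not used in $\mathcal T$, where $\mathcal T$ is any non-excessive route from $x^{\min}$ to $x$. *)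

(* Defs.v *)
From HB Require Import structures.
From mathcomp Require Import all_boot.
From mathcomp Require Import boolp classical_sets.

Set Implicit Arguments.
Unset Strict Implicit.
Unset Printing Implicit Defensive.

(* Members of Z_+^E.  A vector indexed by the edges at a vertex v is
   represented by its extension by zero to all edges. *)
Definition vec (E : finType) := {ffun E -> nat}.

Section Vectors.
Variable E : finType.
Implicit Types x y z : vec E.

Definition vzero : vec E := [ffun => 0].
Definition vle x y := [forall e, x e <= y e].
Definition vmeet x y : vec E := [ffun e => minn (x e) (y e)].
Definition vjoin x y : vec E := [ffun e => maxn (x e) (y e)].
Definition vadd x y : vec E := [ffun e => x e + y e].
Definition vunit (k : nat) (a : E) : vec E := [ffun e => k * (e == a)].
Definition vsize z := \sum_e z e.

End Vectors.

Record market := Market {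
  worker : finType;
  firm : finType;
  edge : finType;
  ew : edge -> worker;
  ef : edge -> firm;
  cap : edge -> nat;
  quota : worker -> nat;
  pref : worker -> rel edge;  (* [pref w e e'] : e is preferred to e' by w *)
  choice_firm : firm -> vec edge -> vec edge
}.

Section Market.
Variable M : market.
Local Notation W := (worker M).
Local Notation F := (firm M).
Local Notation E := (edge M).
Local Notation V := (W + F)%type.
Local Notation vecE := (vec E).

Implicit Types (v : V) (w : W) (f : F) (e a c l : E) (x y z : vecE).

Definition incident v e : bool :=
  match v with inl w => ew e == w | inr f => ef e == f end.

Definition adjacent : rel V :=
  fun u v => [exists e, (u != v) && incident u e && incident v e].

Definition restr x v : vecE := [ffun e => if incident v e then x e else 0].

Definition in_box v z : Prop :=
  forall e, z e <= if incident v e then cap e else 0.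

Definition ranking w : seq E :=
  sort (fun e e' => (e == e') || pref w e e') (enum (incident (inl w))).

Definition top_sum w z (j : nat) := \sum_(e <- take j (ranking w)) z e.

Definition cutoff w z : nat :=
  \max_(j < (size (ranking w)).+1 | top_sum w z j <= quota w) j.

(* [index e (ranking w)] counts from 0, so the first [cutoff w z] edges are
   those of index < cutoff w z. *)
Definition choice_worker w z : vecE :=
  if vsize z <= quota w then z else
  [ffun e => let i := index e (ranking w) in
     if i < cutoff w z then z e
     else if i == cutoff w z then quota w - top_sum w z (cutoff w z)
     else 0].

Definition choice v : vecE -> vecE :=
  match v with inl w => choice_worker w | inr f => choice_firm f end.

Record well_formed : Prop := WellFormed {
  wf_simple : forall e e', ew e = ew e' -> ef e = ef e' -> e = e';
  wf_connected : forall u v : V, connect adjacent u v;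
  wf_pref_irr : forall w e, ew e = w -> ~~ pref w e e;
  wf_pref_trans : forall w e1 e2 e3, ew e1 = w -> ew e2 = w -> ew e3 = w ->
    pref w e1 e2 -> pref w e2 e3 -> pref w e1 e3;
  wf_pref_total : forall w e e', ew e = w -> ew e' = w -> e <> e' ->
    pref w e e' || pref w e' e;
  wf_choice_le : forall f z, in_box (inr f) z -> vle (choice_firm f z) z;
  wf_A1 : forall f z z', in_box (inr f) z -> in_box (inr f) z' -> vle z' z ->
    vle (choice_firm f z) z' -> choice_firm f z' = choice_firm f z;
  wf_A2 : forall f z z', in_box (inr f) z -> in_box (inr f) z' -> vle z' z ->
    vle (vmeet (choice_firm f z) z') (choice_firm f z');
  wf_A3 : forall f z z', in_box (inr f) z -> in_box (inr f) z' -> vle z' z ->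
    vsize (choice_firm f z') <= vsize (choice_firm f z)
}.

Definition acceptable v z : Prop := in_box v z /\ choice v z = z.

(* [prec v] and [preceq v] are only used between acceptable vectors. *)
Definition prec v z' z : Prop := z' <> z /\ choice v (vjoin z' z) = z.
Definition preceq v z' z : Prop := z' = z \/ prec v z' z.

Definition g_allocation x : Prop :=
  vle x [ffun e => cap e] /\ forall v, acceptable v (restr x v).

Definition precF x y : Prop :=
  x <> y /\ forall f, preceq (inr f) (restr x (inr f)) (restr y (inr f)).
Definition preceqF x y : Prop := x = y \/ precF x y.

Definition interesting v z e : Prop :=
  exists z', [/\ in_box v z', z e < z' e,
                 forall e', e' != e -> z' e' = z e' & z e < choice v z' e].

Definition interesting_at v x e : Prop := interesting v (restr x v) e.

Definition blocks x e : Prop :=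
  interesting_at (inl (ew e)) x e /\ interesting_at (inr (ef e)) x e.

Definition stable x : Prop := g_allocation x /\ forall e, ~ blocks x e.

Definition is_least x w l : Prop :=
  [/\ ew l = w, x l != 0 &
      forall e, ew e = w -> x e != 0 -> e != l -> pref w e l].

Definition W_candidate x w l e : Prop :=
  [/\ ew e = w, (e == l) || pref w l e & interesting_at (inr (ef e)) x e].

Definition W_admissible x a : Prop :=
  let w := ew a in
  vsize (restr x (inl w)) = quota w /\
  exists l, [/\ is_least x w l, W_candidate x w l a &
                forall e, W_candidate x w l e -> e != a -> pref w a e].

(* C_f(z + k 1^a) = z + k 1^a - k 1^c, stated without truncated subtraction. *)
Definition exchanges f z (k : nat) a c : Prop :=
  vadd (choice_firm f (vadd z (vunit k a))) (vunit k c) = vadd z (vunit k a).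

Definition tandem x a c : Prop :=
  [/\ W_admissible x a, ef c = ef a, c <> a &
      exchanges (ef a) (restr x (inr (ef a))) 1 a c].

Definition F_admissible x c : Prop := exists a, tandem x a c.

(* (e, true) is e directed from W to F, and (e, false) is e directed from F
   to W. *)
Definition dart := (E * bool)%type.

Definition D x : {set dart} :=
  [set d : dart | if d.2 then `[< W_admissible x d.1 >]
                  else `[< F_admissible x d.1 >]]%SET.

Definition in_other_tandem x (G : {set dart}) a c : bool :=
  [exists a', [&& a' != a, (a', true) \in G & `[< tandem x a' c >]]].

(* One deletion; graphs are edge sets, so isolated vertices play no role. *)
Definition clean_step x : rel {set dart} := fun G G' =>
  [exists a, [&& (a, true) \in G,
    [forall c, (ew c == ew a) ==> ((c, false) \notin G)] &
    G' == [set d in G | (d != (a, true)) &&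
             ~~ [&& ~~ d.2, `[< tandem x a d.1 >]
                  & ~~ in_other_tandem x G a d.1]]%SET]].

Definition is_active_graph x (G : {set dart}) : bool :=
  connect (clean_step x) (D x) G && [forall G', ~~ clean_step x G G'].

(* An edge-simple directed cycle, up to the choice of its first edge, is
   represented by the set of its pairs of consecutive edges. *)
Definition rotation := {set dart * dart}.

Definition cyclic_class (s : seq dart) : rotation :=
  [set p | (p.1 \in s) && (p.2 == next s p.1)]%SET.

Definition consecutive x (G : {set dart}) : rel dart := fun d d' =>
  [&& d \in G, d' \in G &
   match d.2, d'.2 with
   | true, false => `[< tandem x d.1 d'.1 >]
   | false, true => ew d.1 == ew d'.1
   | _, _ => false
   end].

Definition applicable x (L : rotation) : Prop :=
  exists G s, [/\ is_active_graph x G, s <> [::],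
                  ucycle (consecutive x G) s & L = cyclic_class s].

Definition Lplus (L : rotation) : {set E} :=
  [set e | [exists d, ((e, true), d) \in L]]%SET.
Definition Lminus (L : rotation) : {set E} :=
  [set e | [exists d, ((e, false), d) \in L]]%SET.

Definition shift x (L : rotation) (k : nat) : vecE :=
  [ffun e => x e + k * (e \in Lplus L) - k * (e \in Lminus L)].

Definition feasible x (L : rotation) (k : nat) : Prop :=
  [/\ 0 < k,
      forall e, e \in Lminus L -> k <= x e,
      forall e, e \in Lplus L -> k <= cap e - x e &
      forall a c, ((a, true), (c, false)) \in L ->
        exchanges (ef a) (restr x (inr (ef a))) k a c].

Definition route := seq (rotation * nat).

Definition max_weight x y (L : rotation) (k : nat) : Prop :=
  [/\ feasible x L k, preceqF (shift x L k) y &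
      forall k', feasible x L k' -> preceqF (shift x L k') y -> k' <= k].

Fixpoint non_excessive x y (T : route) : Prop :=
  match T with
  | [::] => stable x /\ x = y
  | (L, k) :: T' => [/\ stable x, applicable x L, max_weight x y L k &
                        non_excessive (shift x L k) y T']
  end.

Definition xmin : vecE :=
  xget (vzero E) (fun x => stable x /\ forall y, stable y -> preceqF x y).
Definition xmax : vecE :=
  xget (vzero E) (fun x => stable x /\ forall y, stable y -> preceqF y x).

Definition full_route (T : route) : Prop := non_excessive xmin xmax T.

Definition abstract_tandem f z a c : Prop :=
  [/\ ef a = f, ef c = f, z a < cap a, 0 < z c & exchanges f z 1 a c].

Definition gapless : Prop :=
  forall f z1 z2 z3 a c1 c2 c3,
    acceptable (inr f) z1 -> acceptable (inr f) z2 -> acceptable (inr f) z3 ->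
    prec (inr f) z1 z2 -> prec (inr f) z2 z3 ->
    abstract_tandem f z1 a c1 -> abstract_tandem f z2 a c2 ->
    abstract_tandem f z3 a c3 ->
    c1 = c3 -> c1 = c2.

(* Functions on the set R of rotations are extended by zero. *)
Definition rfun := {ffun rotation -> nat}.
Definition rzero : rfun := [ffun => 0].

Definition in_R (L : rotation) : Prop :=
  exists2 T, full_route T & L \in unzip1 T.

Definition records (T : route) (xi : rfun) : Prop :=
  (forall L k, (L, k) \in T -> xi L = k) /\
  (forall L, L \notin unzip1 T -> xi L = 0).

(* The weight function common to all non-excessive routes from x to y. *)
Definition route_weights x y : rfun :=
  xget rzero (fun xi => (exists T, non_excessive x y T) /\
                        forall T, non_excessive x y T -> records T xi).

Definition tau : rfun := route_weights xmin xmax.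

Definition earlier (L L' : rotation) : Prop :=
  [/\ in_R L, in_R L' & forall T, full_route T ->
      index L (unzip1 T) < index L' (unzip1 T) < size T].

Definition closed_fun (xi : rfun) : Prop :=
  [/\ forall L, ~ in_R L -> xi L = 0,
      forall L, in_R L -> xi L <= tau L &
      forall L L', earlier L L' -> 0 < xi L' -> xi L = tau L].

Definition rle (xi xi' : rfun) : Prop := forall L, xi L <= xi' L.
Definition rmeet (xi xi' : rfun) : rfun := [ffun L => minn (xi L) (xi' L)].
Definition rjoin (xi xi' : rfun) : rfun := [ffun L => maxn (xi L) (xi' L)].

Definition omega x : rfun := route_weights xmin x.

Definition is_meet x y m : Prop :=
  [/\ stable m, preceqF m x, preceqF m y &
      forall z, stable z -> preceqF z x -> preceqF z y -> preceqF z m].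
Definition is_join x y j : Prop :=
  [/\ stable j, preceqF x j, preceqF y j &
      forall z, stable z -> preceqF x z -> preceqF y z -> preceqF j z].

End Market.

(* Main.v *)
From mathcomp Require Import all_boot zify.
From mathcomp Require Import boolp classical_sets.
Require Import Defs.

(** The proof replaces the local data at the vertices by two choice functions on
   vectors over all edges, one for all workers and one for all firms. Both
   satisfy (A2) and (A3). A vector is stable if both accept it and no single
   addition is wanted by both; on stable vectors the orders of the two sides
   are opposite ([below_dual]). Extreme stable vectors come from a monotone
   map on menus ([least_stable]), and what either side chooses from the join
   of two stable vectors is stable, the two choices summing up to the two
   vectors ([stable_choice_join], [choices_exchange]).

   Shifting along rotations one unit at a time generates the order: towards
   every larger stable vector there is a shift that stays below it
   ([next_rotation]). Shifts along
   different rotations commute below a common target ([rotates_shift],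
   [both_below]), so the number of times that each rotation is used on the way
   from the least stable vector to [x] does not depend on the way
   ([walk_perm]), and these counts describe the order ([le_usesP]). A rotation
   moves workers to less preferred edges, hence increases the rank-weighted
   size by a positive amount of its own. Together with [choices_exchange] this
   shows that the counts of a meet are the minima of the counts ([meet_uses]).

   The gapless condition has three consequences. A feasible shift that can be
   followed by another unit of the same rotation was not maximal
   ([shiftable_succ]); the stable vectors to which a rotation is applicable
   form a convex set ([rotates_convex]); and using a rotation that can be
   repeated enables no other rotation ([rotates_keep]). By the first two, every
   rotation occurs at most once in a non-excessive route, with a weight equal to its
   count ([mroute_uses]), so that [omega x] is the function of counts at [x].

   It remains to see that the count functions are exactly the closed ones. If
   [x] uses [L] but does not use up [K], then a full route can postpone [K]
   until [L] has been used, by [rotates_keep]; so [K] does not precede [L]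
   ([uses_closed]). Conversely, if [L] is not applicable at [x] although it is
   not used up, then some rotation preceding [L] is not used up: otherwise [L]
   would be applicable at a meet of states which lies below [x]
   ([unavailable_precedes]). Hence a closed function is realized by adding
   missing rotations one at a time ([closed_realized]). *)

Set Implicit Arguments.
Unset Strict Implicit.
Unset Printing Implicit Defensive.

(** * Vectors and choice functions *)

Section VectorFacts.
Variable E : finType.
Implicit Types x y z u t : vec E.

Lemma vleP x y : reflect (forall e, x e <= y e) (vle x y).
Proof. exact: forallP. Qed.

Lemma vle_refl x : vle x x. Proof. exact/vleP. Qed.

Lemma vle_trans x y z : vle x y -> vle y z -> vle x z.
Proof. by move=> /vleP xy /vleP yz; apply/vleP => e; apply: leq_trans (yz e). Qed.

Lemma vle_anti x y : vle x y -> vle y x -> x = y.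
Proof. by move=> /vleP a /vleP c; apply/ffunP => e; move: (a e) (c e); lia. Qed.

Lemma vjoinC x y : vjoin x y = vjoin y x.
Proof. by apply/ffunP => e; rewrite !ffunE maxnC. Qed.

Lemma vjoin_l x y : vle x (vjoin x y).
Proof. by apply/vleP => e; rewrite ffunE leq_maxl. Qed.

Lemma vjoin_r x y : vle y (vjoin x y).
Proof. by apply/vleP => e; rewrite ffunE leq_maxr. Qed.

Lemma vjoin_le x y z : vle x z -> vle y z -> vle (vjoin x y) z.
Proof.
by move=> /vleP xz /vleP yz; apply/vleP => e; rewrite ffunE geq_max xz yz.
Qed.

Lemma vsize_le x y : vle x y -> vsize x <= vsize y.
Proof. by move/vleP => xy; apply: leq_sum. Qed.

Lemma vsize_add x y : vsize (vadd x y) = vsize x + vsize y.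
Proof. by rewrite /vsize -big_split; apply: eq_bigr => e _; rewrite ffunE. Qed.

Lemma vsize_unit k (a : E) : vsize (vunit k a) = k.
Proof.
rewrite /vsize (bigD1 a) //= big1 ?ffunE ?eqxx ?muln1 ?addn0 // => e.
by rewrite ffunE => /negPf ->; rewrite muln0.
Qed.

Lemma vle_size_eq x y : vle x y -> vsize y <= vsize x -> x = y.
Proof.
move=> xy yx; apply/ffunP => e; apply/eqP; rewrite eqn_leq (vleP _ _ xy) /=.
move: yx; rewrite /vsize (bigD1 e) //= (bigD1 e (F := x)) //=.
have : \sum_(i | i != e) x i <= \sum_(i | i != e) y i.
  by apply: leq_sum => i _; apply: (vleP _ _ xy).
by lia.
Qed.

Lemma vle_addr x y : vle x (vadd x y).
Proof. by apply/vleP => e; rewrite ffunE leq_addr. Qed.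

Lemma vaddAC x y z : vadd (vadd x y) z = vadd (vadd x z) y.
Proof. by apply/ffunP => e; rewrite !ffunE addnAC. Qed.

Lemma vadd_unitS x k a : vadd x (vunit k.+1 a) = vadd (vadd x (vunit k a)) (vunit 1 a).
Proof. by apply/ffunP => e; rewrite !ffunE mul1n mulSn addnA addnAC. Qed.

Lemma vle_size_succ x y :
  vle x y -> vsize y = (vsize x).+1 -> exists c, vadd x (vunit 1 c) = y.
Proof.
move=> /vleP xy sz.
have [c xc] : exists c, x c < y c.
  apply/existsP; apply: contraT; rewrite negb_exists => /forallP h.
  have : vsize y <= vsize x by apply: leq_sum => e _; rewrite leqNgt.
  by rewrite sz ltnn.
exists c; apply: vle_size_eq; last by rewrite vsize_add vsize_unit sz addn1.
apply/vleP => e; rewrite !ffunE mul1n; case: eqP => [->|_]; first by lia.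
by rewrite addn0.
Qed.

End VectorFacts.

Section Choice.
Variables (E : finType) (b : vec E).
Implicit Types (x y z u t : vec E) (a c d e : E).

Record choice_axioms (C : vec E -> vec E) : Prop := ChoiceAxioms {
  choice_le : forall z, vle z b -> vle (C z) z;
  choice_A2 : forall z z', vle z b -> vle z' z -> vle (vmeet (C z) z') (C z');
  choice_A3 : forall z z', vle z b -> vle z' z -> vsize (C z') <= vsize (C z)
}.

Variables (C : vec E -> vec E) (HC : choice_axioms C).

Definition below x y := C (vjoin x y) = y.

Definition interesting_for x e := (x e < b e) && (x e < C (vadd x (vunit 1 e)) e).

(** The exchange of [k] units of [a] for [k] units of [c], as an equation
   between sums because subtraction of naturals is truncated. *)
Definition swaps x k a c := vadd (C (vadd x (vunit k a))) (vunit k c) = vadd x (vunit k a).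

Lemma choice_leE z e : vle z b -> C z e <= z e.
Proof. by move=> zb; apply: (vleP _ _ (choice_le HC zb)). Qed.

Lemma choice_A2E z z' e : vle z b -> vle z' z -> minn (C z e) (z' e) <= C z' e.
Proof. by move=> zb zz; move/vleP: (choice_A2 HC zb zz) => /(_ e); rewrite ffunE. Qed.

(** The axiom (A1): by (A2) the smaller menu keeps everything chosen from
   the larger one, and (A3) leaves no room for more. *)
Lemma choice_A1 z z' : vle z b -> vle z' z -> vle (C z) z' -> C z' = C z.
Proof.
move=> zb zz Cz; apply/esym/vle_size_eq; last exact: choice_A3.
apply/vleP => e; move: (choice_A2E e zb zz) (vleP _ _ Cz e); lia.
Qed.

Lemma choice_idem z : vle z b -> C (C z) = C z.
Proof. by move=> zb; apply: choice_A1 => //; [apply: choice_le | apply: vle_refl]. Qed.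

(** Contrapositive reading of (A2), the form in which it bounds choices from
   above: a quantity that is cut back in a small menu is cut back at least to
   the same value in every larger one. *)
Lemma choice_reduced t z e : vle z b -> vle t z -> C t e < t e -> C z e <= C t e.
Proof. by move=> zb tz h; move: (choice_A2E e zb tz); lia. Qed.

(** Path independence: by (A2) the choice from the join lies below [vjoin (C
   x) y], so (A1) applies. *)
Lemma path_indep x y : vle x b -> vle y b -> C (vjoin (C x) y) = C (vjoin x y).
Proof.
move=> xb yb; have jb : vle (vjoin x y) b by apply: vjoin_le.
apply: choice_A1 => //.
  apply: vjoin_le; last exact: vjoin_r.
  exact: vle_trans (choice_le HC xb) (vjoin_l _ _).
apply/vleP => e; move: (choice_A2E e jb (vjoin_l x y)) (choice_leE e jb).
by rewrite !ffunE; lia.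
Qed.

Lemma below_refl x : C x = x -> below x x.
Proof.
by rewrite /below => h; rewrite (_ : vjoin x x = x) //; apply/ffunP => e; rewrite ffunE maxnn.
Qed.

Lemma below_anti x y : below x y -> below y x -> x = y.
Proof. by rewrite /below vjoinC => -> ->. Qed.

Lemma below_trans x y z : vle x b -> vle y b -> vle z b ->
  below x y -> below y z -> below x z.
Proof.
move=> xb yb zb xy yz; rewrite /below.
have jb : vle (vjoin x y) b by apply: vjoin_le.
have e1 : C (vjoin (vjoin x y) z) = z by rewrite -path_indep // xy.
have e2 : vjoin (vjoin x y) z = vjoin (vjoin y z) x.
  by apply/ffunP => e; rewrite !ffunE; lia.
by rewrite vjoinC -{1}yz path_indep ?vjoin_le // -e2.
Qed.

(** The usual way to compare two vectors: exhibit a common menu from which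
   the larger one is chosen. *)
Lemma below_menu x z y : vle z b -> vle x z -> C z = y -> below x y.
Proof.
move=> zb xz Cz; rewrite /below -Cz; apply: choice_A1 (vjoin_r _ _) => //.
by apply: vjoin_le => //; apply: choice_le.
Qed.

Lemma below_size x y : vle x b -> vle y b -> C x = x -> below x y -> vsize x <= vsize y.
Proof.
move=> xb yb Cx xy; rewrite -xy -{1}Cx; apply: (choice_A3 HC); last exact: vjoin_l.
exact: vjoin_le.
Qed.

Lemma vadd_unit_le x e : vle x b -> x e < b e -> vle (vadd x (vunit 1 e)) b.
Proof.
move=> /vleP xb xe; apply/vleP => e'; rewrite !ffunE mul1n.
by case: eqP => [->|_]; rewrite ?addn1 ?addn0.
Qed.

Lemma not_interesting x e : vle x b -> C x = x -> x e < b e ->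
  ~~ interesting_for x e -> C (vadd x (vunit 1 e)) = x.
Proof.
move=> xb Cx xe; rewrite /interesting_for xe /= -leqNgt => h.
have zb := vadd_unit_le xb xe.
rewrite -{2}Cx; apply/esym/choice_A1 => //; first exact: vle_addr.
apply/vleP => e'; move: (choice_leE e' zb) h.
by rewrite !ffunE mul1n; case: eqP => [->|_] //; rewrite addn0.
Qed.

(** How choices are computed below: (A2) bounds [C z] by some [u], and once
   [u] is no larger in size than what is chosen from a smaller menu, (A3) makes
   the bound an equality. *)
Lemma size_squeeze x z u : vle z b -> C x = x -> vle x z -> vle (C z) u ->
  vsize u <= vsize x -> C z = u.
Proof.
move=> zb Cx xz Cu su; apply: vle_size_eq => //; apply: leq_trans su _.
by rewrite -{1}Cx; apply: choice_A3.
Qed.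

Lemma swaps_interesting x a c : vle x b -> x a < b a -> swaps x 1 a c -> c <> a ->
  interesting_for x a.
Proof.
move=> xb xa /ffunP /(_ a); rewrite !ffunE eqxx /interesting_for xa /= => h ca.
by move: h; case: (a =P c) => [ac|_]; [case: ca | lia].
Qed.

Lemma swaps_coord x k a c e : swaps x k a c -> c <> a ->
  C (vadd x (vunit k a)) e + k * (e == c) = x e + k * (e == a).
Proof. by move=> /ffunP /(_ e); rewrite !ffunE. Qed.

Lemma swaps_uniq x a c d : swaps x 1 a c -> swaps x 1 a d -> c = d.
Proof.
move=> /ffunP/(_ c) h1 /ffunP/(_ c) h2; move: h1 h2.
by rewrite !ffunE eqxx; case: (c =P d) => // _; lia.
Qed.

Lemma swaps_size x a c : swaps x 1 a c -> vsize (C (vadd x (vunit 1 a))) = vsize x.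
Proof.
move=> h; have := congr1 (@vsize _) h.
by rewrite !vsize_add !vsize_unit; lia.
Qed.

(** (A3) prevents the chosen size from dropping, so one added unit pushes
   out at most one unit. *)
Lemma interesting_cases x a : vle x b -> C x = x -> interesting_for x a ->
  C (vadd x (vunit 1 a)) = vadd x (vunit 1 a) \/
  exists2 c, c <> a & swaps x 1 a c.
Proof.
move=> xb Cx /andP[xa ia]; have zb := vadd_unit_le xb xa.
have s1 : vsize x <= vsize (C (vadd x (vunit 1 a))).
  by rewrite -{1}Cx; apply: choice_A3 (vle_addr _ _).
have lez := choice_le HC zb; have := vsize_le lez.
rewrite vsize_add vsize_unit => s2.
have [eq|ne] := eqVneq (vsize (C (vadd x (vunit 1 a)))) (vsize x).
  have [|c hc] := vle_size_succ lez; first by rewrite vsize_add vsize_unit; lia.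
  right; exists c => // ca; move/ffunP/(_ a): hc; rewrite !ffunE ca eqxx.
  lia.
by left; apply: vle_size_eq => //; rewrite vsize_add vsize_unit; lia.
Qed.

(** If [c] were wanted on top of [x], then by (A2) all of [x] and the
   additional unit would be chosen from the menu without [a]. That is more than
   the [vsize x] units chosen when [a] is added as well, against (A3). *)
Lemma swapped_out_not_interesting x a c : vle x b -> C x = x -> x a < b a ->
  swaps x 1 a c -> c <> a -> ~~ interesting_for x c.
Proof.
move=> xb Cx xa sw ca; apply/negP => /andP[xc ic].
have x1b := vadd_unit_le xb xa; have x2b := vadd_unit_le xb xc.
pose t := vjoin (vadd x (vunit 1 a)) (vadd x (vunit 1 c)).
have tb : vle t b by apply: vjoin_le.
have s := swaps_coord _ sw ca.
have h1 : C t c <= C (vadd x (vunit 1 a)) c.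
  apply: choice_reduced (vjoin_l _ _) _ => //.
  by move: (s c); rewrite !ffunE eqxx; lia.
have Ct : C t = C (vadd x (vunit 1 a)).
  apply/esym/choice_A1 => //; first exact: vjoin_l.
  apply/vleP => e; move: (choice_leE e tb) h1 (s e); rewrite !ffunE.
  by case: (e =P c) => [->|]; case: eqP; lia.
have := choice_A3 HC tb (vjoin_r (vadd x (vunit 1 a)) (vadd x (vunit 1 c))).
rewrite -/t Ct (swaps_size sw) leqNgt => /negP; apply.
suff -> : C (vadd x (vunit 1 c)) = vadd x (vunit 1 c).
  by rewrite vsize_add vsize_unit addn1.
apply: vle_anti; first exact: choice_le.
apply/vleP => e; rewrite !ffunE mul1n; case: (e =P c) => [->|nec].
  by rewrite addn1.
have := choice_A2E e tb (vjoin_r (vadd x (vunit 1 a)) (vadd x (vunit 1 c))).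
rewrite -/t Ct; move: (s e); rewrite !ffunE.
by case: (e =P c) => // _; lia.
Qed.

(** Interest only fades as one moves up: the larger vector is chosen from a
   menu that offers all of the smaller one, and (A2) hands the interest down.
   *)
Lemma interesting_back x y e : vle x b -> vle y b -> C x = x -> below x y ->
  interesting_for y e -> interesting_for x e /\ x e <= y e.
Proof.
move=> xb yb Cx xy /andP[ye iy].
have jb : vle (vjoin x y) b by apply: vjoin_le.
have xye : x e <= y e.
  rewrite leqNgt; apply/negP => h.
  have := choice_A1 jb (z' := vadd y (vunit 1 e)).
  rewrite xy => h1; move: iy; rewrite h1 ?ltnn //; last exact: vle_addr.
  apply/vleP => e'; rewrite !ffunE mul1n; case: eqP => [->|_]; move: h; lia.
split=> //; rewrite /interesting_for (leq_ltn_trans xye ye) /=.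
have y1b := vadd_unit_le yb ye.
have eqC : C (vjoin (vjoin x y) (vadd y (vunit 1 e))) = C (vadd y (vunit 1 e)).
  rewrite -path_indep // xy; congr C; apply/ffunP => e'; rewrite !ffunE; lia.
have zb : vle (vjoin (vjoin x y) (vadd y (vunit 1 e))) b by apply: vjoin_le.
have := choice_A2E (z' := vadd x (vunit 1 e)) e zb.
rewrite eqC !ffunE eqxx muln1 => h.
suff : minn (C (vadd y (vunit 1 e)) e) (x e + 1) <= C (vadd x (vunit 1 e)) e.
  by move: iy; lia.
apply: h; apply/vleP => e'; rewrite !ffunE; case: eqP => [->|]; lia.
Qed.

(** Path independence for one extra unit. *)
Lemma choice_add z e : vle (vadd z (vunit 1 e)) b ->
  C (vadd (C z) (vunit 1 e)) = C (vadd z (vunit 1 e)).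
Proof.
move=> zb; have zz : vle z (vadd z (vunit 1 e)) by apply: vle_addr.
have zb' : vle z b by apply: vle_trans zb.
apply: choice_A1 => //; apply/vleP => e'.
  by have := choice_leE e' zb'; rewrite !ffunE; lia.
have h0 := choice_leE e' zb; have h1 := choice_reduced (e := e') zb zz.
have h2 := choice_leE e' zb'.
move: h0 h1 h2; rewrite !ffunE; lia.
Qed.

Lemma swaps_succ x k a c : vle (vadd (vadd x (vunit k a)) (vunit 1 a)) b ->
  swaps x k a c -> swaps (C (vadd x (vunit k a))) 1 a c -> swaps x k.+1 a c.
Proof.
rewrite /swaps => zb h1 h3; rewrite (vadd_unitS x) (vadd_unitS _ k c) -(choice_add zb).
by rewrite [LHS]vaddAC h3 [LHS]vaddAC h1.
Qed.

(** By (A2) the exchange of the smaller weight can only affect [c], and its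
   sizes are squeezed between equal ones by (A3). *)
Lemma swaps_down x k i a c : vle (vadd x (vunit k a)) b -> C x = x ->
  swaps x k a c -> c <> a -> i <= k -> swaps x i a c.
Proof.
move=> kb Cx sw ca ik; pose xi := vadd x (vunit i a).
have xik : vle xi (vadd x (vunit k a)).
  by apply/vleP => e; rewrite !ffunE leq_add2l leq_mul2r ik orbT.
have xib := vle_trans xik kb.
have s1 : vsize x <= vsize (C xi) by rewrite -{1}Cx; apply: choice_A3 (vle_addr _ _).
have s2 := choice_A3 HC kb xik.
have s3 : vsize (C (vadd x (vunit k a))) = vsize x.
  by have := congr1 (@vsize _) sw; rewrite !vsize_add !vsize_unit; lia.
have off e : e <> c -> C xi e = xi e.
  move=> ec; have h1 := choice_leE e xib; have h2 := choice_A2E e kb xik.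
  have := swaps_coord e sw ca; case: (e =P c) h1 h2 => // _; rewrite !ffunE.
  by case: eqP => _; lia.
have sz : vsize (C xi) + i = vsize xi by rewrite vsize_add vsize_unit; lia.
apply/ffunP => e; rewrite [LHS]ffunE [vunit i c e]ffunE.
case: (e =P c) => [->|/off ->]; last by rewrite muln0 addn0.
move: sz; rewrite /vsize (bigD1 c) //= [RHS](bigD1 c) //=.
rewrite (eq_bigr xi) => [|j /eqP/off //]; rewrite muln1 addnAC => /addIn; exact.
Qed.

(** Carries an exchange from [x] over to [C z], where [z] is a larger menu
   with no larger choice. The menu [t] certifies through (A2) that one unit of
   [c] has to leave; the sizes then decide the whole choice. *)
Lemma swaps_transport x z x' t a c : vle (vadd z (vunit 1 a)) b ->
  C x = x -> vle x z -> C z = x' -> vsize x' <= vsize x ->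
  vle t (vadd z (vunit 1 a)) -> C t c < t c -> C t c < x' c ->
  swaps x' 1 a c.
Proof.
move=> zab Cx xz Cz sz tz tc tx'.
have zz : vle z (vadd z (vunit 1 a)) by apply: vle_addr.
have zb : vle z b by apply: vle_trans zab.
have x'z : vle x' z by rewrite -Cz; apply: choice_le.
pose u : vec E := [ffun e => x' e + (e == a) - (e == c)].
have uE : vadd u (vunit 1 c) = vadd x' (vunit 1 a).
  apply/ffunP => e; rewrite !ffunE; case: (e =P c) => [->|_]; lia.
have Cu : C (vadd z (vunit 1 a)) = u.
  apply: (size_squeeze (x := x)) => //; first exact: vle_trans zz.
    apply/vleP => e; rewrite ffunE.
    have h0 := choice_leE e zab.
    have h1 := choice_reduced (t := z) (e := e) zab zz.
    have h2 := choice_reduced (e := c) zab tz tc.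
    have h3 := vleP _ _ x'z e; rewrite Cz in h1.
    move: h0 h1 h3; rewrite !ffunE; case: (e =P c) => [->|_]; move: h2; lia.
  have := congr1 (@vsize _) uE; rewrite !vsize_add !vsize_unit; lia.
rewrite /swaps -uE; congr vadd; rewrite -[RHS]Cu; apply: choice_A1 => //.
  by rewrite uE; apply/vleP => e; rewrite !ffunE leq_add2r; apply: (vleP _ _ x'z).
by rewrite Cu; exact: vle_addr.
Qed.

End Choice.

(** * Stability for two opposed choice functions *)

Section TwoSided.
Variables (E : finType) (b : vec E).
Implicit Types (x y z p q : vec E) (e : E) (C : vec E -> vec E).

(** Stability relative to two choice functions on vectors over all edges,
   which makes the two sides of the market interchangeable. *)
Definition stable_for C1 C2 x : Prop :=
  [/\ vle x b, C1 x = x, C2 x = x &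
      forall e, interesting_for b C1 x e -> ~~ interesting_for b C2 x e].

Lemma stable_for_sym C1 C2 x : stable_for C1 C2 x -> stable_for C2 C1 x.
Proof. by case=> xb x1 x2 nb; split=> // e i2; apply/negP => /nb; rewrite i2. Qed.

(** Additions that are unwanted one at a time are unwanted together: were
   one of them chosen from [z], (A2) would make it wanted on its own. *)
Lemma menu_rejected C x z : choice_axioms b C -> vle z b -> C x = x -> vle x z ->
  (forall e, x e < z e -> ~~ interesting_for b C x e) -> C z = x.
Proof.
move=> HC zb Cx xz ni; rewrite -[RHS]Cx; apply/esym/(choice_A1 HC) => //.
apply/vleP => e; have [lt|ge] := ltnP (x e) (z e); last first.
  exact: leq_trans (choice_leE HC e zb) ge.
have xb := vle_trans xz zb; have xe := leq_trans lt (vleP _ _ zb e).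
have h := not_interesting HC xb Cx xe (ni e lt).
have := choice_reduced HC (t := vadd x (vunit 1 e)) (e := e) zb.
rewrite h => -> //; last by rewrite !ffunE eqxx; lia.
by apply/vleP => e'; move: (vleP _ _ xz e'); rewrite !ffunE; case: eqP => [->|]; lia.
Qed.

Lemma below_interesting C x y e : choice_axioms b C -> vle x b -> vle y b ->
  x e < C (vjoin x y) e -> interesting_for b C x e.
Proof.
move=> HC xb yb lt; have jb : vle (vjoin x y) b by apply: vjoin_le.
have xy : x e < y e.
  by have := choice_leE HC e jb; rewrite ffunE; move: lt; lia.
rewrite /interesting_for (leq_trans xy (vleP _ _ yb e)) /=.
have := choice_A2E HC (z := vjoin x y) (z' := vadd x (vunit 1 e)) e jb.
rewrite [vadd _ _ _]ffunE [vunit _ _ _]ffunE eqxx => h.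
suff : minn (C (vjoin x y) e) (x e + 1 * true) <= C (vadd x (vunit 1 e)) e by move: lt; lia.
by apply: h; apply/vleP => e'; rewrite !ffunE; case: eqP => [->|]; move: xy; lia.
Qed.

(** What one side leaves available to the other after choosing from [p]:
   everything where it was not cut back, and what it accepts elsewhere. Stable
   vectors correspond to the fixed points of the alternation of the two offers.
   *)
Definition offer C p : vec E := [ffun e => if C p e == p e then b e else C p e].

Lemma offer_le C p : choice_axioms b C -> vle p b -> vle (offer C p) b.
Proof.
move=> HC pb; apply/vleP => e; rewrite ffunE; case: ifP => // _.
exact: leq_trans (choice_leE HC e pb) (vleP _ _ pb e).
Qed.

Lemma choice_le_offer C p : choice_axioms b C -> vle p b -> vle (C p) (offer C p).
Proof.
move=> HC pb; apply/vleP => e; rewrite ffunE; case: ifP => // _.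
exact: leq_trans (choice_leE HC e pb) (vleP _ _ pb e).
Qed.

Lemma offer_anti C p p' : choice_axioms b C -> vle p b -> vle p' p -> vle (offer C p) (offer C p').
Proof.
move=> HC pb pp; have pb' := vle_trans pp pb; apply/vleP => e; rewrite !ffunE.
have := choice_A2E HC e pb pp; have := choice_leE HC e pb; have := choice_leE HC e pb'.
have := vleP _ _ pb e; have := vleP _ _ pp e.
by case: eqP; case: eqP; lia.
Qed.

Section OneOrder.
Variables (C1 C2 : vec E -> vec E).
Hypotheses (H1 : choice_axioms b C1) (H2 : choice_axioms b C2).

(** Every edge is either cut back by side 1 in [p], or offered in full to
   side 2 which did not take more; either way it blocks nothing. *)
Lemma offer_stable p : vle p b -> C2 (offer C1 p) = C1 p -> stable_for C1 C2 (C1 p).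
Proof.
move=> pb eqC; have qb := offer_le H1 pb; have c1 := choice_idem H1 pb.
have c2 : C2 (C1 p) = C1 p by rewrite -eqC (choice_idem H2 qb).
have mp := choice_le H1 pb; have mb := vle_trans mp pb.
have rej (C : vec E -> vec E) z e : choice_axioms b C -> vle z b -> C z = C1 p -> vle (C1 p) z ->
    C1 p e < z e -> C (vadd (C1 p) (vunit 1 e)) = C1 p.
  move=> HC zb Cz mz lt; rewrite -[RHS]Cz; apply: (choice_A1 HC) => //.
    by apply/vleP => e'; have := vleP _ _ mz e'; rewrite !ffunE; case: eqP => [->|]; lia.
  by rewrite Cz; apply: vle_addr.
split=> // e /andP[me i1]; rewrite /interesting_for me /= -leqNgt.
have [lt|ge] := ltnP (C1 p e) (p e).
  by move: i1; rewrite (rej C1 p) // ltnn.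
rewrite (rej C2 (offer C1 p)) //; first exact: choice_le_offer.
by rewrite ffunE (_ : C1 p e == p e) // eqn_leq ge (vleP _ _ mp).
Qed.

(** The menu of a stable [x] consists of [x] together with everything side 1
   does not want. *)
Lemma stable_offer x : stable_for C1 C2 x -> exists p,
  [/\ vle p b, C1 p = x, C2 (offer C1 p) = x & offer C2 (offer C1 p) = p].
Proof.
case=> xb x1 x2 nb.
pose p : vec E := [ffun e => if interesting_for b C1 x e then x e else b e].
have pb : vle p b by apply/vleP => e; rewrite ffunE; case: ifP => // _; apply: (vleP _ _ xb).
have xp : vle x p by apply/vleP => e; rewrite ffunE; case: ifP => // _; apply: (vleP _ _ xb).
have Cp : C1 p = x.
  by apply: menu_rejected => // e; rewrite ffunE; case: ifP => //; rewrite ltnn.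
have qE e : offer C1 p e = if interesting_for b C1 x e then b e else x e.
  rewrite ffunE Cp [p e]ffunE; case: (interesting_for b C1 x e); first by rewrite eqxx.
  by case: eqP.
have Cq : C2 (offer C1 p) = x.
  apply: menu_rejected => //; first exact: offer_le.
    by apply/vleP => e; rewrite qE; case: ifP => // _; apply: (vleP _ _ xb).
  by move=> e; rewrite qE; case: ifP => [/nb|]; rewrite ?ltnn.
exists p; split=> //; apply/ffunP => e; rewrite ffunE Cq qE [p e]ffunE.
case i1: (interesting_for b C1 x e); last by rewrite eqxx.
by case/andP: i1 => xe _; case: eqP => // h; move: xe; rewrite h ltnn.
Qed.

(** The menus of [x] and [y] are joined. The joined menu leaves side 2 an
   offer below both old offers, from which by (A2) it accepts at least the
   choice of side 1; since by (A3) it cannot accept more in size, both choices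
   agree. *)
Lemma stable_choice_join x y : stable_for C1 C2 x -> stable_for C1 C2 y ->
  stable_for C1 C2 (C1 (vjoin x y)).
Proof.
move=> sx sy; have [p [pb px qx _]] := stable_offer sx.
have [p' [pb' py qy _]] := stable_offer sy.
have jb : vle (vjoin p p') b by apply: vjoin_le.
have [xb x1 _ _] := sx; have [yb _ _ _] := sy.
have eqj : C1 (vjoin x y) = C1 (vjoin p p').
  rewrite -[in LHS]px (path_indep H1) // vjoinC -[in LHS]py (path_indep H1) //.
  by rewrite vjoinC.
rewrite eqj; apply: offer_stable => //; apply/esym/vle_size_eq; last first.
  apply: (@leq_trans (vsize x)).
    rewrite -[in leqRHS]qx; apply: choice_A3; first exact: H2.
      exact: offer_le.
    by apply: offer_anti => //; apply: vjoin_l.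
  by rewrite -[in leqLHS]px; apply: (choice_A3 H1) => //; apply: vjoin_l.
have q1x : vle (offer C1 (vjoin p p')) (offer C1 p) by apply: offer_anti (vjoin_l _ _).
have q1y : vle (offer C1 (vjoin p p')) (offer C1 p') by apply: offer_anti (vjoin_r _ _).
apply/vleP => e; have := choice_A2E H2 e (offer_le H1 pb) q1x.
have := choice_A2E H2 e (offer_le H1 pb') q1y; rewrite qx qy.
have := vleP _ _ (choice_le_offer H1 jb) e.
have : C1 (vjoin p p') e <= maxn (x e) (y e).
  rewrite -eqj.
  by have := choice_leE H1 e (z := vjoin x y); rewrite ffunE; apply; apply: vjoin_le.
lia.
Qed.

(** An edge on which [y] exceeds [x] is wanted by side 1 at [x], hence by
   stability unwanted by side 2. *)
Lemma below_dual x y : stable_for C1 C2 x -> stable_for C1 C2 y ->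
  below C1 x y -> below C2 y x.
Proof.
move=> [xb x1 x2 nbx] [yb y1 y2 nby] xy; rewrite /below vjoinC.
apply: menu_rejected => //; [exact: vjoin_le | exact: vjoin_l |].
move=> e; rewrite ffunE => lt; apply: nbx; apply: (@below_interesting _ _ y) => //.
by rewrite xy; move: lt; lia.
Qed.

(** The alternation of offers is monotone on menus, so iterating it from the
   empty menu reaches its least fixed point. *)
Lemma least_stable : exists2 x, stable_for C1 C2 x &
  forall y, stable_for C1 C2 y -> below C1 x y.
Proof.
pose g p := offer C2 (offer C1 p).
have gb p : vle p b -> vle (g p) b by move=> pb; apply/offer_le/offer_le.
have gm p p' : vle p' b -> vle p p' -> vle (g p) (g p').
  move=> pb pp; apply: (offer_anti H2); last exact: offer_anti.
  exact/offer_le/(vle_trans pp).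
have z0 p : vle (vzero E) p by apply/vleP => e; rewrite [vzero E e]ffunE.
pose it n := iter n g (vzero E).
have itb n : vle (it n) b.
  by elim: n => [|n IH]; [exact: z0 | apply: gb].
have its n : vle (it n) (it n.+1).
  by elim: n => [|n IH]; [exact: z0 | exact: gm (itb _) IH].
have [n fixn] : exists n, g (it n) = it n.
  apply: contrapT => no.
  have grow n : n <= vsize (it n).
    elim: n => // n IH; apply: leq_ltn_trans IH _; rewrite ltnNge; apply/negP => h.
    by apply: no; exists n; apply/esym/vle_size_eq.
  by have := vsize_le (itb (vsize b).+1); rewrite leqNgt grow.
set p := it n in fixn; have pb : vle p b := itb n.
have eqC : C2 (offer C1 p) = C1 p.
  apply/ffunP => e; move/ffunP/(_ e): fixn; rewrite /g [LHS]ffunE.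
  have := choice_leE H1 e pb; have := choice_leE H2 e (offer_le H1 pb).
  rewrite (_ : offer C1 p e = if C1 p e == p e then b e else C1 p e); last by rewrite ffunE.
  by case: eqP; case: eqP; lia.
exists (C1 p); first exact: offer_stable.
move=> y sy; have [p' [pb' py _ fp']] := stable_offer sy.
apply: (below_menu H1 pb') py.
apply: vle_trans (choice_le H1 pb) _.
suff : forall k, vle (it k) p' by apply.
by elim=> [|k IH]; [exact: z0 | rewrite -fp'; apply: gm].
Qed.

End OneOrder.

Section BothOrders.
Variables (C1 C2 : vec E -> vec E).
Hypotheses (H1 : choice_axioms b C1) (H2 : choice_axioms b C2).

Lemma stable_size x y : stable_for C1 C2 x -> stable_for C1 C2 y ->
  below C1 x y -> vsize x = vsize y.
Proof.
move=> sx sy xy; have [xb x1 x2 _] := sx; have [yb y1 y2 _] := sy.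
apply/eqP; rewrite eqn_leq (below_size H1) //=; apply: (below_size H2) => //.
exact: below_dual xy.
Qed.

(** Both choices cannot exceed [x e] simultaneously, for then [e] would
   block [x], and the same holds for [y]; so the left-hand side is at most the
   right-hand side, and by (A3) it is not smaller in size. *)
Lemma choices_exchange x y : stable_for C1 C2 x -> stable_for C1 C2 y ->
  vadd (C1 (vjoin x y)) (C2 (vjoin x y)) = vadd x y.
Proof.
move=> sx sy; have [xb x1 x2 nbx] := sx; have [yb y1 y2 nby] := sy.
have jb : vle (vjoin x y) b by apply: vjoin_le.
apply: vle_size_eq; last first.
  rewrite !vsize_add leq_add //.
    by rewrite -{1}x1; apply: (choice_A3 H1) => //; apply: vjoin_l.
  by rewrite -{1}y2; apply: (choice_A3 H2) => //; apply: vjoin_r.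
apply/vleP => e; rewrite [vadd _ _ _]ffunE [leqRHS]ffunE.
have c1 := choice_leE H1 e jb; have c2 := choice_leE H2 e jb.
rewrite !ffunE in c1 c2.
have nx : (C1 (vjoin x y) e <= x e) || (C2 (vjoin x y) e <= x e).
  apply: contraT; rewrite negb_or -!ltnNge => /andP[l1 l2].
  by have := nbx e (below_interesting H1 xb yb l1); rewrite (below_interesting H2 xb yb l2).
have ny : (C1 (vjoin x y) e <= y e) || (C2 (vjoin x y) e <= y e).
  rewrite vjoinC in c1 c2 *.
  apply: contraT; rewrite negb_or -!ltnNge => /andP[l1 l2].
  by have := nby e (below_interesting H1 yb xb l1); rewrite (below_interesting H2 yb xb l2).
lia.
Qed.

Lemma below_choice_join x y : vle x b -> vle y b -> below C1 x (C1 (vjoin x y)).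
Proof. by move=> xb yb; apply: (below_menu H1) (vjoin_l x y) _ => //; apply: vjoin_le. Qed.

(** Path independence, used twice. *)
Lemma choice_join_least x y z : vle x b -> vle y b -> vle z b ->
  below C1 x z -> below C1 y z -> below C1 (C1 (vjoin x y)) z.
Proof.
move=> xb yb zb xz yz; rewrite /below (path_indep H1) //; last exact: vjoin_le.
have -> : vjoin (vjoin x y) z = vjoin (vjoin y z) x.
  by apply/ffunP => e; rewrite !ffunE; lia.
rewrite -(path_indep H1) ?vjoin_le // yz vjoinC; exact: xz.
Qed.

End BothOrders.
End TwoSided.

(** * The greedy choice of a worker *)

Section WorkerChoice.
Variables (M : market) (HM : well_formed M).
Local Notation W := (worker M).
Local Notation E := (edge M).
Implicit Types (w : W) (e a c l : E) (x y z : vec E).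

Definition rank e : nat := index e (ranking (ew e)).

Lemma mem_ranking w e : (e \in ranking w) = (ew e == w).
Proof. by rewrite mem_sort mem_enum. Qed.

Lemma ranking_uniq w : uniq (ranking w).
Proof. by rewrite sort_uniq enum_uniq. Qed.

Lemma rank_inj e e' : ew e = ew e' -> rank e = rank e' -> e = e'.
Proof.
rewrite /rank => h; rewrite -h => hi.
by apply: (index_inj e _ _ hi); rewrite mem_ranking ?h.
Qed.

Lemma pref_rank e e' : ew e = ew e' -> e <> e' ->
  pref (ew e) e e' = (rank e < rank e').
Proof.
move=> eqw ne.
pose leT := (fun e e' => (e == e') || pref (ew e') e e').
set w := ew e.
pose leW := (fun e1 e2 : E => (e1 == e2) || pref w e1 e2).
have tot : {in mem (enum (incident (inl w))) &, total leW}.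
  move=> e1 e2; rewrite !mem_enum /in_mem /= => /eqP w1 /eqP w2.
  rewrite /leW; have [->//|/eqP n12] := eqVneq e1 e2.
  by case/orP: (wf_pref_total HM w1 w2 n12) => ->; rewrite ?orbT.
have srt : sorted leW (ranking w) by apply: (sort_sorted_in tot); apply/allP.
have tr : {in ranking w & &, transitive leW}.
  move=> e2 e1 e3; rewrite !mem_ranking => /eqP w2 /eqP w1 /eqP w3.
  rewrite /leW => /orP[/eqP->//|p12] /orP[/eqP <-|p23]; first by rewrite p12 orbT.
  by rewrite (wf_pref_trans HM w1 w2 w3 p12 p23) orbT.
have mono e1 e2 : ew e1 = w -> ew e2 = w -> rank e1 < rank e2 -> pref w e1 e2.
  rewrite /rank => w1 w2; rewrite w1 w2 => lt.
  have := sorted_ltn_index_in tr srt _ _ _ _ lt.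
  rewrite !mem_ranking w1 w2 eqxx => /(_ isT isT) /orP[/eqP e12|//].
  by move: lt; rewrite e12 ltnn.
apply/idP/idP => [p|]; last by apply: mono.
rewrite ltnNge leq_eqVlt; apply/negP => /orP[/eqP h|h].
  by apply: ne; apply/esym/rank_inj.
have p' := mono _ _ (esym eqw) erefl h.
have := wf_pref_irr HM (erefl : ew e = w).
by rewrite (wf_pref_trans HM _ _ _ p p').
Qed.

Definition load x e := \sum_(e' | (ew e' == ew e) && (rank e' <= rank e)) x e'.

Lemma restr_size x w : vsize (restr x (inl w)) = \sum_(e | ew e == w) x e.
Proof.
by rewrite /vsize [RHS]big_mkcond /=; apply: eq_bigr => e _; rewrite ffunE.
Qed.

Lemma top_sumE w z j :
  top_sum w z j = \sum_(e | (ew e == w) && (index e (ranking w) < j)) z e.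
Proof.
rewrite /top_sum big_uniq ?take_uniq ?ranking_uniq //; apply: eq_bigl => e.
have [ew_e|ne] := boolP (ew e == w); first by rewrite in_take ?mem_ranking.
by apply/negP => /mem_take; rewrite mem_ranking (negPf ne).
Qed.

Lemma top_sum_mono w z i j : i <= j -> top_sum w z i <= top_sum w z j.
Proof.
move=> ij; rewrite !top_sumE [leqRHS](bigID (fun e => index e (ranking w) < i)) /=.
apply: leq_trans (leq_addr _ _); apply: eq_leq; apply: eq_bigl => e.
by case: eqP => //= _; case: ltnP => /= h; [rewrite (leq_trans h ij) | rewrite andbF].
Qed.

Lemma top_sumS w z e : ew e = w ->
  top_sum w z (index e (ranking w)).+1 = top_sum w z (index e (ranking w)) + z e.
Proof.
move=> ewe; rewrite /top_sum (take_nth e); last by rewrite index_mem mem_ranking ewe.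
by rewrite big_rcons /= nth_index ?mem_ranking ?ewe.
Qed.

Lemma top_sum_all w z : in_box (inl w) z ->
  top_sum w z (size (ranking w)) = vsize z.
Proof.
move=> bz; rewrite top_sumE /vsize [RHS](bigID (fun e => ew e == w)) /=.
rewrite [X in _ = _ + X]big1 ?addn0; last first.
  by move=> e ne; have := bz e; rewrite /incident (negPf ne); lia.
apply: eq_bigl => e; case: eqP => //= h; by rewrite index_mem mem_ranking h eqxx.
Qed.

(** The greedy choice fills each edge with what the preferred edges leave of
   the quota; this closed form makes (A2) immediate. *)
Lemma choice_workerE w z e : in_box (inl w) z ->
  choice_worker w z e = minn (z e) (quota w - top_sum w z (index e (ranking w))).
Proof.
move=> bz; rewrite /choice_worker; set r := ranking w; set i := index e r.
have [ewe|ne] := eqVneq (ew e) w; last first.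
  have z0 : z e = 0 by have := bz e; rewrite /incident (negPf ne); lia.
  case: ifP => //= h; rewrite ?ffunE z0 ?min0n //= -/r -/i.
  have ei : i = size r by apply: memNindex; rewrite mem_ranking.
  case: ifP => // h1; case: ifP => // /eqP h2.
  move: h; rewrite -(top_sum_all bz) -/r -ei h2; lia.
have lti : i < size r by rewrite index_mem mem_ranking ewe.
have tS := top_sumS z ewe; rewrite -/r -/i in tS.
case: leqP => h.
  have := top_sum_mono w z lti; rewrite tS (top_sum_all bz); lia.
have cutP j : j <= size r -> (j <= cutoff w z) = (top_sum w z j <= quota w).
  move=> jr; apply/idP/idP => [jk|].
    apply: leq_trans (top_sum_mono w z jk) _.
    rewrite /cutoff; have [|k kq ->] := @eq_bigmax_cond _
        [pred k : 'I_(size (ranking w)).+1 | top_sum w z k <= quota w] val.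
      apply/card_gt0P; exists ord0; rewrite inE /= /top_sum take0 big_nil //.
    by move: kq; rewrite inE.
  move=> jq; rewrite -ltnS in jr.
  exact: (@leq_bigmax_cond _ (fun k : 'I_(size r).+1 => top_sum w z k <= quota w)
            val (Ordinal jr)).
rewrite ffunE -/r -/i; have := cutP _ lti; have := cutP _ (ltnW lti); rewrite tS.
case: (ltnP i) => h1; first by lia.
case: eqP => [h2|h2]; last by lia.
rewrite -h2; lia.
Qed.

Lemma choice_worker_size w z : in_box (inl w) z ->
  vsize (choice_worker w z) = minn (vsize z) (quota w).
Proof.
move=> bz.
have bc : in_box (inl w) (choice_worker w z).
  by move=> e; rewrite choice_workerE //; apply: leq_trans (bz e); apply: geq_minl.
suff main j : j <= size (ranking w) ->
    top_sum w (choice_worker w z) j = minn (top_sum w z j) (quota w).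
  by rewrite -(top_sum_all bc) main // top_sum_all.
elim: j => [|j IH] jr; first by rewrite /top_sum take0 !big_nil min0n.
have [e0 _] : exists e0 : E, True by case: (ranking w) jr => // e0 _ _; exists e0.
pose e := nth e0 (ranking w) j.
have ej : index e (ranking w) = j by rewrite index_uniq ?ranking_uniq.
have ewe : ew e = w by apply/eqP; rewrite -mem_ranking mem_nth.
have := top_sumS z ewe; have := top_sumS (choice_worker w z) ewe.
by rewrite ej IH ?(ltnW jr) // => -> ->; rewrite choice_workerE // ej; lia.
Qed.

End WorkerChoice.

(** * The joint choices of all workers and of all firms *)

Section GlobalChoice.
Variables (M : market) (HM : well_formed M).
Local Notation W := (worker M).
Local Notation F := (firm M).
Local Notation E := (edge M).
Local Notation V := (W + F)%type.
Implicit Types (v : V) (w : W) (f : F) (e a c : E) (x y z : vec E) (s : bool).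

Lemma restr_box v z : vle z [ffun e => cap e] -> in_box v (restr z v).
Proof.
move=> /vleP zb e; rewrite ffunE; case: ifP => // _.
by have := zb e; rewrite ffunE.
Qed.

Lemma restr_le v x y : vle x y -> vle (restr x v) (restr y v).
Proof. by move=> /vleP xy; apply/vleP => e; rewrite !ffunE; case: ifP. Qed.

Lemma local_le v z : in_box v z -> vle (choice v z) z.
Proof.
case: v => [w|f] bz /=; last exact: (wf_choice_le HM).
by apply/vleP => e; rewrite choice_workerE // geq_minl.
Qed.

Lemma local_A2 v z z' : in_box v z -> in_box v z' -> vle z' z ->
  vle (vmeet (choice v z) z') (choice v z').
Proof.
case: v => [w|f] bz bz' zz /=; last exact: (wf_A2 HM).
apply/vleP => e; rewrite !ffunE !choice_workerE //.
have : top_sum w z' (index e (ranking w)) <= top_sum w z (index e (ranking w)).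
  by rewrite /top_sum; apply: leq_sum => i _; apply: (vleP _ _ zz).
lia.
Qed.

Lemma local_A3 v z z' : in_box v z -> in_box v z' -> vle z' z ->
  vsize (choice v z') <= vsize (choice v z).
Proof.
case: v => [w|f] bz bz' zz /=; last exact: (wf_A3 HM).
rewrite !choice_worker_size //; have := vsize_le zz; lia.
Qed.

Definition endpoint s e : V := if s then inl (ew e) else inr (ef e).
Definition sideof v : bool := if v is inl _ then true else false.
(** The choices of all workers ([true]) or of all firms ([false]) at once.
   As every edge has one end on each side, (A2) and (A3) hold jointly, and
   statements about restrictions to a vertex become statements about vectors
   over all edges. *)
Definition gchoice s z : vec E :=
  [ffun e => choice (endpoint s e) (restr z (endpoint s e)) e].
Definition gcap : vec E := [ffun e => cap e].

Local Notation CW := (gchoice true).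
Local Notation CF := (gchoice false).

Lemma incident_endpoint v e : incident v e = (endpoint (sideof v) e == v).
Proof. by case: v. Qed.

Lemma restr_gchoice v z : vle z gcap ->
  restr (gchoice (sideof v) z) v = choice v (restr z v).
Proof.
move=> zb; have bz := restr_box v zb; apply/ffunP => e; rewrite [LHS]ffunE.
case: ifP => h; first by rewrite ffunE; move: h; rewrite incident_endpoint => /eqP ->.
have := vleP _ _ (local_le bz) e; rewrite ffunE h; lia.
Qed.

Lemma vsize_restr s z : vsize z = \sum_(v | sideof v == s) vsize (restr z v).
Proof.
rewrite /vsize (partition_big (endpoint s) (fun v => sideof v == s)) /=; last by case: s.
apply: eq_bigr => v /eqP sv; rewrite big_mkcond; apply: eq_bigr => e _.
by rewrite ffunE incident_endpoint sv.
Qed.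

Lemma gchoice_axioms s : choice_axioms gcap (gchoice s).
Proof.
split=> [z zb|z z' zb zz|z z' zb zz].
- apply/vleP => e; rewrite ffunE.
  apply: leq_trans (vleP _ _ (local_le (restr_box (endpoint s e) zb)) e) _.
  by rewrite ffunE; case: ifP.
- have zb' := vle_trans zz zb; apply/vleP => e; rewrite !ffunE.
  have := vleP _ _ (local_A2 (restr_box (endpoint s e) zb)
    (restr_box (endpoint s e) zb') (restr_le (endpoint s e) zz)) e.
  by rewrite !ffunE; case: s => /=; rewrite eqxx.
- have zb' := vle_trans zz zb.
  rewrite (vsize_restr s) [leqRHS](vsize_restr s); apply: leq_sum => v /eqP <-.
  rewrite !restr_gchoice //.
  by apply: local_A3 (restr_box v zb) (restr_box v zb') (restr_le v zz).
Qed.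

Lemma restr_ext s x y : (forall v, sideof v = s -> restr x v = restr y v) -> x = y.
Proof.
move=> h; apply/ffunP => e; have := h (endpoint s e) _.
by case: s {h} => /(_ erefl)/ffunP/(_ e); rewrite !ffunE /= eqxx.
Qed.

Lemma vjoin_restr x y v : vjoin (restr x v) (restr y v) = restr (vjoin x y) v.
Proof. by apply/ffunP => e; rewrite !ffunE; case: ifP. Qed.

Lemma vadd_restr x k a v : incident v a ->
  vadd (restr x v) (vunit k a) = restr (vadd x (vunit k a)) v.
Proof.
move=> va; apply/ffunP => e; rewrite !ffunE; case: ifP => // ve.
by case: eqP => [ea|]; [move: va ve; rewrite ea => -> | lia].
Qed.

Lemma g_allocationP x : g_allocation x <->
  [/\ vle x gcap, CW x = x & CF x = x].
Proof.
split=> [[xb acc]|[xb wx fx]].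
  split=> //.
    apply: (@restr_ext true) => v <-; rewrite restr_gchoice //; exact: (acc v).2.
  apply: (@restr_ext false) => v <-; rewrite restr_gchoice //; exact: (acc v).2.
split=> // v; split; first exact: restr_box.
rewrite -restr_gchoice //; congr restr; by case: v.
Qed.

(** By (A2), if some larger amount of [e] is partly accepted then so is a
   single extra unit. *)
Lemma interesting_atP v x e : vle x gcap -> incident v e ->
  interesting_at v x e <-> interesting_for gcap (gchoice (sideof v)) x e.
Proof.
move=> xb ve; have ev : endpoint (sideof v) e = v.
  by apply/eqP; rewrite -incident_endpoint.
split=> [[z' [bz xz zx iz]]|/andP[xe ix]].
  pose x'' : vec E := [ffun e' => if e' == e then z' e else x e'].
  have rx : restr x'' v = z'.
    apply/ffunP => e'; rewrite !ffunE; case: ifP => ve'; last first.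
      by have := bz e'; rewrite ve'; lia.
    by case: eqP => [->//|/eqP/zx ->]; rewrite ffunE ve'.
  have xe : x e < z' e by move: xz; rewrite ffunE ve.
  have zc : z' e <= cap e by have := bz e; rewrite ve.
  have xb'' : vle x'' gcap.
    apply/vleP => e'; rewrite !ffunE; case: eqP => [->//|_].
    by have := vleP _ _ xb e'; rewrite ffunE.
  rewrite /interesting_for [gcap _]ffunE (leq_trans xe zc) /=.
  have xx : vle (vadd x (vunit 1 e)) x''.
    by apply/vleP => e'; rewrite !ffunE; case: eqP => [->|]; lia.
  have := choice_A2E (gchoice_axioms (sideof v)) e xb'' xx.
  have -> : gchoice (sideof v) x'' e = choice v z' e by rewrite ffunE ev rx.
  move: iz; rewrite [restr _ _ _]ffunE ve [vadd _ _ _]ffunE [vunit _ _ _]ffunE eqxx; lia.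
exists (restr (vadd x (vunit 1 e)) v).
have xb1 := vadd_unit_le xb xe.
split; first exact: restr_box.
- by rewrite !ffunE ve eqxx; lia.
- by move=> e' /negPf ne; rewrite !ffunE ne muln0 addn0.
- by rewrite -restr_gchoice // [restr _ _ _]ffunE [restr _ _ _]ffunE ve.
Qed.

Lemma stableP x : stable x <-> stable_for gcap CW CF x.
Proof.
split=> [[/g_allocationP[xb wx fx] nb]|[xb wx fx nb]].
  split=> // e iw; apply/negP => iF; apply: (nb e); split; apply/interesting_atP => //=.
split; first exact/g_allocationP.
move=> e [/interesting_atP-/(_ xb) iw /interesting_atP-/(_ xb) iF].
by have := nb e (iw (eqxx _)); rewrite iF //=.
Qed.

Lemma preceqFP x y : vle x gcap -> vle y gcap -> CF x = x -> CF y = y ->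
  preceqF x y <-> below CF x y.
Proof.
move=> xb yb fx fy; have jb : vle (vjoin x y) gcap by apply: vjoin_le.
split=> [[<-|[_ h]]|h].
- exact: below_refl.
- apply: (@restr_ext false) => -[//|f] _.
  rewrite (restr_gchoice (inr f)) // -vjoin_restr.
  have [<-|[_ //]] := h f.
  by rewrite vjoin_restr -(restr_gchoice (inr f)) ?vjoin_le //= (below_refl fx).
have [xy|ne] := pselect (x = y); [by left | right; split=> // f].
have [rxy|rne] := pselect (restr x (inr f) = restr y (inr f)); [by left | right; split=> //].
by rewrite vjoin_restr -(restr_gchoice (inr f)) // -/gcap h.
Qed.

Lemma exchangesP x k a c : vle (vadd x (vunit k a)) gcap -> CF x = x -> ef c = ef a ->
  exchanges (ef a) (restr x (inr (ef a))) k a c <-> swaps CF x k a c.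
Proof.
move=> zb fx eca; rewrite /exchanges vadd_restr /= ?eqxx //.
rewrite -[choice_firm _ _]/(choice (inr (ef a)) _) -restr_gchoice //.
rewrite vadd_restr /= ?eca ?eqxx //; split=> [h|->//].
apply: (@restr_ext false) => -[//|f] _.
have [->//|ne] := pselect (f = ef a).
have xb : vle x gcap by apply: vle_trans zb; apply: vle_addr.
have rzx : restr (vadd x (vunit k a)) (inr f) = restr x (inr f).
  apply/ffunP => e; rewrite !ffunE /=; case: eqP => // fe.
  by case: eqP => [ea|]; [case: ne; rewrite -fe ea | lia].
rewrite rzx -[in RHS]fx (restr_gchoice (inr f)) // -rzx -(restr_gchoice (inr f)) //.
apply/ffunP => e; rewrite !ffunE /=; case: eqP => // fe.
by case: eqP => [ec|]; [case: ne; rewrite -fe ec | lia].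
Qed.

Lemma swaps_firm x a c : vle x gcap -> CF x = x -> swaps CF x 1 a c -> c <> a -> ef c = ef a.
Proof.
move=> xb fx /ffunP/(_ c); rewrite [LHS]ffunE [RHS]ffunE !ffunE eqxx => h ca.
apply/eqP/negPn/negP => ne; move: h.
have -> : restr (vadd x (vunit 1 a)) (endpoint false c) = restr x (endpoint false c).
  apply/ffunP => e; rewrite !ffunE /=; case: eqP => // fe.
  by case: eqP => [ea|]; [case/eqP: ne; rewrite -fe ea | lia].
have : CF x c = x c by rewrite fx.
rewrite ffunE => ->; case: eqP => [//|_]; lia.
Qed.

(** At the firm of [a] the vectors may have equal restrictions, where the
   strict order of the gapless condition is not available; equal restrictions
   however have equal tandems. *)
Lemma gapless_global (HC : gapless M) z1 z2 z3 a c d :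
  vle z1 gcap -> vle z2 gcap -> vle z3 gcap ->
  CF z1 = z1 -> CF z2 = z2 -> CF z3 = z3 ->
  below CF z1 z2 -> below CF z2 z3 ->
  z1 a < cap a -> z2 a < cap a -> z3 a < cap a ->
  swaps CF z1 1 a c -> swaps CF z2 1 a d -> swaps CF z3 1 a c ->
  c <> a -> d <> a -> d = c.
Proof.
move=> b1 b2 b3 f1 f2 f3 l12 l23 r1 r2 r3 s1 s2 s3 ca da.
have ec := swaps_firm b1 f1 s1 ca; have ed := swaps_firm b2 f2 s2 da.
have up z : vle z gcap -> z a < cap a -> vle (vadd z (vunit 1 a)) gcap.
  by move=> zb za; apply: vadd_unit_le => //; rewrite ffunE.
set v : V := inr (ef a).
have x1 := (exchangesP (up _ b1 r1) f1 ec).2 s1.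
have x2 := (exchangesP (up _ b2 r2) f2 ed).2 s2.
have x3 := (exchangesP (up _ b3 r3) f3 ec).2 s3.
have same z z' p q : vle z gcap -> z a < cap a -> CF z = z -> vle z' gcap -> z' a < cap a -> CF z' = z' ->
    ef p = ef a -> ef q = ef a ->
    restr z v = restr z' v -> swaps CF z 1 a p -> swaps CF z' 1 a q -> p = q.
  move=> zb za fz zb' za' fz' ep eq rz sp sq.
  have h := (exchangesP (up _ zb za) fz ep).2 sp; rewrite -/v rz in h.
  apply: (swaps_uniq _ sq); exact: (exchangesP (up _ zb' za') fz' ep).1 h.
have [r12|n12] := pselect (restr z1 v = restr z2 v); first by apply/esym; apply: same r12 s1 s2.
have [r23|n23] := pselect (restr z2 v = restr z3 v); first by apply: same r23 s2 s3.
have acc z : vle z gcap -> CF z = z -> acceptable v (restr z v).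
  by move=> zb fz; split; [apply: restr_box | rewrite -restr_gchoice // fz].
have prc z z' : vle z gcap -> vle z' gcap -> below CF z z' -> restr z v <> restr z' v ->
    prec v (restr z v) (restr z' v).
  move=> zb zb' zz ne; split=> //.
  by rewrite vjoin_restr -restr_gchoice ?zz //; apply: vjoin_le.
have tan z p : z a < cap a -> ef p = ef a -> swaps CF z 1 a p -> p <> a ->
    exchanges (ef a) (restr z v) 1 a p -> abstract_tandem (ef a) (restr z v) a p.
  move=> za ep sp pa ex; split=> //; first by rewrite ffunE /= eqxx.
  rewrite ffunE /= ep eqxx.
  by move/ffunP/(_ p): sp; rewrite !ffunE eqxx; case: eqP => // _; lia.
apply/esym; apply: (HC (ef a) _ _ _ a c d c (acc _ b1 f1) (acc _ b2 f2) (acc _ b3 f3)) => //.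
- exact: prc.
- exact: prc.
- exact: tan.
- exact: tan.
- exact: tan.
Qed.

End GlobalChoice.

(** * Closed alternating walks *)

Section Cycles.
Variable M : market.
Local Notation E := (edge M).
Implicit Types (e a c : E) (L K : rotation M).

(** The part of applicability that does not mention a vector: a cyclic
   sequence of distinct darts that alternates in direction and stays at the
   same worker when it turns there. *)
Definition alternating L : Prop := exists s,
  [/\ s <> [::], uniq s, L = cyclic_class s &
      forall d, d \in s -> (next s d).2 = ~~ d.2 /\ (~~ d.2 -> ew (next s d).1 = ew d.1)].

(** The two darts at a firm that have to form a tandem. *)
Definition turn L a c : bool := ((a, true), (c, false)) \in L.

Lemma cyclic_classE (s : seq (dart M)) d d' :
  ((d, d') \in cyclic_class s) = (d \in s) && (d' == next s d).
Proof. by rewrite inE. Qed.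

Section OneCycle.
Variables (L : rotation M) (altL : alternating L).

Lemma plus_turn a : a \in Lplus L -> exists c, turn L a c.
Proof.
have [s [_ us eL alt]] := altL; rewrite inE eL => /existsP[[c b]].
rewrite cyclic_classE => /andP[as_ /eqP en].
have [hb _] := alt _ as_; rewrite -en /= in hb; rewrite hb in en.
by exists c; rewrite /turn cyclic_classE as_ en eqxx.
Qed.

Lemma turn_plus a c : turn L a c -> a \in Lplus L.
Proof. by move=> t; rewrite inE; apply/existsP; exists (c, false). Qed.

Lemma turn_minus a c : turn L a c -> c \in Lminus L.
Proof.
have [s [_ us eL alt]] := altL; rewrite /turn eL cyclic_classE => /andP[as_ /eqP e].
rewrite inE; apply/existsP; exists (next s (c, false)).
by rewrite cyclic_classE eqxx andbT e mem_next.
Qed.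

Lemma minus_turn c : c \in Lminus L -> exists a, turn L a c.
Proof.
have [s [_ us eL alt]] := altL; rewrite inE eL => /existsP[d].
rewrite cyclic_classE => /andP[cs _].
have ps : prev s (c, false) \in s by rewrite mem_prev.
have [] := alt _ ps; rewrite next_prev //=.
case eP: (prev s (c, false)) => [a b] /=; case: b eP => // eP _ _.
by exists a; rewrite /turn cyclic_classE -eP ps next_prev //=.
Qed.

Lemma pair_shape d d' : (d, d') \in L ->
  [/\ d'.2 = ~~ d.2, ~~ d.2 -> ew d'.1 = ew d.1 & exists d'', (d', d'') \in L].
Proof.
have [s [_ us eL alt]] := altL; rewrite eL cyclic_classE => /andP[ds /eqP ->].
have [h1 h2] := alt _ ds; split=> //; exists (next s (next s d)).
by rewrite cyclic_classE mem_next ds eqxx.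
Qed.

Lemma alternating_nonempty : exists a c, turn L a c.
Proof.
have [s [s0 us eL alt]] := altL.
have [d ds] : exists d, d \in s by case: (s) s0 => // d s' _; exists d; rewrite mem_head.
have [a /plus_turn[c t]] : exists a, a \in Lplus L; last by exists a, c.
have in_plus a : (a, true) \in s -> a \in Lplus L.
  move=> as_; rewrite inE eL; apply/existsP; exists (next s (a, true)).
  by rewrite cyclic_classE as_ eqxx.
case: d ds => [a [|]] ds; first by exists a; apply: in_plus.
have [] := alt _ ds; have := ds; rewrite -mem_next; case: (next _ _) => [a' [|]] //= h _ _.
by exists a'; apply: in_plus.
Qed.

(** Following each edge of [Lminus] by the next one is a bijection onto
   [Lplus] that keeps the worker; it transports sums over [Lplus] to sums over
   [Lminus]. *)
Lemma worker_matching : exists rho : E -> E,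
  (forall c, c \in Lminus L -> [/\ rho c \in Lplus L, ew (rho c) = ew c &
     ((c, false), (rho c, true)) \in L]) /\
  (forall G : E -> nat, \sum_(a in Lplus L) G a = \sum_(c in Lminus L) G (rho c)).
Proof.
have [s [_ us eL alt]] := altL.
have inp a : (a \in Lplus L) = ((a, true) \in s).
  rewrite inE eL; apply/existsP/idP => [[d]|as_]; first by rewrite cyclic_classE => /andP[].
  by exists (next s (a, true)); rewrite cyclic_classE as_ eqxx.
have inm a : (a \in Lminus L) = ((a, false) \in s).
  rewrite inE eL; apply/existsP/idP => [[d]|as_]; first by rewrite cyclic_classE => /andP[].
  by exists (next s (a, false)); rewrite cyclic_classE as_ eqxx.
exists (fun c => (next s (c, false)).1); split=> [c|G].
  rewrite inm => cs; have [h1 h2] := alt _ cs; have /= h2' := h2 isT.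
  have eN : next s (c, false) = ((next s (c, false)).1, true).
    by rewrite [LHS]surjective_pairing h1.
  split=> //; first by rewrite inp -eN mem_next.
  by rewrite eL cyclic_classE cs -eN eqxx.
have -> : \sum_(a in Lplus L) G a = \sum_(d <- s | d.2) G d.1.
  rewrite -[RHS]big_filter [RHS]big_uniq ?filter_uniq //=.
  rewrite [RHS](reindex_onto (fun e => (e, true)) fst) /=; last first.
    by move=> [e b]; rewrite mem_filter /= => /andP[->].
  by apply: eq_bigl => e; rewrite inp mem_filter /= eqxx andbT.
have -> : \sum_(c in Lminus L) G (next s (c, false)).1 = \sum_(d <- s | ~~ d.2) G (next s d).1.
  rewrite -[RHS]big_filter [RHS]big_uniq ?filter_uniq //=.
  rewrite [RHS](reindex_onto (fun e => (e, false)) fst) /=; last first.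
    by move=> [e b]; rewrite mem_filter /= => /andP[/negPf ->].
  by apply: eq_bigl => e; rewrite inm mem_filter /= eqxx andbT.
have pn : perm_eq (map (next s) s) s.
  apply: uniq_perm => //.
    by rewrite map_inj_uniq // => d d' h; rewrite -(prev_next us d) h prev_next.
  move=> d; apply/mapP/idP => [[d' d's ->]|ds]; first by rewrite mem_next.
  by exists (prev s d); rewrite ?mem_prev ?next_prev.
rewrite -(perm_big _ pn) big_map big_seq_cond [RHS]big_seq_cond.
by apply: eq_bigl => d; case ds: (d \in s) => //=; have [-> _] := alt _ ds.
Qed.

End OneCycle.

(** A closed walk is recovered from one of its darts by iterating the
   successor function. *)
Lemma alternating_eq L K (altL : alternating L) (altK : alternating K) d d1 d2 :
  (d, d1) \in L -> (d, d2) \in K ->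
  (forall p q q', (p, q) \in L -> (p, q') \in K -> q = q') -> L = K.
Proof.
have [s [_ us eL _]] := altL; have [t [_ ut eK _]] := altK.
rewrite eL eK => dL dK fn.
have {}fn p : p \in s -> p \in t -> next s p = next t p.
  by move=> ps pt; apply: (fn p); rewrite cyclic_classE ?ps ?pt eqxx.
move: dL dK; rewrite !cyclic_classE => /andP[ds _] /andP[dt _].
have sub (u v : seq (dart M)) : uniq u -> d \in u -> d \in v ->
    (forall p, p \in u -> p \in v -> next u p = next v p) -> {subset u <= v}.
  move=> uu du dv fuv p pu.
  have : fconnect (next u) d p by rewrite (fconnect_cycle (cycle_next uu) du).
  case/iter_findex: {pu}(p) / => //.
  elim: (findex _ _ _) => [|n IH] //=.
  have inu : iter n (next u) d \in u by elim: (n) => //= m IHm; rewrite mem_next.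
  by rewrite fuv ?mem_next.
have st : s =i t.
  move=> p; apply/idP/idP; first exact: sub.
  by apply: sub => // q qt qs; rewrite fn.
apply/setP => -[p q]; rewrite !cyclic_classE st; case pt: (p \in t) => //=.
by rewrite fn // st.
Qed.

End Cycles.

(** * Admissible edges, tandems and rotations *)

Section Admissible.
Variables (M : market) (HM : well_formed M).
Local Notation W := (worker M).
Local Notation E := (edge M).
Local Notation CW := (@gchoice M true).
Local Notation CF := (@gchoice M false).
Local Notation gcap := (gcap M).
Local Notation iW := (interesting_for gcap CW).
Local Notation iF := (interesting_for gcap CF).
Local Notation st := (stable_for gcap CW CF).
Implicit Types (w : W) (e a c l : E) (x y z : vec E) (L K : rotation M).

Let HW := gchoice_axioms HM true.
Let HF := gchoice_axioms HM false.

Lemma loadE x e : load x e =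
  top_sum (ew e) (restr x (inl (ew e))) (rank e) + x e.
Proof.
have -> : x e = restr x (inl (ew e)) e by rewrite ffunE /= eqxx.
rewrite -top_sumS // top_sumE /load; apply: eq_big => [e'|e' /andP[we _]].
  by rewrite ltnS /rank; case: eqP => //= ->.
by rewrite ffunE /= we.
Qed.

Lemma interesting_worker x e : vle x gcap ->
  iW x e = (x e < cap e) && (load x e < quota (ew e)).
Proof.
move=> xb; rewrite /interesting_for [gcap e]ffunE; case: ltnP => //= xe.
have x1b : vle (vadd x (vunit 1 e)) gcap by apply: vadd_unit_le; rewrite ?ffunE.
rewrite ffunE /= choice_workerE; last exact: restr_box.
have -> : top_sum (ew e) (restr (vadd x (vunit 1 e)) (inl (ew e))) (index e (ranking (ew e)))
   = top_sum (ew e) (restr x (inl (ew e))) (rank e).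
  rewrite !top_sumE /rank; apply: eq_bigr => e' /andP[we' lt]; rewrite !ffunE.
  by case: (e' =P e) lt => [->|_]; rewrite ?ltnn ?addn0.
rewrite loadE !ffunE /= !eqxx; lia.
Qed.

Definition wsum x w := \sum_(e | ew e == w) x e.

Lemma wsum_le_quota x w : vle x gcap -> CW x = x -> wsum x w <= quota w.
Proof.
move=> xb wx; rewrite /wsum -restr_size.
have := restr_gchoice HM (inl w) xb; rewrite /= wx => ->.
by rewrite choice_worker_size ?geq_minr //; apply: restr_box.
Qed.

Lemma worker_fixed x : vle x gcap -> (forall w, wsum x w <= quota w) -> CW x = x.
Proof.
move=> xb h; apply: (@restr_ext _ true) => -[w|//] _.
rewrite (restr_gchoice HM (inl w)) //= /choice_worker restr_size.
by rewrite h.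
Qed.

Lemma wsum_load x e : wsum x (ew e) =
  load x e + \sum_(e' | (ew e' == ew e) && (rank e < rank e')) x e'.
Proof.
rewrite /wsum (bigID (fun e' => rank e' <= rank e)) /=; congr (_ + _).
by apply: eq_bigl => e'; rewrite ltnNge.
Qed.

(** Otherwise the worker would want [e] as well, and [e] would block. *)
Lemma firm_wants_load x e : st x -> iF x e -> quota (ew e) <= load x e.
Proof.
case=> xb wx fx nb ie; rewrite leqNgt; apply/negP => lt.
have iw : iW x e by rewrite interesting_worker // lt andbT; case/andP: ie; rewrite ffunE.
by have := nb e iw; rewrite ie.
Qed.

Lemma firm_wants_wsum x e : st x -> iF x e -> wsum x (ew e) = quota (ew e).
Proof.
move=> sx ie; have [xb wx _ _] := sx; apply/eqP; rewrite eqn_leq wsum_le_quota //=.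
by rewrite wsum_load; apply: leq_trans (leq_addr _ _); apply: firm_wants_load.
Qed.

Lemma firm_wants_worse0 x e e' : st x -> iF x e -> ew e' = ew e ->
  rank e < rank e' -> x e' = 0.
Proof.
move=> sx ie we lt; have := firm_wants_wsum sx ie; have := firm_wants_load sx ie.
rewrite wsum_load (bigD1 e') /= ?we ?eqxx //; lia.
Qed.

(** At a stable vector this is W-admissibility: [firm_wants_load] makes the
   worker full and places every edge wanted by a firm after the least preferred
   edge in use, so that this edge need not be mentioned. *)
Definition admissible x a : Prop := [/\ 0 < quota (ew a), iF x a &
  forall e, ew e = ew a -> iF x e -> rank a <= rank e].

Lemma admissible_uniq x a a' : admissible x a -> admissible x a' -> ew a = ew a' -> a = a'.
Proof.
move=> [_ i m] [_ i' m'] we; apply: rank_inj => //; apply/eqP.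
by rewrite eqn_leq m ?m'.
Qed.

Lemma admissible_exists x e : 0 < quota (ew e) -> iF x e -> exists2 a, admissible x a & ew a = ew e.
Proof.
move=> q0 ie.
have [a] := arg_minnP (P := fun a => (ew a == ew e) && iF x a) (@rank M)
  (introT andP (conj (eqxx _) ie)).
case/andP=> /eqP wa ia mina; exists a => //; split=> //; first by rewrite wa.
by move=> e' we' ie'; apply: mina; rewrite we' wa eqxx.
Qed.

Lemma W_admissibleP x a : st x -> W_admissible x a <-> admissible x a.
Proof.
move=> sx; have [xb wx fx nb] := sx.
have iFP e : interesting_at (inr (ef e)) x e <-> iF x e.
  by apply: interesting_atP => //=.
split=> [[full [l [[wl xl lmin] [wa la /iFP ia] amin]]]|[q0 ia amin]].
  have q0 : 0 < quota (ew a).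
    rewrite -full restr_size (bigD1 l) /=; last by rewrite wl.
    by rewrite addn_gt0 lt0n xl.
  split=> // e we ie.
  have [->//|/eqP ne] := eqVneq e a.
  have le : rank l <= rank e.
    rewrite leqNgt; apply/negP => lt; move: xl.
    by rewrite (firm_wants_worse0 sx ie (e' := l)) ?wl ?we.
  have : pref (ew a) a e.
    apply: amin => //; last exact/eqP.
    split=> //; last exact/iFP.
    have [->|/eqP nel] := eqVneq e l; first by [].
    apply/orP; right; rewrite -wl pref_rank ?wl //; last by move=> h; apply: nel.
    rewrite ltn_neqAle le andbT; apply/eqP => h.
    by apply: nel; apply/esym/rank_inj; rewrite ?wl.
  by rewrite pref_rank //; [apply: ltnW | move=> h; apply: ne].
have full := firm_wants_wsum sx ia.
split; first by rewrite restr_size.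
have [l0 /andP[wl0 xl0]] : exists l, (ew l == ew a) && (0 < x l).
  apply/existsP; apply: contraLR q0; rewrite negb_exists => /forallP h.
  rewrite -full -leqNgt leqn0 /wsum; apply/eqP/big1 => e we.
  by have := h e; rewrite we /= lt0n negbK => /eqP.
have [l /andP[/eqP wl xl] lmax] := arg_maxnP (P := fun l => (ew l == ew a) && (0 < x l))
  (@rank M) (introT andP (conj wl0 xl0)).
have la : rank l <= rank a.
  rewrite leqNgt; apply/negP => lt; move: xl.
  by rewrite (firm_wants_worse0 sx ia wl lt).
exists l; split.
- split=> //; first by rewrite -lt0n.
  move=> e we xe /eqP ne; rewrite -we pref_rank ?we ?wl //.
  have le : rank e <= rank l by apply: lmax; rewrite we eqxx lt0n xe.
  rewrite ltn_neqAle le andbT; apply/eqP => h.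
  by apply: ne; apply: rank_inj => //; rewrite wl.
- split=> //; last exact/iFP.
  have [->|/eqP ne] := eqVneq a l; first by [].
  apply/orP; right; rewrite -wl pref_rank ?wl //; last by move=> h; apply: ne.
  rewrite ltn_neqAle la andbT; apply/eqP => h.
  by apply: ne; apply/esym/rank_inj.
- move=> e [we _ /iFP ie] /eqP ne; rewrite pref_rank //; last by move=> h; apply: ne.
  rewrite ltn_neqAle amin // andbT; apply/eqP => h.
  by apply: ne; apply/esym/rank_inj.
Qed.

Lemma tandemP x a c : st x ->
  tandem x a c <-> [/\ admissible x a, c <> a & swaps CF x 1 a c].
Proof.
move=> sx; have [xb wx fx nb] := sx.
have up : admissible x a -> vle (vadd x (vunit 1 a)) gcap.
  by case=> _ /andP[xa _] _; apply: vadd_unit_le.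
split=> [[/(W_admissibleP _ sx) ha ec ca ex]|[ha ca sw]].
  by split=> //; apply/(exchangesP HM) => //; apply: up.
have ec := swaps_firm xb fx sw ca.
by split=> //; [apply/W_admissibleP | apply/(exchangesP HM) => //; apply: up].
Qed.

(** At a stable vector this is applicability of [L], with the active graph
   eliminated. *)
Definition rotates x L : Prop := alternating L /\
  forall a c, turn L a c -> [/\ admissible x a, c <> a & swaps CF x 1 a c].

(** Cleaning never deletes a dart of a closed alternating walk of tandems,
   because each worker on it keeps an entering edge and each of its
   F-admissible edges keeps its tandem. So every such walk survives into the
   active graph. *)
Lemma applicableP x L : st x -> applicable x L <-> rotates x L.
Proof.
move=> sx; split=> [[G [s [actG s0 /andP[cyc us] ->]]]|[altL tanL]].
  have arc d : d \in s -> consecutive x G d (next s d) by apply: next_cycle.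
  split.
    exists s; split=> // d ds; have := arc d ds; rewrite /consecutive => /and3P[_ _].
    by case: d.2; case: (next s d).2 => // /eqP ->.
  move=> a c; rewrite /turn cyclic_classE => /andP[as_ /eqP e].
  by have := arc _ as_; rewrite -e /consecutive /= => /and3P[_ _ /asboolP/(tandemP _ _ sx)].
have tan a c : turn L a c -> tandem x a c by move/tanL => h; apply/tandemP.
have [s [s0 us eL alt]] := altL.
have inD d : d \in s -> d \in D x.
  case: d => [a [|]] ds; rewrite inE /=; apply/asboolP.
    have [|c t] := plus_turn altL (a := a); last by apply/W_admissibleP => //; case: (tanL _ _ t).
    by rewrite inE eL; apply/existsP; exists (next s (a, true)); rewrite cyclic_classE ds eqxx.
  have [|b t] := minus_turn altL (c := a); last by exists b; apply: tan.
  by rewrite inE eL; apply/existsP; exists (next s (a, false)); rewrite cyclic_classE ds eqxx.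
have keep (G G' : {set dart M}) : {subset s <= G} -> clean_step x G G' -> {subset s <= G'}.
  move=> sG /existsP[a /and3P[aG noent /eqP ->]] d ds; rewrite inE sG //=.
  have na : (a, true) \notin s.
    apply/negP => as_; have ps : prev s (a, true) \in s by rewrite mem_prev.
    have [] := alt _ ps; rewrite next_prev //=.
    case eP: (prev s (a, true)) => [c [|]] //= _ /(_ isT) we.
    move/forallP/(_ c): noent; rewrite we eqxx /= => /negP; apply.
    by apply: sG; rewrite -eP.
  apply/andP; split; first by apply: contra na => /eqP <-.
  apply/negP => /and3P[]; case: d ds => [c [|]] //= cs _ /asboolP tac /negP; apply.
  have [|b t] := minus_turn altL (c := c).
    by rewrite inE eL; apply/existsP; exists (next s (c, false)); rewrite cyclic_classE cs eqxx.
  have bs : (b, true) \in s by move: t; rewrite /turn eL cyclic_classE => /andP[].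
  apply/existsP; exists b; rewrite sG //=.
  apply/andP; split; first by apply: contra na => /eqP <-.
  by apply/asboolP/tan.
have [G [actG sG]] : exists G, is_active_graph x G /\ {subset s <= G}.
  have [n] := ubnP #|D x|; have : connect (clean_step x) (D x) (D x) by apply: connect0.
  move: inD; move: {1 3 4}(D x) => G.
  elim: n G => // n IH G sG con lt.
  have [/forallP fin|] := boolP [forall G', ~~ clean_step x G G'].
    by exists G; split=> //; apply/andP; split=> //; apply/forallP.
  rewrite negb_forall => /existsP[G']; rewrite negbK => step.
  apply: (IH G'); first exact: keep step.
    exact: connect_trans con (connect1 step).
  rewrite ltnS in lt; apply: leq_trans lt; apply: proper_card.
  case/existsP: step => a /and3P[aG _ /eqP ->]; apply/properP; split.
    by apply/fintype.subsetP => d; rewrite inE => /andP[].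
  by exists (a, true) => //; rewrite inE eqxx /= andbF.
exists G, s; split=> //; apply/andP; split=> //.
apply: cycle_from_next => // d ds; rewrite /consecutive sG // sG ?mem_next //=.
have [h1 h2] := alt _ ds.
case: d ds h1 h2 => [a [|]] ds /=; case eN: (next s _) => [c [|]] //= _ we.
  by apply/asboolP/tan; rewrite /turn eL cyclic_classE ds eN eqxx.
by rewrite we.
Qed.

End Admissible.

(** * Shifting along rotations *)

Section Shifts.
Variables (M : market) (HM : well_formed M).
Local Notation W := (worker M).
Local Notation E := (edge M).
Local Notation CW := (@gchoice M true).
Local Notation CF := (@gchoice M false).
Local Notation gcap := (gcap M).
Local Notation iF := (interesting_for gcap CF).
Local Notation st := (stable_for gcap CW CF).
Local Notation leF := (below CF).
Implicit Types (w : W) (e a c : E) (x y z : vec E) (L K : rotation M).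

Let HW := gchoice_axioms HM true.
Let HF := gchoice_axioms HM false.

Lemma rotates_plus x L a : rotates x L -> a \in Lplus L -> admissible x a.
Proof. by case=> altL tan /(plus_turn altL)[c /tan[]]. Qed.

Lemma admissible_interesting x a : admissible x a -> iF x a. Proof. by case. Qed.

Lemma admissible_room x a : admissible x a -> x a < cap a.
Proof. by case=> _ /andP[]; rewrite ffunE. Qed.

Lemma rotates_minus x L c : st x -> rotates x L -> c \in Lminus L -> ~~ iF x c.
Proof.
move=> [xb _ fx _] [altL tan] /(minus_turn altL)[a /tan[[_ /andP[xa _] _] ca sw]].
exact: swapped_out_not_interesting sw ca.
Qed.

(** Edges of [Lplus] are wanted by their firm, those of [Lminus] are pushed
   out and hence unwanted. *)
Lemma plus_minus x L a : st x -> rotates x L -> a \in Lplus L -> a \notin Lminus L.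
Proof.
move=> sx aL aP; apply/negP => /(rotates_minus sx aL).
by rewrite (admissible_interesting (rotates_plus aL aP)).
Qed.

(** Feasibility of the weight [k], read on vectors over all edges. *)
Definition shiftable x L k : Prop := [/\ 0 < k, forall c, c \in Lminus L -> k <= x c,
  forall a, a \in Lplus L -> k <= cap a - x a &
  forall a c, turn L a c -> swaps CF x k a c].

(** The menu from which the firms choose the shifted vector. *)
Definition with_plus x L k : vec E := [ffun e => x e + k * (e \in Lplus L)].

Lemma vadd_unit_le_gcap x k a : vle x gcap -> k <= cap a - x a -> vle (vadd x (vunit k a)) gcap.
Proof.
move=> xb ka; apply/vleP => e; have := vleP _ _ xb e; rewrite !ffunE.
by case: (e =P a) ka => [->|_]; lia.
Qed.

Lemma feasible_shiftable x L k : st x -> rotates x L -> feasible x L k <-> shiftable x L k.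
Proof.
move=> sx aL; have [xb wx fx nb] := sx; have [altL tan] := aL.
have firm a c : turn L a c -> ef c = ef a.
  by case/tan => _ ca sw; apply: swaps_firm sw ca.
split=> -[k0 hm hp ht]; split=> // a c t.
  apply/(exchangesP HM) => //; [|exact: firm t|exact: ht].
  by apply: vadd_unit_le_gcap => //; apply: hp; apply: turn_plus t.
apply/(exchangesP HM) => //; [|exact: firm t|exact: ht].
by apply: vadd_unit_le_gcap => //; apply: hp; apply: turn_plus t.
Qed.

Lemma shiftable1 x L : st x -> rotates x L -> shiftable x L 1.
Proof.
move=> sx aL; have [altL tan] := aL; split=> //.
- move=> c /(minus_turn altL)[a /tan[_ ca /ffunP/(_ c)]]; rewrite !ffunE eqxx.
  by case: eqP => // _; lia.
- by move=> a /(rotates_plus aL)/admissible_room; lia.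
- by move=> a c /tan[].
Qed.

Lemma plus_minus_sum x L w : rotates x L ->
  \sum_(e | ew e == w) (e \in Lplus L) = \sum_(e | ew e == w) (e \in Lminus L) :> nat.
Proof.
move=> [altL _]; have [rho [h1 h2]] := worker_matching altL.
have toA (A : {set E}) : \sum_(e | ew e == w) (e \in A) = \sum_(e in A) (ew e == w) :> nat.
  rewrite big_mkcond [RHS]big_mkcond; apply: eq_bigr => e _.
  by case: (e \in A); case: (ew e == w).
rewrite !toA (h2 (fun e => ew e == w)); apply: eq_bigr => c cm.
by have [_ -> _] := h1 c cm.
Qed.

Lemma shiftE x L k e : st x -> rotates x L -> shiftable x L k ->
  shift x L k e + k * (e \in Lminus L) = x e + k * (e \in Lplus L).
Proof.
move=> sx aL [_ hm _ _]; rewrite ffunE.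
case eM: (e \in Lminus L); last by rewrite muln0 addn0 subn0.
by have := hm e eM; lia.
Qed.

Lemma shift_plus x L k e : st x -> rotates x L -> shiftable x L k -> e \notin Lminus L ->
  shift x L k e = x e + k * (e \in Lplus L).
Proof. by move=> sx aL fe /negPf eM; rewrite -shiftE // eM muln0 addn0. Qed.

Lemma shift_minus x L k e : st x -> rotates x L -> shiftable x L k -> e \in Lminus L ->
  shift x L k e = x e - k.
Proof.
move=> sx aL fe eM; have := shiftE e sx aL fe; rewrite eM.
have : e \notin Lplus L by apply/negP => /(plus_minus sx aL); rewrite eM.
by move=> /negPf ->; lia.
Qed.

Lemma shift_wsum x L k w : st x -> rotates x L -> shiftable x L k ->
  wsum (shift x L k) w = wsum x w.
Proof.
move=> sx aL fe; apply/(@addIn (k * \sum_(e | ew e == w) (e \in Lminus L))).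
rewrite -[in RHS](plus_minus_sum w aL) !big_distrr /= -!big_split /=.
by apply: eq_bigr => e _; apply: shiftE.
Qed.

Lemma vsize_wsum x : vsize x = \sum_w wsum x w.
Proof. exact: partition_big. Qed.

Lemma shift_size x L k : st x -> rotates x L -> shiftable x L k -> vsize (shift x L k) = vsize x.
Proof.
by move=> sx aL fe; rewrite !vsize_wsum; apply: eq_bigr => w _; apply: shift_wsum.
Qed.

Lemma with_plus_le x L k : st x -> shiftable x L k -> vle (with_plus x L k) gcap.
Proof.
move=> [xb _ _ _] [_ _ hp _]; apply/vleP => e; have := vleP _ _ xb e; rewrite !ffunE.
by case eP: (e \in Lplus L); [have := hp e eP; lia | lia].
Qed.

Lemma le_with_plus x L k : vle x (with_plus x L k).
Proof. by apply/vleP => e; rewrite ffunE leq_addr. Qed.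

(** Each tandem is present in the common menu, so by (A2) each edge of
   [Lminus] loses at least [k]; the sizes balance, and (A3) leaves room for
   nothing else. *)
Lemma shift_choice x L k : st x -> rotates x L -> shiftable x L k ->
  CF (with_plus x L k) = shift x L k.
Proof.
move=> sx aL fe; have [xb wx fx nb] := sx; have [altL tan] := aL.
have zb := with_plus_le sx fe; have xz := le_with_plus x L k.
apply: (size_squeeze HF zb fx xz); last by rewrite shift_size.
apply/vleP => e; case eM: (e \in Lminus L); last first.
  by rewrite shift_plus ?eM //; have := choice_leE HF e zb; rewrite [with_plus _ _ _ _]ffunE.
rewrite shift_minus //; have [a t] := minus_turn altL eM.
have [k0 hm hp ht] := fe; have [_ ca _] := tan _ _ t.
have s := swaps_coord e (ht _ _ t) ca; rewrite eqxx in s.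
have km := hm e eM.
have ne : (e == a) = false by apply/eqP.
rewrite ne in s.
apply: leq_trans (choice_reduced HF (t := vadd x (vunit k a)) zb _ _) _.
- apply/vleP => i; rewrite !ffunE leq_add2l; case: eqP => [->|_]; last by rewrite muln0.
  by rewrite (turn_plus t).
- by rewrite [vadd _ _ _]ffunE [vunit _ _ _]ffunE ne; lia.
- by lia.
Qed.

Lemma shift_below x L k : st x -> rotates x L -> shiftable x L k -> leF x (shift x L k).
Proof.
move=> sx aL fe; apply: (below_menu HF (with_plus_le sx fe)) (shift_choice sx aL fe).
exact: le_with_plus.
Qed.

Lemma shift_le_gcap x L k : st x -> rotates x L -> shiftable x L k -> vle (shift x L k) gcap.
Proof.
move=> sx aL fe; rewrite -shift_choice //; have zb := with_plus_le sx fe.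
exact: vle_trans (choice_le HF zb) zb.
Qed.

(** The shift adds load only on admissible edges, which are at least as good
   as any edge [e] wanted by a firm, and it keeps the worker full. *)
Lemma shift_load x L k e : st x -> rotates x L -> shiftable x L k -> iF x e ->
  quota (ew e) <= load (shift x L k) e.
Proof.
move=> sx aL fe ie; rewrite -(firm_wants_wsum HM sx ie) -(shift_wsum _ sx aL fe).
rewrite wsum_load -[leqRHS]addn0 leq_add2l leqn0; apply/eqP/big1 => e' /andP[/eqP we lt].
have x0 := firm_wants_worse0 HM sx ie we lt.
rewrite ffunE x0; case eP: (e' \in Lplus L); last by rewrite muln0 addn0 sub0n.
have [_ _ m] := rotates_plus aL eP.
by have := m e (esym we) ie; rewrite leqNgt lt.
Qed.

(** A firm wanting [e] after the shift wanted it before, and then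
   [shift_load] keeps the worker from wanting it. *)
Lemma shift_stable x L k : st x -> rotates x L -> shiftable x L k -> st (shift x L k).
Proof.
move=> sx aL fe; have [xb wx fx nb] := sx.
have zb := with_plus_le sx fe; have xb' := shift_le_gcap sx aL fe.
split=> //.
- by apply: worker_fixed => // w; rewrite shift_wsum //; apply: wsum_le_quota.
- by rewrite -shift_choice // (choice_idem HF zb).
- move=> e; rewrite interesting_worker // => /andP[_ lt]; apply/negP => ie.
  have [ix _] := interesting_back HF xb xb' fx (shift_below sx aL fe) ie.
  by move: lt; rewrite ltnNge shift_load.
Qed.

(** Among stable vectors the orders of the firms and of the workers are
   opposite, and the workers' order is easier to test: it only depends on
   loads. *)
Lemma shift_below_target x y L k : st x -> st y -> rotates x L -> shiftable x L k -> leF x y ->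
  (forall c, c \in Lminus L -> y c <= shift x L k c) -> leF (shift x L k) y.
Proof.
move=> sx sy aL fe xy hc; have [xb wx fx nb] := sx; have [yb wy fy _] := sy.
have sx' := shift_stable sx aL fe; have [xb' wx' fx' _] := sx'.
apply: (below_dual HW HF sy sx'); rewrite /below.
apply: (menu_rejected HW) => //; [exact: vjoin_le | exact: vjoin_r |].
move=> e; rewrite [vjoin _ _ _]ffunE => lt.
rewrite interesting_worker // negb_and -[X in _ || X]leqNgt shift_load ?orbT //.
apply: (below_interesting HF (y := y)) => //; rewrite xy.
have [eM|eM] := boolP (e \in Lminus L); first by have := hc e eM; lia.
by move: lt; rewrite shift_plus //; lia.
Qed.

(** If [y] exceeded the shifted vector on an edge of [Lminus], the firm
   would want that edge back. *)
Lemma below_shift_minus x y L k c : st x -> st y -> rotates x L -> shiftable x L k ->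
  leF (shift x L k) y -> c \in Lminus L -> y c <= shift x L k c.
Proof.
move=> sx sy aL fe x'y cM; have [xb wx fx nb] := sx; have [yb wy fy _] := sy.
have [xb' _ _ _] := shift_stable sx aL fe.
rewrite leqNgt; apply/negP => lt.
have ic : iF (shift x L k) c by apply: (below_interesting HF (y := y)); rewrite ?x'y.
have [] := interesting_back HF xb xb' fx (shift_below sx aL fe) ic.
by rewrite (negPf (rotates_minus sx aL cM)).
Qed.

Lemma admissible_up x y a : st x -> st y -> leF x y -> admissible x a -> iF y a -> admissible y a.
Proof.
move=> [xb _ fx _] [yb _ _ _] xy [q0 _ m] ia; split=> // e we ie; apply: m => //.
by have [] := interesting_back HF xb yb fx xy ie.
Qed.

(** Both kinds of turns are determined by the vector: the partner of a
   tandem is unique, and so is the admissible edge of a worker. Hence distinct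
   applicable rotations share no dart. *)
Lemma same_dart x L K d d1 d2 : rotates x L -> rotates x K ->
  (d, d1) \in L -> (d, d2) \in K -> L = K.
Proof.
move=> aL aK dL dK; have [altL tanL] := aL; have [altK tanK] := aK.
apply: (alternating_eq altL altK dL dK) => p q q' pL pK.
have [qb qw [r qr]] := pair_shape altL pL; have [qb' qw' [r' qr']] := pair_shape altK pK.
case: p q q' => [p [|]] [q bq] [q' bq'] /= in pL pK qb qw qb' qw' qr qr' *; subst bq bq'.
  have [_ qp sw] := tanL _ _ pL; have [_ _ sw'] := tanK _ _ pK.
  by rewrite (swaps_uniq sw sw').
have qP : q \in Lplus L by rewrite inE; apply/existsP; exists r.
have qP' : q' \in Lplus K by rewrite inE; apply/existsP; exists r'.
by rewrite (admissible_uniq (rotates_plus aL qP) (rotates_plus aK qP')) // qw // qw'.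
Qed.

Lemma plus_disjoint x L K e : rotates x L -> rotates x K -> L <> K ->
  e \in Lplus L -> e \notin Lplus K.
Proof.
move=> aL aK ne eL; apply/negP => eK; apply: ne.
by have [c t] := plus_turn aL.1 eL; have [c' t'] := plus_turn aK.1 eK; exact: (same_dart aL aK t t').
Qed.

Lemma minus_disjoint x L K e : rotates x L -> rotates x K -> L <> K ->
  e \in Lminus L -> e \notin Lminus K.
Proof.
move=> aL aK ne; rewrite inE => /existsP[d dL]; rewrite inE; apply/negP => /existsP[d' dK].
by apply: ne; exact: (same_dart aL aK dL dK).
Qed.

(** Local confluence. Distinct rotations share no edge, so the tandems of
   [K] carry over to the larger menu of the shift along [L]. *)
Lemma rotates_shift x L K : st x -> rotates x L -> rotates x K -> L <> K -> rotates (shift x L 1) K.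
Proof.
move=> sx aL aK ne; have fe := shiftable1 sx aL; have [altK tanK] := aK.
have sx' := shift_stable sx aL fe; split=> // a c t.
have [ad ca sw] := tanK _ _ t; have [xb wx fx _] := sx; have [xb' wx' fx' _] := sx'.
have aP := turn_plus t; have cM := turn_minus altK t.
have aPL : a \notin Lplus L by apply: plus_disjoint aK aL (not_eq_sym ne) aP.
have aML : a \notin Lminus L.
  by apply/negP => /(rotates_minus sx aL); rewrite (admissible_interesting ad).
have cML : c \notin Lminus L by apply: minus_disjoint aK aL (not_eq_sym ne) cM.
have xa' : shift x L 1 a = x a by rewrite shift_plus // (negPf aPL) muln0 addn0.
have room := admissible_room ad.
have s := swaps_coord c sw ca; have nca : (c == a) = false by apply/eqP.
rewrite eqxx nca muln1 muln0 addn0 addn1 in s.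
have sw' : swaps CF (shift x L 1) 1 a c.
  apply: (swaps_transport HF (x := x) (z := with_plus x L 1) (t := vadd x (vunit 1 a))) => //.
  - apply: vadd_unit_le; first exact: with_plus_le.
    by rewrite !ffunE (negPf aPL) muln0 addn0.
  - exact: le_with_plus.
  - exact: shift_choice.
  - by rewrite shift_size.
  - by apply/vleP => e; rewrite !ffunE leq_add2r leq_addr.
  - by rewrite [vadd _ _ _]ffunE [vunit _ _ _]ffunE nca muln0 addn0 s.
  - by rewrite shift_plus // s leq_addr.
split=> //; apply: (admissible_up sx sx' (shift_below sx aL fe) ad).
by apply: (swaps_interesting xb' _ sw' ca); rewrite [ltnRHS]ffunE xa'.
Qed.

Lemma shift_comm x L K : st x -> rotates x L -> rotates x K -> L <> K ->
  shift (shift x L 1) K 1 = shift (shift x K 1) L 1.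
Proof.
move=> sx aL aK ne; apply/ffunP => e; rewrite !ffunE.
have [_ mL _ _] := shiftable1 sx aL; have [_ mK _ _] := shiftable1 sx aK.
have pp : ~~ ((e \in Lplus L) && (e \in Lplus K)).
  by apply/negP => /andP[/(plus_disjoint aL aK ne)/negPf ->].
have mm : ~~ ((e \in Lminus L) && (e \in Lminus K)).
  by apply/negP => /andP[/(minus_disjoint aL aK ne)/negPf ->].
have pm : ~~ ((e \in Lplus L) && (e \in Lminus K)).
  by apply/negP => /andP[/(rotates_plus aL)/admissible_interesting i /(rotates_minus sx aK)]; rewrite i.
have mp : ~~ ((e \in Lminus L) && (e \in Lplus K)).
  by apply/negP => /andP[/(rotates_minus sx aL)/negP i /(rotates_plus aK)/admissible_interesting].
by move: pp mm pm mp; do 4 case: (e \in _) => //=; lia.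
Qed.

(** The other half of confluence: by [shift_below_target] lying below [y] is
   a condition on the edges of [Lminus] alone, and those of [L] and [K] are
   disjoint. *)
Lemma both_below x y L K : st x -> st y -> rotates x L -> rotates x K -> L <> K ->
  leF (shift x L 1) y -> leF (shift x K 1) y -> leF (shift (shift x L 1) K 1) y.
Proof.
move=> sx sy aL aK ne Ly Ky.
have fL := shiftable1 sx aL; have fK := shiftable1 sx aK.
have sL := shift_stable sx aL fL; have aLK := rotates_shift sx aL aK ne.
apply: shift_below_target => //; first exact: shiftable1.
move=> c cM; have := below_shift_minus sx sy aK fK Ky cM.
rewrite (shift_minus sL aLK (shiftable1 sL aLK) cM) (shift_minus sx aK fK cM).
have cML := minus_disjoint aK aL (not_eq_sym ne) cM.
by rewrite (shift_plus sx aL fL cML); lia.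
Qed.

Lemma rank_up x L c a : st x -> rotates x L -> c \in Lminus L -> a \in Lplus L ->
  ew a = ew c -> rank c < rank a.
Proof.
move=> sx aL cM aP we; have ia := admissible_interesting (rotates_plus aL aP).
have [_ hm _ _] := shiftable1 sx aL.
rewrite ltn_neqAle; apply/andP; split.
  apply/eqP => h; have := rotates_minus sx aL cM.
  by rewrite (rank_inj (esym we) h) ia.
rewrite leqNgt; apply/negP => lt.
by have := hm c cM; rewrite (firm_wants_worse0 HM sx ia (esym we) lt).
Qed.

(** Rank-weighted size: a linear function that grows along every rotation by
   an amount depending on the rotation only, since a rotation moves each of its
   workers to a less preferred edge. *)
Definition potential x := \sum_e rank e * x e.
Definition gain L := \sum_(a in Lplus L) rank a - \sum_(c in Lminus L) rank c.

Lemma shift_potential x L : st x -> rotates x L ->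
  potential (shift x L 1) = potential x + gain L /\ 0 < gain L.
Proof.
move=> sx aL; have fe := shiftable1 sx aL.
have [rho [h1 h2]] := worker_matching aL.1.
have lt c : c \in Lminus L -> rank c < rank (rho c).
  by move=> cM; have [aP we _] := h1 c cM; exact: (rank_up sx aL cM aP we).
have lts : \sum_(c in Lminus L) rank c < \sum_(a in Lplus L) rank a.
  rewrite h2; have [a [c t]] := alternating_nonempty aL.1.
  have cM := turn_minus aL.1 t.
  rewrite (bigD1 c) //= [ltnRHS](bigD1 c) //= -addSn leq_add ?lt //.
  by apply: leq_sum => i /andP[iM _]; apply/ltnW/lt.
split; last by rewrite subn_gt0.
apply/(@addIn (\sum_(c in Lminus L) rank c)).
rewrite -addnA [gain L + _]subnK; last exact: ltnW.
have toA (A : {set E}) : \sum_(e in A) rank e = \sum_e rank e * (e \in A).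
  by rewrite big_mkcond; apply: eq_bigr => e _; case: ifP; rewrite ?muln1 ?muln0.
rewrite !toA -!big_split /=; apply: eq_bigr => e _.
by have := shiftE e sx aL fe; rewrite -!mulnDr !mul1n => ->.
Qed.

(** * Existence of rotations *)

(** Each worker's total can only drop on the way up, while the grand total
   is constant. *)
Lemma wsum_eq x y w : st x -> st y -> leF x y -> wsum x w = wsum y w.
Proof.
move=> sx sy xy; have [xb wx fx _] := sx; have [yb wy fy _] := sy.
have sz := stable_size HF HW (stable_for_sym sx) (stable_for_sym sy) xy.
have yx : below CW y x := below_dual HF HW (stable_for_sym sx) (stable_for_sym sy) xy.
have jb : vle (vjoin y x) gcap by apply: vjoin_le.
have cwE z w' : vle z gcap -> wsum (CW z) w' = minn (wsum z w') (quota w').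
  move=> zb; rewrite /wsum -!restr_size (restr_gchoice HM (inl w')) //=.
  by rewrite choice_worker_size //; apply: restr_box.
have le w' : wsum y w' <= wsum x w'.
  rewrite -yx cwE // leq_min wsum_le_quota // andbT /wsum.
  by apply: leq_sum => e _; rewrite ffunE leq_maxl.
apply/eqP; rewrite eqn_leq le andbT; move: sz; rewrite !vsize_wsum.
rewrite (bigD1 w) //= [RHS](bigD1 w) //=.
have : \sum_(i | i != w) wsum y i <= \sum_(i | i != w) wsum x i by apply: leq_sum.
by lia.
Qed.

Lemma gains_elsewhere x y c : st x -> st y -> leF x y -> y c < x c ->
  exists2 e, ew e = ew c & x e < y e.
Proof.
move=> sx sy xy lt; apply: contrapT => no.
have := wsum_eq (ew c) sx sy xy; rewrite /wsum (bigD1 c) //= [RHS](bigD1 c) //=.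
have : \sum_(i | (ew i == ew c) && (i != c)) y i <= \sum_(i | (ew i == ew c) && (i != c)) x i.
  apply: leq_sum => i /andP[/eqP wi _]; rewrite leqNgt; apply/negP => h.
  by apply: no; exists i.
by lia.
Qed.

(** Let [a] be the admissible edge of the worker of [e0]. In [y] the firm of
   [a] either has more of [a] or does not want it any more, so adding one unit
   of [a] to the join of [x] and [y] does not change the choice [y]. As [x] and
   [y] have the same size, [a] pushes out some [c] at [x], and by (A2) this [c]
   is reduced in [y] as well. *)
Lemma moved_tandem x y e0 : st x -> st y -> leF x y -> x e0 < y e0 ->
  exists a c, [/\ admissible x a, ew a = ew e0, c <> a, swaps CF x 1 a c & y c < x c].
Proof.
move=> sx sy xy lt; have [xb wx fx nb] := sx; have [yb wy fy nby] := sy.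
have jb : vle (vjoin x y) gcap by apply: vjoin_le.
have ie0 : iF x e0 by apply: (below_interesting HF (y := y)); rewrite ?xy.
have q0 : 0 < quota (ew e0).
  apply: leq_trans (wsum_le_quota HM (ew e0) yb wy).
  by rewrite /wsum (bigD1 e0) //=; move: lt; lia.
have [a ad wa] := admissible_exists q0 ie0.
have ia := admissible_interesting ad; have room := admissible_room ad.
have x1b : vle (vadd x (vunit 1 a)) gcap by apply: vadd_unit_le => //; rewrite ffunE.
set big := vjoin (vjoin x y) (vadd x (vunit 1 a)).
have bigb : vle big gcap by apply: vjoin_le.
have Cbig : CF big = y.
  have [le|gt] := leqP (y a) (x a); last first.
    rewrite -[RHS]xy; congr CF; apply/ffunP => e; rewrite !ffunE.
    by case: (e =P a) => [->|_]; clear -gt; lia.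
  have nia : ~~ iF y a.
    apply/negP => iya; have ne : rank a <> rank e0.
      by move=> h; move: lt; rewrite -(rank_inj wa h) ltnNge le.
    have ra : rank a < rank e0.
      by rewrite ltn_neqAle; apply/andP; split; [apply/eqP | case: ad => _ _; apply].
    by move: lt; rewrite (firm_wants_worse0 HM sy iya (esym wa) ra).
  have ya : y a < gcap a by rewrite ffunE; apply: leq_ltn_trans room.
  have Cy := not_interesting HF yb fy ya nia.
  rewrite -[RHS]xy; apply/esym/(choice_A1 HF bigb); first exact: vjoin_l.
  apply/vleP => e; have h := choice_leE HF e bigb.
  have [ea|ne] := eqVneq e a; last first.
    by move: h; rewrite !ffunE (negPf ne) muln0 addn0; clear; lia.
  rewrite ea; apply: (@leq_trans (x a)); last by rewrite ffunE leq_maxl.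
  have [lt'|ge'] := ltnP (y a) (x a).
    apply: leq_trans (choice_reduced HF (t := vjoin x y) bigb (vjoin_l _ _) _) _;
    by rewrite xy ?ffunE; clear -lt'; lia.
  have yab : vle (vadd y (vunit 1 a)) big.
    by apply/vleP => i; rewrite !ffunE; case: (i =P a) => [->|_]; clear -ge' le; lia.
  have := choice_A2E HF a bigb yab; rewrite Cy [vadd _ _ a]ffunE [vunit _ _ a]ffunE eqxx.
  clear -le; lia.
have sxy := stable_size HF HW (stable_for_sym sx) (stable_for_sym sy) xy.
have [same|[c ca sw]] := interesting_cases HF xb fx ia.
  have := choice_A3 HF bigb (vjoin_r (vjoin x y) (vadd x (vunit 1 a))).
  by rewrite -/big Cbig same vsize_add vsize_unit sxy addn1 ltnn.
exists a, c; split=> //.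
have nca : (c == a) = false by apply/eqP.
have s := swaps_coord c sw ca; rewrite eqxx nca in s.
have := choice_reduced HF (t := vadd x (vunit 1 a)) (e := c) bigb (vjoin_r _ _).
rewrite Cbig [vadd _ _ c]ffunE [vunit _ _ c]ffunE nca; clear -s; lia.
Qed.

(** The edges reduced between [x] and [y] and the admissible edges of their
   workers are linked by [gains_elsewhere] and [moved_tandem] into an infinite
   walk; the cycle it eventually enters is a rotation. *)
Lemma next_rotation x y : st x -> st y -> leF x y -> x <> y ->
  exists2 L, rotates x L & leF (shift x L 1) y.
Proof.
move=> sx sy xy ne.
have sxy := stable_size HF HW (stable_for_sym sx) (stable_for_sym sy) xy.
pose good (d : dart M) := if d.2 then admissible x d.1 /\
  (exists c, [/\ c <> d.1, swaps CF x 1 d.1 c & y c < x c]) else y d.1 < x d.1.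
have step (d : dart M) : exists d' : dart M, good d -> [/\ good d', d'.2 = ~~ d.2,
    ~~ d.2 -> ew d'.1 = ew d.1 &
    d.2 -> [/\ admissible x d.1, d'.1 <> d.1 & swaps CF x 1 d.1 d'.1]].
  case: d => [e [|]]; rewrite /good /=.
    have [[ha [c [ce sw lt]]]|no] := pselect (admissible x e /\
        exists c, [/\ c <> e, swaps CF x 1 e c & y c < x c]); last by exists (e, true).
    by exists (c, false).
  have [lt|ge] := ltnP (y e) (x e); last by exists (e, false).
  have [e0 we0 lt0] := gains_elsewhere sx sy xy lt.
  have [a [c [ha wa ca sw ltc]]] := moved_tandem sx sy xy lt0.
  exists (a, true) => _; split=> //=; last by rewrite wa.
  by split=> //; exists c.
have [g gP] := boolp.choice step.
have [c0 lt0] : exists c, y c < x c.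
  apply: contrapT => no; apply: ne; apply: vle_size_eq; last by rewrite sxy.
  by apply/vleP => e; rewrite leqNgt; apply/negP => lt; apply: no; exists e.
have gooditer n : good (iter n g (c0, false)) by elim: n => [|n IH] //=; have [] := gP _ IH.
have /loopingP := looping_order g (c0, false).
move/(_ (order g (c0, false))); case/trajectP => i lti ei.
set d := iter i g (c0, false) in ei.
have per : exists k, iter k.+1 g d = d.
  exists (order g (c0, false) - i).-1; rewrite prednK ?subn_gt0 //.
  by rewrite /d -iterD subnK // ltnW.
have cyc : fcycle g (orbit g d) := iffRL (orbitPcycle 0 3) per.
set s := orbit g d in cyc.
have nextE p : p \in s -> next s p = g p by move=> /(next_cycle cyc)/eqP.
have goods p : p \in s -> good p.
  by rewrite -fconnect_orbit => /iter_findex <-; rewrite /d -iterD.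
have us : uniq s := orbit_uniq g d.
have alt : alternating (cyclic_class s).
  exists s; split=> //; first by rewrite /s /orbit -orderSpred.
  by move=> p ps; rewrite nextE //; have [] := gP p (goods p ps).
have aL : rotates x (cyclic_class s).
  split=> // a c; rewrite /turn cyclic_classE => /andP[as_]; rewrite nextE // => /eqP e.
  by have [_ _ _ /(_ isT)] := gP _ (goods _ as_); rewrite -e.
exists (cyclic_class s) => //; have fe := shiftable1 sx aL.
apply: shift_below_target => // c cM; rewrite shift_minus //.
move: cM; rewrite inE => /existsP[d']; rewrite cyclic_classE => /andP[/goods + _].
by rewrite /good /=; lia.
Qed.

End Shifts.

(** * Consequences of the gapless condition *)

Section Gapless.
Variables (M : market) (HM : well_formed M).
Local Notation E := (edge M).
Local Notation CW := (@gchoice M true).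
Local Notation CF := (@gchoice M false).
Local Notation gcap := (gcap M).
Local Notation iF := (interesting_for gcap CF).
Local Notation st := (stable_for gcap CW CF).
Local Notation leF := (below CF).
Implicit Types (e a c : E) (x y z : vec E) (L K : rotation M).

Let HW := gchoice_axioms HM true.
Let HF := gchoice_axioms HM false.

Lemma swaps_value x k a c : swaps CF x k a c -> c <> a ->
  CF (vadd x (vunit k a)) c + k = x c.
Proof.
move=> sw ca; have := swaps_coord c sw ca; rewrite eqxx muln1.
by move/eqP/negPf: ca => ->; rewrite muln0 addn0.
Qed.

Lemma vadd_unit_other x k a c : c <> a -> vadd x (vunit k a) c = x c.
Proof. by move=> /eqP/negPf ca; rewrite !ffunE ca muln0 addn0. Qed.

Lemma vadd_unit_same x k a : vadd x (vunit k a) a = x a + k.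
Proof. by rewrite !ffunE eqxx muln1. Qed.

Lemma vadd_unit_mono x z k a : vle x z -> vle (vadd x (vunit k a)) (vadd z (vunit k a)).
Proof. by move=> /vleP xz; apply/vleP => e; rewrite !ffunE leq_add2r. Qed.

Lemma shiftable_down x L k i : st x -> rotates x L -> shiftable x L k -> 0 < i <= k -> shiftable x L i.
Proof.
move=> sx aL [k0 hm hp ht] /andP[i0 ik]; have [xb wx fx _] := sx; split=> //.
- by move=> c /hm; apply: leq_trans.
- by move=> a /hp; apply: leq_trans.
move=> a c t; apply: (swaps_down HF _ fx (ht _ _ t)) => //; last by have [] := aL.2 _ _ t.
by apply: vadd_unit_le_gcap => //; apply: hp; apply: turn_plus t.
Qed.

(** The tandem at the intermediate vector is obtained from the exchange of
   weight [i.+1], which holds in a smaller menu. *)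
Lemma rotates_after_part x L k i : st x -> rotates x L -> shiftable x L k -> 0 < i < k ->
  rotates (shift x L i) L.
Proof.
move=> sx aL fk /andP[i0 ik]; have [xb wx fx _] := sx.
have fi : shiftable x L i by apply: shiftable_down fk _ => //; rewrite i0 ltnW.
have fi1 : shiftable x L i.+1 by apply: shiftable_down fk _.
have sx' := shift_stable HM sx aL fi; have [xb' _ _ _] := sx'.
have [altL tan] := aL; split=> // a c t; have [ad ca sw] := tan _ _ t.
have aP := turn_plus t; have cM := turn_minus altL t.
have [_ _ hp _] := fi1; have room := hp a aP.
have aM := plus_minus HM sx aL aP.
have zb := with_plus_le sx fi.
have za : with_plus x L i a = x a + i by rewrite ffunE aP muln1.
have sw' : swaps CF (shift x L i) 1 a c.
  have [_ hm _ ht] := fi1; have v := swaps_value (ht _ _ t) ca; have cm := hm c cM.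
  apply: (swaps_transport HF (x := x) (z := with_plus x L i) (t := vadd x (vunit i.+1 a))) => //.
  - by apply: vadd_unit_le => //; rewrite za ffunE; clear -room; lia.
  - exact: le_with_plus.
  - exact: shift_choice.
  - by rewrite shift_size.
  - apply/vleP => e; rewrite !ffunE; case: (e =P a) => [->|_]; last by rewrite muln0 leq_add2r leq_addr.
    by rewrite aP; clear; lia.
  - by rewrite vadd_unit_other // -v addnS ltnS leq_addr.
  - by rewrite shift_minus //; clear -v cm; lia.
split=> //; apply: (admissible_up HM sx sx' (shift_below HM sx aL fi) ad).
apply: (swaps_interesting xb' _ sw' ca); rewrite [ltnRHS]ffunE shift_plus // aP.
by clear -room; lia.
Qed.

Lemma shift_next x L k : st x -> rotates x L -> shift x L k.+1 = shift (shift x L k) L 1.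
Proof.
move=> sx aL; apply/ffunP => e; rewrite !ffunE.
have := plus_minus HM sx aL (a := e).
case: (e \in Lplus L) => [/(_ isT)/negPf ->|_]; last case: (e \in Lminus L); clear; lia.
Qed.

Hypothesis HC : gapless M.

Let gap z1 z2 z3 a c d := @gapless_global M HM HC z1 z2 z3 a c d.

(** If the rotation is applicable again after a feasible shift, the weight
   was not maximal. The next unit of [a] displaces some [d] at an intermediate
   vector reached by exchanging [a] and [c] alone; as [a] displaces [c] before
   and after, the gapless condition gives [d = c]. *)
Lemma shiftable_succ x L k : st x -> rotates x L -> shiftable x L k -> rotates (shift x L k) L -> shiftable x L k.+1.
Proof.
move=> sx aL fk aL'; have [xb wx fx _] := sx.
have sx' := shift_stable HM sx aL fk; have [xb' _ fx' _] := sx'.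
have [altL tan] := aL; have [_ tan'] := aL'; have [k0 hm hp ht] := fk.
have [_ hm' hp' _] := shiftable1 sx' aL'.
split=> //.
- by move=> c cM; have := hm' c cM; rewrite shift_minus //; lia.
- move=> a aP; have := hp' a aP; rewrite shift_plus // ?aP; last exact: (plus_minus HM sx aL).
  by lia.
move=> a c t; have [ad ca sw] := tan _ _ t; have [ad' _ sw'] := tan' _ _ t.
have aP := turn_plus t; have cM := turn_minus altL t.
have room' := admissible_room ad'.
have x'a : shift x L k a = x a + k.
  by rewrite shift_plus // ?aP ?muln1 //; apply: (plus_minus HM sx aL).
have swk := ht _ _ t.
set xk := vadd x (vunit k a); pose u := CF xk.
have xkb : vle xk gcap by apply: vadd_unit_le_gcap => //; apply: hp.
have zb := with_plus_le sx fk.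
have xkz : vle xk (with_plus x L k).
  apply/vleP => e; rewrite !ffunE leq_add2l; case: eqP => [->|_]; last by rewrite muln0.
  by rewrite aP.
have zab : vle (vadd (with_plus x L k) (vunit 1 a)) gcap.
  by apply: vadd_unit_le => //; rewrite !ffunE aP muln1 -x'a.
have xkab : vle (vadd xk (vunit 1 a)) gcap by apply: vle_trans zab; apply: vadd_unit_mono.
have fu : CF u = u by apply: (choice_idem HF).
have ub : vle u gcap := vle_trans (choice_le HF xkb) xkb.
have Cz : CF (vadd (with_plus x L k) (vunit 1 a)) = CF (vadd (shift x L k) (vunit 1 a)).
  by rewrite -(choice_add HF zab) shift_choice.
have Cu : CF (vadd u (vunit 1 a)) = CF (vadd xk (vunit 1 a)) by apply: (choice_add HF).
have su : vsize u = vsize x.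
  by have := congr1 (@vsize _) swk; rewrite !vsize_add !vsize_unit => /addIn.
have ua : u a = x a + k.
  have := swaps_coord a swk ca; rewrite -/xk -/u eqxx muln1.
  by case: eqP => [ac|_]; [case: ca | rewrite muln0 addn0].
have uroom : u a < cap a by rewrite ua -x'a.
have le_sz : vsize (CF (vadd u (vunit 1 a))) <= vsize x.
  rewrite Cu; apply: leq_trans (choice_A3 HF zab (vadd_unit_mono 1 a xkz)) _.
  by rewrite Cz (swaps_size sw') shift_size.
have iu : iF u a.
  rewrite /interesting_for [gcap a]ffunE uroom /= Cu.
  have h := choice_A2E HF a zab (vadd_unit_mono 1 a xkz); apply: leq_trans h.
  rewrite Cz leq_min; apply/andP; split; last by rewrite !vadd_unit_same ua addn1.
  by rewrite ua -x'a; case/andP: (admissible_interesting ad').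
have [same|[d da swu]] := interesting_cases HF ub fu iu.
  by move: le_sz; rewrite same vsize_add vsize_unit su addn1 ltnn.
have edc : d = c.
  apply: (gap xb ub xb' fx fu fx' _ _ _ uroom room' sw swu sw' ca da).
  - exact: (below_menu HF xkb (vle_addr _ _) erefl).
  - apply: (below_menu HF zb) (shift_choice HM sx aL fk).
    exact: vle_trans (choice_le HF xkb) xkz.
  - exact: admissible_room ad.
subst d.
exact: (swaps_succ HF xkab swk swu).
Qed.

(** The edge [a] of a tandem is wanted at the upper vector, hence in
   between; its partner there is the same by the gapless condition. *)
Lemma rotates_convex s x y L : st s -> st x -> st y -> leF s x -> leF x y ->
  rotates s L -> rotates y L -> rotates x L.
Proof.
move=> ss sx sy sx_le xy aS aY; have [altL tanS] := aS; have [_ tanY] := aY.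
have [sb _ fs _] := ss; have [xb _ fx _] := sx; have [yb _ fy _] := sy.
split=> // a c t; have [adS ca swS] := tanS _ _ t; have [adY _ swY] := tanY _ _ t.
have [ia xya] := interesting_back HF xb yb fx xy (admissible_interesting adY).
have adX := admissible_up HM ss sx sx_le adS ia.
split=> //; have [same|[d da swX]] := interesting_cases HF xb fx ia.
  have y1b : vle (vadd y (vunit 1 a)) gcap.
    by apply: vadd_unit_le => //; rewrite ffunE; apply: admissible_room adY.
  have jb : vle (vjoin (vjoin x y) (vadd y (vunit 1 a))) gcap by do ! apply: vjoin_le => //.
  have x1 : vle (vadd x (vunit 1 a)) (vjoin (vjoin x y) (vadd y (vunit 1 a))).
    by apply/vleP => e; rewrite !ffunE; case: (e =P a) => [->|_]; clear -xya; lia.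
  have := choice_A3 HF jb x1.
  rewrite -(path_indep HF) ?vjoin_le // xy.
  have -> : vjoin y (vadd y (vunit 1 a)) = vadd y (vunit 1 a).
    by apply/ffunP => e; rewrite !ffunE; clear; lia.
  rewrite (swaps_size swY) same vsize_add vsize_unit.
  have := stable_size HF HW (stable_for_sym sx) (stable_for_sym sy) xy.
  by clear; lia.
suff -> : c = d by [].
apply/esym; apply: (gap sb xb yb fs fx fy sx_le xy _ _ _ swS swX swY ca da);
  exact: admissible_room.
Qed.

(** Suppose that [e] displaces [d] at [x] but not at the shifted vector.
   Then [d] lies on the rotation, in a tandem with some [a1] say. This [a1]
   displaces [d] at [x] and at the choice after adding [e] to the shifted
   vector. In between, at the choice after adding [e] to [x], it displaces
   something else, because by (A2) as much of [d] is kept as in the upper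
   vector. This contradicts the gapless condition. *)
Lemma same_displacement x L e : st x -> rotates x L -> rotates (shift x L 1) L ->
  iF x e -> e \notin Lplus L ->
  vsize (CF (vadd (shift x L 1) (vunit 1 e))) <= vsize x ->
  exists d, [/\ d <> e, swaps CF x 1 e d & swaps CF (shift x L 1) 1 e d].
Proof.
move=> sx aL aL' ie eP le_sz; have [xb wx fx _] := sx; have fe := shiftable1 sx aL.
set x' := shift x L 1 in aL' le_sz *.
have sx' : st x' := shift_stable HM sx aL fe; have [xb' _ fx' _] := sx'.
have szx' : vsize x' = vsize x := shift_size sx aL fe.
have eM : e \notin Lminus L by apply/negP => /(rotates_minus HM sx aL); rewrite ie.
have x'e : x' e = x e by rewrite /x' shift_plus // (negPf eP) muln0 addn0.
have /andP[xe _] := ie; rewrite [gcap e]ffunE in xe.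
set z := with_plus x L 1.
have zb : vle z gcap := with_plus_le sx fe.
have xz : vle x z := le_with_plus x L 1.
have Cz : CF z = x' := shift_choice HM sx aL fe.
have ze : z e = x e by rewrite ffunE (negPf eP) muln0 addn0.
have zeb : vle (vadd z (vunit 1 e)) gcap by apply: vadd_unit_le; rewrite ?ze ?[gcap e]ffunE.
have x1z : vle (vadd x (vunit 1 e)) (vadd z (vunit 1 e)) := vadd_unit_mono 1 e xz.
have x1b := vle_trans x1z zeb.
set x'' := CF (vadd x' (vunit 1 e)) in le_sz.
have Cze : CF (vadd z (vunit 1 e)) = x'' by rewrite -(choice_add HF zeb) Cz.
have [same|[d de sw]] := interesting_cases HF xb fx ie.
  have := choice_A3 HF zeb x1z; rewrite same vsize_add vsize_unit Cze addn1 => h.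
  by move: (leq_trans h le_sz); rewrite ltnn.
exists d; split=> //; have v := swaps_value sw de.
have x'z : vle x' z by rewrite -Cz; apply: (choice_le HF).
have dP : d \notin Lplus L.
  apply/negP => /(rotates_plus aL)/admissible_interesting.
  by rewrite (negPf (swapped_out_not_interesting HF xb fx _ sw de)) // ffunE.
have [dM|dM] := boolP (d \in Lminus L); last first.
  apply: (swaps_transport HF (x := x) (z := z) (t := vadd x (vunit 1 e))) => //.
  - by rewrite szx'.
  - by rewrite vadd_unit_other // -v addn1.
  - by rewrite /x' shift_plus // (negPf dP) muln0 addn0 -v addn1.
have [lt|ge] := ltnP (x'' d) (x' d).
  apply: (swaps_transport HF (x := x) (z := z) (t := vadd x' (vunit 1 e))) => //.
  - by rewrite szx'.
  - exact: vadd_unit_mono.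
  - by rewrite vadd_unit_other.
exfalso.
have [a1 t] := minus_turn aL.1 dM; have [ad1 da1 sw1] := aL.2 _ _ t.
have [ad1' _ sw1'] := aL'.2 _ _ t.
have a1P := turn_plus t.
have a1e : a1 <> e by move=> h; move: eP; rewrite -h a1P.
have ea1 := not_eq_sym a1e.
have x'a1 : x' a1 = x a1 + 1.
  by rewrite /x' shift_plus // ?a1P ?muln1 //; apply: (plus_minus HM sx aL).
have x'd : x' d + 1 = x d.
  have [_ hm _ _] := fe; have := hm d dM; rewrite /x' shift_minus //; clear; lia.
have x'1b : vle (vadd x' (vunit 1 e)) gcap.
  by apply: vadd_unit_le => //; rewrite x'e [gcap e]ffunE.
have fx'' : CF x'' = x'' by apply: (choice_idem HF).
have xb'' : vle x'' gcap := vle_trans (choice_le HF x'1b) x'1b.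
have [x''a1 sw1''] : x'' a1 = x' a1 /\ swaps CF x'' 1 a1 d.
  have [ie'|nie'] := boolP (iF x' e); last first.
    have -> : x'' = x' by apply: (not_interesting HF) => //; rewrite x'e [gcap e]ffunE.
    by [].
  have [same|[g ge' swg]] := interesting_cases HF xb' fx' ie'.
    by move: le_sz; rewrite /x'' same vsize_add vsize_unit szx' addn1 ltnn.
  have gd : d <> g.
    move=> h; have := swaps_value swg ge'; rewrite -h -/x'' => hh.
    by move: ge; rewrite -hh addn1 ltnn.
  have ga1 : a1 <> g.
    move=> h; have := admissible_interesting ad1'; rewrite h.
    by rewrite (negPf (swapped_out_not_interesting HF xb' fx' _ swg ge')) // x'e ffunE.
  split.
    have := swaps_coord a1 swg ge'; rewrite -/x''.
    by move/eqP/negPf: ga1 => ->; move/eqP/negPf: a1e => ->; rewrite !muln0 !addn0.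
  have v1 := swaps_value sw1' da1.
  apply: (swaps_transport HF (x := x') (z := vadd x' (vunit 1 e)) (t := vadd x' (vunit 1 a1))) => //.
  - by apply: vadd_unit_le => //; rewrite vadd_unit_other // [gcap a1]ffunE; apply: admissible_room ad1'.
  - exact: vle_addr.
  - by rewrite szx'.
  - by apply: vadd_unit_mono; apply: vle_addr.
  - by rewrite vadd_unit_other // -v1 addn1.
  - by apply: leq_trans ge; rewrite -v1 addn1.
pose w := CF (vadd x (vunit 1 e)).
have wb : vle w gcap := vle_trans (choice_le HF x1b) x1b.
have fw : CF w = w by apply: (choice_idem HF).
have szw : vsize w = vsize x := swaps_size sw.
have wa1 : w a1 = x a1.
  have := swaps_coord a1 sw de; rewrite -/w.
  move/eqP/negPf: a1e => ->; rewrite eq_sym; move/eqP/negPf: da1 => ->.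
  by rewrite !muln0 !addn0.
set t2 := vadd (vadd x (vunit 1 e)) (vunit 1 a1).
have t2z : vle t2 (vadd z (vunit 1 e)).
  apply/vleP => i; rewrite !ffunE; case: (i =P a1) => [->|_].
    by rewrite a1P; clear; lia.
  by clear; lia.
have t2b := vle_trans t2z zeb.
have Cw : CF (vadd w (vunit 1 a1)) = CF t2 by apply: (choice_add HF).
have lb i : minn (x'' i) (t2 i) <= CF t2 i by rewrite -Cze; apply: (choice_A2E HF).
have iw : iF w a1.
  rewrite /interesting_for wa1 [gcap a1]ffunE admissible_room //= Cw.
  apply: leq_trans (lb a1); rewrite leq_min x''a1 x'a1 addn1 ltnSn /=.
  by rewrite /t2 vadd_unit_same vadd_unit_other // addn1.
have [same|[g gne swg]] := interesting_cases HF wb fw iw.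
  have := choice_A3 HF zeb t2z; rewrite -Cw same vsize_add vsize_unit Cze szw addn1 => h.
  by move: (leq_trans h le_sz); rewrite ltnn.
have egd : g = d.
  apply: (gap xb wb xb'' fx fw fx'' _ _ _ _ _ sw1 swg sw1'' da1 gne).
  - exact: (below_menu HF x1b (vle_addr _ _) erefl).
  - by apply: (below_menu HF zeb) Cze; apply: vle_trans x1z; apply: (choice_le HF).
  - exact: admissible_room ad1.
  - by rewrite wa1; apply: admissible_room ad1.
  - by rewrite x''a1; apply: admissible_room ad1'.
subst g; have v2 := swaps_value swg da1.
have v3 : w d + 1 = x d := v.
have := lb d; rewrite -Cw /t2 vadd_unit_other // vadd_unit_other //.
by clear -v2 v3 x'd ge; lia.
Qed.

(** By [same_displacement], as long as a rotation can be repeated, the edges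
   wanted before its use are still wanted after it, and the tandems found after
   it were there before. *)
Lemma rotates_keep x L K : st x -> rotates x L -> rotates (shift x L 1) L ->
  rotates (shift x L 1) K -> rotates x K.
Proof.
move=> sx aL aL' aK; have [xb wx fx _] := sx; have fe := shiftable1 sx aL.
have sx' := shift_stable HM sx aL fe; have [xb' _ fx' _] := sx'.
have xx' := shift_below HM sx aL fe.
have [altK tan] := aK; split=> // a c t; have [[q0 ia' m] ca sw] := tan _ _ t.
have [ia _] := interesting_back HF xb xb' fx xx' ia'.
split=> //.
  split=> // e we ie; apply: m => //.
  have [eP|eP] := boolP (e \in Lplus L); first exact: admissible_interesting (rotates_plus aL' eP).
  apply: contraT => nie.
  have eM : e \notin Lminus L by apply/negP => /(rotates_minus HM sx aL); rewrite ie.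
  have x'e : shift x L 1 e < gcap e.
    by rewrite shift_plus // (negPf eP) muln0 addn0; case/andP: ie.
  have C' := not_interesting HF xb' fx' x'e nie.
  have [|d [de _ sw']] := same_displacement sx aL aL' ie eP; first by rewrite C' shift_size.
  by rewrite (swaps_interesting xb' x'e sw' de) in nie.
have [aP|aP] := boolP (a \in Lplus L).
  have [cL tL] := plus_turn aL.1 aP; have [_ _ swL] := aL.2 _ _ tL.
  by have [_ _ swL'] := aL'.2 _ _ tL; rewrite (swaps_uniq sw swL').
have [|d [_ swx swx']] := same_displacement sx aL aL' ia aP.
  by rewrite (swaps_size sw) shift_size.
by rewrite (swaps_uniq sw swx').
Qed.

End Gapless.

(** * Systems of confluent unit steps *)

Lemma sum_count_mem (R : finType) (g : R -> nat) (w : seq R) :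
  \sum_(L <- w) g L = \sum_L count_mem L w * g L.
Proof.
elim: w => [|K w IH] /=; first by rewrite big_nil big1.
rewrite big_cons IH (bigD1 K (P := xpredT)) //= [RHS](bigD1 K) //= eqxx.
rewrite mulnDl mul1n addnA; congr (_ + _); apply: eq_bigr => L /negPf.
by rewrite eq_sym => ->.
Qed.

Section StepSystem.
Variables (T : Type) (R : finType).
Variables (st : T -> Prop) (app : T -> R -> Prop) (sh : T -> R -> T).
Variables (le : T -> T -> Prop) (P : T -> nat) (gain : R -> nat).
Variables (bound : nat) (bot top : T).
Implicit Types (x y z s t m j : T) (K L : R) (w v : seq R).

(** An order generated by unit steps labelled by [R], with local confluence
   ([sh_diamond], [sh_both]), steps of fixed gain, convexity of applicability
   ([app_convex]), steps that enable nothing while they can be repeated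
   ([app_keep]), and for any two states a lower bound and a least upper bound
   of complementary rank ([meet_join]). The representation theorem is proved at
   this level. *)
Record step_axioms : Prop := StepAxioms {
  le_refl : forall x, st x -> le x x;
  le_trans : forall x y z, st x -> st y -> st z -> le x y -> le y z -> le x z;
  st_bot : st bot;
  st_top : st top;
  le_bot : forall x, st x -> le bot x;
  le_top : forall x, st x -> le x top;
  rank_bound : forall x, st x -> P x <= bound;
  sh_st : forall x L, st x -> app x L -> st (sh x L);
  sh_le : forall x L, st x -> app x L -> le x (sh x L);
  sh_rank : forall x L, st x -> app x L -> P (sh x L) = P x + gain L /\ 0 < gain L;
  sh_next : forall x y, st x -> st y -> le x y -> x <> y ->
    exists2 L, app x L & le (sh x L) y;
  sh_diamond : forall x L K, st x -> app x L -> app x K -> L <> K ->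
    app (sh x L) K /\ sh (sh x L) K = sh (sh x K) L;
  sh_both : forall x y L K, st x -> st y -> app x L -> app x K -> L <> K ->
    le (sh x L) y -> le (sh x K) y -> le (sh (sh x L) K) y;
  app_convex : forall s x y L, st s -> st x -> st y -> le s x -> le x y ->
    app s L -> app y L -> app x L;
  app_keep : forall x L K, st x -> app x L -> app (sh x L) L -> app (sh x L) K ->
    app x K;
  meet_join : forall x y, st x -> st y -> exists m j,
    [/\ st m /\ st j, le m x /\ le m y, le x j /\ le y j,
        forall u, st u -> le x u -> le y u -> le j u &
        P m + P j = P x + P y]
}.

Hypothesis HS : step_axioms.

Fixpoint walk x w y : Prop :=
  if w is L :: w' then app x L /\ walk (sh x L) w' y else x = y.

Lemma walk_st x w y : st x -> walk x w y -> st y.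
Proof.
elim: w x => [|L w IH] x sx /=; first by move<-.
by case=> aL; apply: IH; apply: (sh_st HS).
Qed.

Lemma walk_le x w y : st x -> walk x w y -> le x y.
Proof.
elim: w x => [|L w IH] x sx /=; first by move<-; apply: (le_refl HS).
case=> aL wy; have sL := sh_st HS sx aL.
apply: (le_trans HS sx sL (walk_st sL wy) (sh_le HS sx aL)); exact: IH.
Qed.

Lemma walk_cat x w v y : walk x (w ++ v) y <-> exists2 z, walk x w z & walk z v y.
Proof.
elim: w x => [|L w IH] x /=; first by split=> [h|[z ->]//]; exists x.
split=> [[aL /IH[z h1 h2]]|[z [aL h1] h2]]; first by exists z.
by split=> //; apply/IH; exists z.
Qed.

Lemma walk_rank x w y : st x -> walk x w y -> P y = P x + \sum_(L <- w) gain L.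
Proof.
elim: w x => [|L w IH] x sx /=; first by move<-; rewrite big_nil addn0.
case=> aL wy; rewrite (IH _ (sh_st HS sx aL) wy) big_cons.
by rewrite (sh_rank HS sx aL).1 addnA.
Qed.

Lemma le_walk x y : st x -> st y -> le x y -> exists w, walk x w y.
Proof.
have [n] := ubnP (bound - P x); elim: n x => // n IH x lt sx sy xy.
have [->|ne] := pselect (x = y); first by exists [::].
have [L aL Ly] := sh_next HS sx sy xy ne.
have sL := sh_st HS sx aL; have [rL gL] := sh_rank HS sx aL.
have bL := rank_bound HS sL.
have [|w wy] := IH _ _ sL sy Ly; first by move: lt; lia.
by exists (L :: w).
Qed.

Lemma walk_loop x w : st x -> walk x w x -> w = [::].
Proof.
case: w => //= L w sx [aL wx].
have := walk_rank (sh_st HS sx aL) wx; have := sh_rank HS sx aL; lia.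
Qed.

(** Newman's argument: two walks that start with different letters are both
   compared with a walk through the common successor. So the number of uses of
   each letter only depends on the ends. *)
Lemma walk_perm x w w' y : st x -> walk x w y -> walk x w' y -> perm_eq w w'.
Proof.
have [n] := ubnP (size w); elim: n x w w' => // n IH x [|L w] w' lt sx.
  by move=> /= <- /(walk_loop sx) ->.
have [sy|] := pselect (st y); last by move=> h /(walk_st sx)/h.
case: w' => [|K w'].
  by move=> h /= xy; move: h; rewrite -xy => /(walk_loop sx).
move=> [aL wL] [aK wK].
have sL := sh_st HS sx aL; have sK := sh_st HS sx aK.
have [eqLK|/eqP neLK] := eqVneq L K.
  by subst K; rewrite perm_cons; apply: IH wL wK.
have [aLK cLK] := sh_diamond HS sx aL aK neLK.
have zy := sh_both HS sx sy aL aK neLK (walk_le sL wL) (walk_le sK wK).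
have sz := sh_st HS sL aLK.
have [v wv] := le_walk sz sy zy.
have p1 : perm_eq w (K :: v) by apply: (IH (sh x L)) => //=.
have p2 : perm_eq (L :: v) w'.
  apply: (IH (sh x K)) => //; first by move: lt (perm_size p1) => /=; lia.
  have [aKL cKL] := sh_diamond HS sx aK aL (not_eq_sym neLK).
  by split=> //; rewrite -cLK.
apply: (@perm_trans _ (L :: K :: v)); first by rewrite perm_cons.
apply: (@perm_trans _ (K :: L :: v)); last by rewrite perm_cons.
by apply/permP => p /=; lia.
Qed.

(** Independent of the walk that is picked, by [walk_perm]. *)
Definition uses x L : nat := count_mem L (xget [::] [set w | walk bot w x]%classic).

Lemma uses_walk w x L : walk bot w x -> uses x L = count_mem L w.
Proof.
move=> h; rewrite /uses; case: xgetP => [v _ /= hv|/(_ w)//].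
by apply/permP; apply: walk_perm hv h; apply: (st_bot HS).
Qed.

Lemma uses_bot L : uses bot L = 0.
Proof. exact: (@uses_walk [::]). Qed.

Lemma uses_add x w y L : st x -> walk x w y -> uses y L = uses x L + count_mem L w.
Proof.
move=> sx wy; have [v wv] := le_walk (st_bot HS) sx (le_bot HS sx).
rewrite (uses_walk L wv) -count_cat; apply: uses_walk.
by apply/walk_cat; exists x.
Qed.

Lemma uses_sh x L K : st x -> app x L -> uses (sh x L) K = uses x K + (L == K).
Proof. by move=> sx aL; rewrite (uses_add K sx (w := [:: L])) //= addn0. Qed.

Lemma le_uses x y L : st x -> st y -> le x y -> uses x L <= uses y L.
Proof.
move=> sx sy /(le_walk sx sy)[w wy]; rewrite (uses_add L sx wy); exact: leq_addr.
Qed.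

Lemma walk_sub x w y L : st x -> walk x w y -> uses y L <= uses x L -> L \notin w.
Proof.
move=> sx wy; rewrite (uses_add L sx wy) => h.
by apply/count_memPn; lia.
Qed.

Lemma walk_mem x w y L : st x -> walk x w y -> uses x L < uses y L -> L \in w.
Proof.
move=> sx wy; rewrite (uses_add L sx wy) => h.
by rewrite -has_pred1 has_count; lia.
Qed.

Lemma mem_walk_split x w y L : walk x w y -> L \in w ->
  exists w1 z, [/\ walk x w1 z, app z L & L \notin w1].
Proof.
elim: w x => [//|K w IH] x [aK wy]; rewrite inE.
have [->|neLK] := eqVneq L K; first by exists [::], x.
move=> /= /(IH _ wy)[w1 [z [w1z az nL]]]; exists (K :: w1), z; split=> //.
by rewrite inE negb_or neLK.
Qed.

(** A letter that is applicable and used later can be moved to the front. *)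
Lemma sh_le_target x w y L : st x -> app x L -> walk x w y -> L \in w -> le (sh x L) y.
Proof.
elim: w x => [//|K w IH] x sx aL [aK wy].
have sK := sh_st HS sx aK; have sL := sh_st HS sx aL.
rewrite inE; case: eqP => [->|neLK] /= hL; first exact: walk_le wy.
have [aKL cKL] := sh_diamond HS sx aK aL (not_eq_sym neLK).
have [aLK cLK] := sh_diamond HS sx aL aK neLK.
have := IH _ sK aKL wy hL; rewrite cKL.
by apply: (le_trans HS) => //; [apply: (sh_st HS) | apply: walk_st wy | apply: (sh_le HS)].
Qed.

Lemma app_persist x w y L : st x -> app x L -> walk x w y -> L \notin w -> app y L.
Proof.
elim: w x => [|K w IH] x sx aL /=; first by move<-.
case=> aK wy; rewrite inE negb_or => /andP[/eqP neLK].
apply: IH wy; first exact: (sh_st HS).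
by have [] := sh_diamond HS sx aK aL (not_eq_sym neLK).
Qed.

Lemma app_up x y L : st x -> st y -> le x y -> app x L -> uses y L = uses x L -> app y L.
Proof.
move=> sx sy xy aL eL; have [w wy] := le_walk sx sy xy.
by apply: (app_persist sx aL wy); apply: (walk_sub sx wy); rewrite eL.
Qed.

Lemma sh_up x y L : st x -> st y -> le x y -> app x L -> uses x L < uses y L ->
  le (sh x L) y.
Proof.
move=> sx sy xy aL eL; have [w wy] := le_walk sx sy xy.
by apply: (sh_le_target sx aL wy); apply: (walk_mem sx wy).
Qed.

(** The walk to [x] is replayed above [y], omitting the letters that [y] has
   used already. *)
Lemma join_uses s w x y : st s -> walk s w x -> st y -> le s y ->
  exists z, [/\ st z, le x z, le y z & forall L, uses z L = maxn (uses x L) (uses y L)].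
Proof.
elim: w s y => [|L w IH] s y ss /=.
  move<- => sy sy_le; exists y; split=> //; first exact: (le_refl HS).
  by move=> L; rewrite (maxn_idPr _) //; apply: le_uses.
case=> aL wx sy sley; have s1 := sh_st HS ss aL.
have [lt|ge] := ltnP (uses s L) (uses y L).
  by apply: (IH _ _ s1 wx sy); apply: sh_up.
have eL : uses y L = uses s L by apply/eqP; rewrite eqn_leq ge le_uses.
have ay := app_up ss sy sley aL eL.
have sy1 := sh_st HS sy ay.
have yy1 := sh_le HS sy ay.
have [|z [sz xz yz uz]] := IH _ (sh y L) s1 wx sy1.
  apply: sh_up => //; last by rewrite uses_sh // eqxx eL addn1.
  exact: (le_trans HS) sley yy1.
exists z; split=> // [|K]; first exact: (le_trans HS) yy1 yz.
rewrite uz uses_sh //; case: (L =P K) => [<-|_]; last by rewrite addn0.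
by rewrite (uses_add L s1 wx) uses_sh // eqxx eL; lia.
Qed.

(** The order is thus coordinatewise: joining [x] to [y] adds no use if all
   the uses of [x] are covered by those of [y]. *)
Lemma le_usesP x y : st x -> st y -> (le x y <-> forall L, uses x L <= uses y L).
Proof.
move=> sx sy; split=> [xy L|h]; first exact: le_uses.
have [w wx] := le_walk (st_bot HS) sx (le_bot HS sx).
have [z [sz xz yz uz]] := join_uses (st_bot HS) wx sy (le_bot HS sy).
have [[|L v] wz] := le_walk sy sz yz; first by rewrite wz.
have := uses_add L sy wz; rewrite uz /= eqxx (maxn_idPr (h L)); lia.
Qed.

(** The counts at the lower bound [m] are at most the minima. The rank is a
   positive combination of the counts and the ranks of [m] and of the join add
   up to those of [x] and [y], so no count can be smaller. *)
Lemma meet_uses x y : st x -> st y ->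
  exists m, [/\ st m, le m x, le m y & forall L, uses m L = minn (uses x L) (uses y L)].
Proof.
move=> sx sy; have [m [j [[sm sj] [mx my] [xj yj] jmin rk]]] := meet_join HS sx sy.
exists m; split=> // L.
have rankE z : st z -> P z = P bot + \sum_L uses z L * gain L.
  move=> sz; have [w wz] := le_walk (st_bot HS) sz (le_bot HS sz).
  rewrite (walk_rank (st_bot HS) wz) sum_count_mem; congr (_ + _).
  by apply: eq_bigr => K _; rewrite (uses_walk K wz).
have [w wx] := le_walk (st_bot HS) sx (le_bot HS sx).
have [z [sz xz yz uz]] := join_uses (st_bot HS) wx sy (le_bot HS sy).
have uj K : uses j K = maxn (uses x K) (uses y K).
  have jz : uses j K <= uses z K by apply: le_uses => //; apply: jmin.
  by apply/eqP; rewrite eqn_leq geq_max !le_uses // !andbT -uz.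
have mle K : uses m K <= minn (uses x K) (uses y K) by rewrite leq_min !le_uses.
have h : \sum_K uses m K * gain K = \sum_K minn (uses x K) (uses y K) * gain K.
  have : \sum_K uses m K * gain K + \sum_K uses j K * gain K =
         \sum_K uses x K * gain K + \sum_K uses y K * gain K.
    have cancel (p a c d e : nat) : p + a + (p + c) = p + d + (p + e) -> a + c = d + e.
      by lia.
    by apply: (cancel (P bot)); rewrite -!rankE.
  rewrite -!big_split /= => h.
  have : \sum_K uses m K * gain K + \sum_K uses j K * gain K =
    \sum_K minn (uses x K) (uses y K) * gain K + \sum_K uses j K * gain K.
    rewrite -!big_split /= h; apply: eq_bigr => K _.
    by rewrite uj -!mulnDl; congr (_ * _); rewrite addn_min_max.
  by move/addIn.
apply/eqP; rewrite eqn_leq mle /= leqNgt; apply/negP => lt.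
have g0 : 0 < gain L.
  have Lw : L \in w by apply: (walk_mem (st_bot HS) wx); rewrite uses_bot; move: lt; lia.
  have [w1 [s [w1s aS _]]] := mem_walk_split wx Lw.
  exact: (sh_rank HS (walk_st (st_bot HS) w1s) aS).2.
have : \sum_K uses m K * gain K < \sum_K minn (uses x K) (uses y K) * gain K.
  rewrite (bigD1 L) //= [ltnRHS](bigD1 L) //= -addSn leq_add //.
    by rewrite ltn_pmul2r.
  by apply: leq_sum => K _; rewrite leq_mul2r mle orbT.
by rewrite h ltnn.
Qed.

Definition shk x L k : T := iter k (fun z => sh z L) x.

Definition max_step t x L k : Prop :=
  [/\ 0 < k, walk x (nseq k L) (shk x L k), le (shk x L k) t &
      forall k', walk x (nseq k' L) (shk x L k') -> le (shk x L k') t -> k' <= k].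

(** Maximality of the weights refers to the target [t] rather than to the
   end [y], so that initial segments of full routes are covered. *)
Fixpoint mroute t x (S : seq (R * nat)) y : Prop :=
  if S is (L, k) :: S' then max_step t x L k /\ mroute t (shk x L k) S' y
  else x = y.

Lemma mroute_cat t x S S' y :
  mroute t x (S ++ S') y <-> exists2 z, mroute t x S z & mroute t z S' y.
Proof.
elim: S x => [|[L k] S IH] x /=; first by split=> [h|[z ->]//]; exists x.
split=> [[aL /IH[z h1 h2]]|[z [aL h1] h2]]; first by exists z.
by split=> //; apply/IH; exists z.
Qed.

Definition expand (S : seq (R * nat)) : seq R := flatten [seq nseq p.2 p.1 | p <- S].

Lemma mroute_walk t x S y : mroute t x S y -> walk x (expand S) y.
Proof.
elim: S x => [|[L k] S IH] x //= [[k0 wk _ _] /IH h].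
by apply/walk_cat; exists (shk x L k).
Qed.

Lemma mroute_st t x S y : st x -> mroute t x S y -> st y.
Proof. by move=> sx /mroute_walk; apply: walk_st. Qed.

Lemma expand_notin S L : L \notin unzip1 S -> count_mem L (expand S) = 0.
Proof.
elim: S => [//|[K k] S IH] /=; rewrite inE negb_or => /andP[h1 h2].
rewrite count_cat IH // count_nseq /= eq_sym (negPf h1); lia.
Qed.

Lemma walk_nseq_end x L k y : walk x (nseq k L) y -> y = shk x L k.
Proof.
elim: k x => [|k IH] x /=; first by move<-.
by case=> _ /IH ->; rewrite /shk -iterSr.
Qed.

Lemma walk_nseqS x L k : walk x (nseq k.+1 L) (shk x L k.+1) <->
  walk x (nseq k L) (shk x L k) /\ app (shk x L k) L.
Proof.
have -> : nseq k.+1 L = nseq k L ++ [:: L] by elim: k => //= k ->.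
split=> [/walk_cat[z wz [az _]]|[w a]]; last by apply/walk_cat; exists (shk x L k).
by rewrite -(walk_nseq_end wz).
Qed.

(** A letter that returned later would by convexity be applicable right
   after its maximal step, and moving that use to the front would prolong the
   step. *)
Lemma max_step_once t x L k S y : st x -> st t -> max_step t x L k ->
  mroute t (shk x L k) S y -> le y t -> L \notin unzip1 S.
Proof.
move=> sx sS [k0 wk lek mk] r yt; apply/negP => LS.
have sx' := walk_st sx wk; have sy := mroute_st sx' r.
have ax : app x L by case: (k) k0 wk => // k' _ [].
have ax' : app (shk x L k) L.
  move: LS r; case/(nthP L) => i; rewrite size_map => lti nthi.
  rewrite -(cat_take_drop i S) => /mroute_cat[z rz].
  rewrite (drop_nth (L, 0)) //; move: nthi; rewrite (nth_map (L, 0)) //.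
  case: (nth _ _ _) => K l /= -> [[l0 wl _ _] r2].
  have sz := mroute_st sx' rz.
  apply: (app_convex HS sx sx' sz) => //.
  - exact: walk_le wk.
  - by apply: walk_le (mroute_walk rz).
  - by case: (l) l0 wl => // l' _ [].
have [] : k.+1 <= k.
  apply: mk; first by apply/walk_nseqS.
  apply: (le_trans HS) yt => //; first exact: (sh_st HS).
  apply: sh_le_target (mroute_walk r) _ => //.
  move: LS r; case/(nthP L) => i; rewrite size_map => lti nthi.
  rewrite -(cat_take_drop i S) => /mroute_cat[z rz].
  rewrite (drop_nth (L, 0)) //; move: nthi; rewrite (nth_map (L, 0)) //.
  case: (nth _ _ _) => K l /= -> [[l0 wl _ _] r2].
  rewrite /expand map_cat flatten_cat mem_cat /= mem_cat mem_nseq l0 eqxx.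
  by rewrite orbT.
by rewrite ltnn.
Qed.

(** As every letter occurs at most once, its weight is its number of uses.
   *)
Lemma mroute_uses t x S y : st x -> st t -> le y t -> mroute t x S y ->
  (forall L k, (L, k) \in S -> uses y L = uses x L + k) /\
  (forall L, L \notin unzip1 S -> uses y L = uses x L).
Proof.
move=> sx sS yt r; split=> [L k|L LS]; last first.
  by rewrite (uses_add L sx (mroute_walk r)) expand_notin ?addn0.
rewrite (uses_add L sx (mroute_walk r)) => h; congr (_ + _).
elim: S x sx r h => [//|[K l] S IH] x sx /= [mK r].
have once := max_step_once sx sS mK r yt.
have [l0 wl _ _] := mK; have sx' := walk_st sx wl.
rewrite inE /= count_cat count_nseq /=; case/orP=> [/eqP[-> ->]|h].
  by rewrite eqxx expand_notin // mul1n addn0.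
rewrite (IH _ sx' r h); case: eqP => [eKL|//].
by case/negP: once; rewrite eKL; apply/mapP; exists (L, k).
Qed.

Lemma max_step_exists t x L : st x -> st t -> app x L -> le (sh x L) t ->
  exists k, max_step t x L k.
Proof.
move=> sx sS aL Lt.
pose Q k := `[< walk x (nseq k L) (shk x L k) /\ le (shk x L k) t >].
have Q1 : exists k, Q k by exists 1; apply/asboolP.
have [|k /asboolP[wk lk] mk] := @ex_maxnP Q bound Q1.
  move=> k /asboolP[wk _]; apply: leq_trans (rank_bound HS (walk_st sx wk)).
  rewrite (walk_rank sx wk) sum_count_mem (bigD1 L) //= count_nseq /= eqxx mul1n.
  have := (sh_rank HS sx aL).2; nia.
exists k; split=> //; first by apply: mk; apply/asboolP.
by move=> k' w' l'; apply: mk; apply/asboolP.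
Qed.

Lemma mroute_exists t x : st x -> st t -> le x t -> exists S, mroute t x S t.
Proof.
have [n] := ubnP (bound - P x); elim: n x => // n IH x lt sx sS xt.
have [->|ne] := pselect (x = t); first by exists [::].
have [L aL Lt] := sh_next HS sx sS xt ne.
have [k mk] := max_step_exists sx sS aL Lt; have [k0 wk lk _] := mk.
have sx' := walk_st sx wk.
have [|S r] := IH _ _ sx' sS lk; last by exists ((L, k) :: S).
have := rank_bound HS sx'; move: lt; rewrite (walk_rank sx wk).
rewrite sum_count_mem (bigD1 L) //= count_nseq /= eqxx mul1n.
have := (sh_rank HS sx aL).2; nia.
Qed.

Definition full S := mroute top bot S top.
Definition used_in_full L := exists2 S, full S & L \in unzip1 S.
Definition precedes K L := [/\ used_in_full K, used_in_full L &
  forall S, full S -> index K (unzip1 S) < index L (unzip1 S) < size S].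

Lemma full_uses S L : full S -> (L \in unzip1 S) = (0 < uses top L).
Proof.
move=> fS; have [h1 h2] := mroute_uses (st_bot HS) (st_top HS) (le_refl HS (st_top HS)) fS.
have [/mapP[[K k] Kk /= ->]|/h2 ->] := boolP (L \in unzip1 S); last by rewrite uses_bot.
rewrite (h1 _ _ Kk) uses_bot.
have pos x : mroute top x S top -> 0 < k.
  elim: {h1 h2 fS} S x Kk => [//|[K' k'] S IH] x /=.
  rewrite inE => /orP[/eqP[_ <-]|Kk] [[k0 _ _ _] r] //.
  exact: IH Kk r.
by rewrite add0n (pos _ fS).
Qed.

Lemma full_exists : exists S, full S.
Proof. by apply: mroute_exists; [apply: (st_bot HS) | apply: (st_top HS) | apply/(le_bot HS)/(st_top HS)]. Qed.

Lemma used_in_fullP L : used_in_full L <-> 0 < uses top L.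
Proof.
split=> [[S fS]|h]; first by rewrite (full_uses _ fS).
by have [S fS] := full_exists; exists S; rewrite // (full_uses _ fS).
Qed.

Lemma uses_le_top x L : st x -> uses x L <= uses top L.
Proof. by move=> sx; apply: le_uses => //; [apply: (st_top HS) | apply: (le_top HS)]. Qed.

(** A letter that has been started and is not used up is applicable at an
   earlier and at a later state, so convexity applies. *)
Lemma app_partial x L : st x -> 0 < uses x L < uses top L -> app x L.
Proof.
move=> sx /andP[h0 h1].
have [w wx] := le_walk (st_bot HS) sx (le_bot HS sx).
have Lw : L \in w by apply: (walk_mem (st_bot HS) wx); rewrite uses_bot.
have [v vt] := le_walk sx (st_top HS) (le_top HS sx).
have Lv : L \in v by apply: (walk_mem sx vt).
have [v1 [z [v1z az _]]] := mem_walk_split vt Lv.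
case/splitPr: Lw wx => w1 w2 /walk_cat[s w1s [/= aS w2x]].
have ss := walk_st (st_bot HS) w1s; have sz := walk_st sx v1z.
apply: (app_convex HS ss sx sz _ _ aS az); last exact: walk_le v1z.
exact: (@walk_le s (L :: w2) x ss (conj aS w2x)).
Qed.

(** Repetitions of a letter that is not used up enable nothing new, so they
   can be undone. *)
Lemma app_before_partial m K i M x : st m -> st x -> uses x K < uses top K ->
  walk m (nseq i K) (shk m K i) -> app (shk m K i) M -> le (shk m K i) x -> app m M.
Proof.
move=> sm sx xK; elim: i => [//|i IH] wi1 aM lx.
have [wi ai] := (walk_nseqS m K i).1 wi1.
have si := walk_st sm wi; have si1 := walk_st sm wi1.
have lei : le (shk m K i) x := le_trans HS si si1 sx (sh_le HS si ai) lx.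
apply: (IH wi) => //; apply: (app_keep HS si ai) aM.
apply: app_partial => //; apply/andP; split.
  by rewrite [uses _ _](uses_sh K si ai) eqxx addn1.
by apply: leq_ltn_trans xK; apply: le_uses.
Qed.

(** The states reached from [s] and [t] by [L] have a meet with one more use
   of [L] than the meet of [s] and [t] and the same uses of all other letters.
   *)
Lemma app_meet s t L : st s -> st t -> app s L -> app t L ->
  exists m, [/\ st m, app m L & forall K, uses m K = minn (uses s K) (uses t K)].
Proof.
move=> ss sS aS aT; have [m [sm _ _ um]] := meet_uses ss sS.
have ss' := sh_st HS ss aS; have sS' := sh_st HS sS aT.
have [m' [sm' _ _ um']] := meet_uses ss' sS'.
exists m; split=> //.
have u' K : uses m' K = uses m K + (L == K) by rewrite um' um !uses_sh //; lia.
have mm' : le m m' by apply/le_usesP => // K; rewrite u' leq_addr.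
have [w wm] := le_walk sm sm' mm'.
have cw K : count_mem K w = (L == K) by have := uses_add K sm wm; rewrite u' => /addnI.
case: w wm cw => [|K w] wm cw; first by move: (cw L); rewrite eqxx.
have -> : L = K by move: (cw K) => /=; rewrite eqxx; case: eqP.
by case: wm.
Qed.

(** Suppose that [x] uses [L] although [K] is not used up. Starting from
   [bot], maximal steps by letters other than [K] can be continued as long as
   [L] is unused, and this yields a full route where [L] is earlier than [K].
   *)
Lemma uses_closed K L x : st x -> precedes K L -> 0 < uses x L ->
  uses x K = uses top K.
Proof.
move=> sx [uK uL pKL] xL; apply/eqP; rewrite eqn_leq uses_le_top //= leqNgt.
apply/negP => xK.
have neKL : K <> L.
  by move=> eq; have [S fS] := full_exists; move: (pKL S fS); rewrite eq ltnn.
(* On the way from the meet of [x] and [y] to [x], the first letter other than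
   [K] is already applicable at the meet, for [K] is not used up. As [y] uses
   it no more often than the meet, it stays applicable at [y]. *)
have other y : st y -> uses y K = 0 -> uses y L = 0 -> exists2 M, M != K & app y M.
  move=> sy yK yL; have [m [sm mx my um]] := meet_uses sx sy.
  have mL : uses m L = 0 by rewrite um yL minn0.
  have [w wx] := le_walk sm sx mx.
  have Lw : L \in w by apply: (walk_mem sm wx); rewrite mL.
  have [i [M [v [ew neMK]]]] : exists i M v, w = nseq i K ++ M :: v /\ M != K.
    elim: (w) Lw => [//|N w' IH]; rewrite inE.
    have [->|neNK] := eqVneq N K; last by move=> _; exists 0, N, w'.
    case/orP=> [/eqP eLK|/IH[i [M [v [-> h]]]]]; first by case: neKL.
    by exists i.+1, M, v.
  move: wx; rewrite ew => /walk_cat[z wz [aM wv]].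
  exists M => //.
  have {}wv : walk z (M :: v) x by [].
  have am : app m M.
    have zx := walk_le (walk_st sm wz) wv.
    have ez := walk_nseq_end wz; subst z.
    exact: app_before_partial sx xK wz aM zx.
  apply: (app_up sm sy my am); rewrite um.
  have : uses m M < uses x M.
    have := uses_add M sm (w := nseq i K ++ M :: v) (y := x).
    rewrite count_cat /= eqxx => -> //; last by apply/walk_cat; exists z.
    lia.
  rewrite um; lia.
have [S [y [rS KS sy yL]]] : exists S y,
    [/\ mroute top bot S y, K \notin unzip1 S, st y & 0 < uses y L].
  suff main y S : st y -> mroute top bot S y -> K \notin unzip1 S ->
      exists S' y', [/\ mroute top bot S' y', K \notin unzip1 S', st y' & 0 < uses y' L].
    by apply: (main bot [::]) => //; apply: (st_bot HS).
  have [n] := ubnP (bound - P y); elim: n y S => // n IH y S lt sy rS KS.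
  have [yL|] := posnP (uses y L); last by exists S, y.
  have yK : uses y K = 0.
    by rewrite ((mroute_uses (st_bot HS) (st_top HS) (le_top HS sy) rS).2 _ KS) uses_bot.
  have [M neMK aM] := other _ sy yK yL.
  have sM := sh_st HS sy aM.
  have [k mk] := max_step_exists sy (st_top HS) aM (le_top HS sM).
  have [k0 wk _ _] := mk; have sy' := walk_st sy wk.
  apply: (IH (shk y M k) (rcons S (M, k))) => //.
  - have := rank_bound HS sy'; move: lt; rewrite (walk_rank sy wk).
    rewrite sum_count_mem (bigD1 M) //= count_nseq /= eqxx mul1n.
    have := (sh_rank HS sy aM).2; nia.
  - by rewrite -cats1; apply/mroute_cat; exists y.
  - by rewrite /unzip1 map_rcons mem_rcons inE negb_or eq_sym neMK.
have [S' rS'] := mroute_exists sy (st_top HS) (le_top HS sy).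
have fS : full (S ++ S') by apply/mroute_cat; exists y.
have := pKL _ fS; rewrite /unzip1 map_cat !index_cat -!/(unzip1 _) (negPf KS).
have -> : L \in unzip1 S.
  apply: contraLR yL => /(mroute_uses (st_bot HS) (st_top HS) (le_top HS sy) rS).2 ->.
  by rewrite uses_bot.
rewrite ltnNge => /andP[/negP + _]; apply.
apply: leq_trans (leq_addr _ _); apply: index_size.
Qed.

(** Suppose that every [K] preceding [L] is used up at [x]. For each other
   [K] some full route reaches [L] before [K], so [L] is applicable at a state
   where [K] is unused. By [app_meet], [L] is applicable at the meet of these
   states and of a later state; this meet lies below [x], whence [L] is
   applicable at [x]. *)
Lemma unavailable_precedes x L : st x -> uses x L < uses top L -> ~ app x L ->
  exists2 K, precedes K L & uses x K < uses top K.
Proof.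
move=> sx xL nax; apply: contrapT => no.
have uxL : uses x L = 0.
  by have [//|h] := posnP (uses x L); case: nax; apply: app_partial; rewrite ?h.
have [v vt] := le_walk sx (st_top HS) (le_top HS sx).
have [v1 [z [v1z az nL]]] := mem_walk_split vt (walk_mem sx vt xL).
have sz := walk_st sx v1z.
have zL : uses z L = 0 by rewrite (uses_add L sx v1z) uxL (count_memPn nL).
have late K : uses x K < uses top K -> K != L ->
    exists s, [/\ st s, app s L & uses s K = 0].
  move=> xK neKL.
  have uL : used_in_full L by apply/used_in_fullP; apply: leq_ltn_trans xL.
  have uK : used_in_full K by apply/used_in_fullP; apply: leq_ltn_trans xK.
  have [S fS nS] : exists2 S, full S & ~~ (index K (unzip1 S) < index L (unzip1 S)).
    apply: contrapT => h; apply: no; exists K => //; split=> // S fS.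
    apply/andP; split; first by apply/negPn/negP => h'; apply: h; exists S.
    by rewrite -(size_map fst) index_mem (full_uses _ fS); apply/used_in_fullP.
  have LS : L \in unzip1 S by rewrite (full_uses _ fS); apply/used_in_fullP.
  rewrite -leqNgt in nS.
  pose i := index L (unzip1 S).
  have lti : i < size S by rewrite -(size_map fst) index_mem.
  have nthi : (nth (L, 0) S i).1 = L by rewrite -(nth_map _ L) // nth_index.
  move: fS; rewrite /full -{1}(cat_take_drop i S) => /mroute_cat[s rs].
  rewrite (drop_nth (L, 0)) //; move: nthi; case: (nth _ _ _) => L' l /= -> [[l0 wl _ _] _].
  have ss := mroute_st (st_bot HS) rs.
  exists s; split=> //; first by case: (l) l0 wl => // l' _ [].
  rewrite ((mroute_uses (st_bot HS) (st_top HS) (le_top HS ss) rs).2 K) ?uses_bot //.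
  rewrite /unzip1 map_take -/(unzip1 _); apply/negP => /index_ltn; rewrite ltnNge.
  by rewrite nS.
have [s [ss aS sK]] : exists s, [/\ st s, app s L &
    forall K, uses s L = 0 /\ (K \in enum R -> uses x K < uses top K -> uses s K = 0)].
  elim: (enum R) => [|K Ks [s [ss aS IH]]]; first by exists z.
  have [keep|] := boolP ((uses x K < uses top K) && (K != L)); last first.
    move=> h; exists s; split=> // M; have [sL sM] := IH M; split=> //.
    rewrite inE => /orP[/eqP ->|//] xK.
    by move: h; rewrite xK /= negbK => /eqP ->.
  have [s1 [ss1 aS1 s1K]] := late K (andP keep).1 (andP keep).2.
  have [m [sm am um]] := app_meet ss ss1 aS aS1.
  exists m; split=> // M; have [sL sM] := IH M; rewrite !um sL min0n; split=> //.
  rewrite inE => /orP[/eqP ->|h] xK; first by rewrite s1K minn0.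
  by rewrite sM // min0n.
have sx_le : le s x.
  apply/le_usesP => // K; have [_ h] := sK K.
  have [lt|ge] := ltnP (uses x K) (uses top K); first by rewrite h ?mem_enum.
  exact: leq_trans (uses_le_top K ss) ge.
by apply: nax; apply: (app_up ss) => //; rewrite uxL (sK L).1.
Qed.

(** A state with maximal counts below [xi] realizes [xi]: otherwise the
   earliest letter still missing is applicable, because by
   [unavailable_precedes] and closedness an obstacle would be an even earlier
   missing letter. *)
Lemma closed_realized (xi : R -> nat) :
  (forall L, ~ used_in_full L -> xi L = 0) ->
  (forall L, used_in_full L -> xi L <= uses top L) ->
  (forall K L, precedes K L -> 0 < xi L -> xi K = uses top K) ->
  exists2 x, st x & forall L, uses x L = xi L.
Proof.
move=> c1 c2 c3.
have cle L : xi L <= uses top L.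
  by have [/c2//|/c1 ->] := pselect (used_in_full L).
have step x : st x -> (forall L, uses x L <= xi L) -> (exists L, uses x L < xi L) ->
    exists2 L, app x L & uses x L < xi L.
  move=> sx lex [L0 ltL0]; have [S fS] := full_exists.
  have [n] := ubnP (index L0 (unzip1 S)); elim: n L0 ltL0 => // n IH L ltL ltn.
  have [aL|naL] := pselect (app x L); first by exists L.
  have [K pKL xK] := unavailable_precedes sx (leq_trans ltL (cle L)) naL.
  have eK : xi K = uses top K by apply: c3 pKL _; apply: leq_ltn_trans ltL.
  apply: (IH K); first by rewrite eK.
  by have [_ _ /(_ S fS)/andP[h _]] := pKL; apply: leq_trans h _.
suff main x : st x -> (forall L, uses x L <= xi L) ->
    exists2 x, st x & forall L, uses x L = xi L.
  by apply: (main bot) => [|L]; [apply: (st_bot HS) | rewrite uses_bot].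
have [n] := ubnP (bound - P x); elim: n x => // n IH x lt sx lex.
have [h|h] := pselect (exists L, uses x L < xi L); last first.
  exists x => // L; apply/eqP; rewrite eqn_leq lex leqNgt.
  by apply/negP => ltL; apply: h; exists L.
have [L aL ltL] := step x sx lex h.
have sL := sh_st HS sx aL.
apply: (IH (sh x L)) => //.
  by have := rank_bound HS sL; have [-> g0] := sh_rank HS sx aL; move: lt; lia.
by move=> K; rewrite uses_sh //; case: (L =P K) => [<-|_]; rewrite ?addn1 ?addn0.
Qed.

End StepSystem.

(** * The lattice of stable vectors *)

Section RotationSystem.
Variables (M : market) (HM : well_formed M) (HC : gapless M).
Local Notation E := (edge M).
Local Notation CW := (@gchoice M true).
Local Notation CF := (@gchoice M false).
Local Notation gcap := (gcap M).
Local Notation st := (stable_for gcap CW CF).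
Local Notation leF := (below CF).
Local Notation sh := (fun x L => shift x L 1).
Local Notation xmin := (@xmin M).
Local Notation xmax := (@xmax M).
Implicit Types (x y z : vec E) (L K : rotation M) (T : route M).

Let HW := gchoice_axioms HM true.
Let HF := gchoice_axioms HM false.

Lemma preceqF_stable x y : st x -> st y -> preceqF x y <-> leF x y.
Proof. by move=> [xb _ fx _] [yb _ fy _]; apply: preceqFP. Qed.

Lemma xmin_spec : st xmin /\ forall y, st y -> leF xmin y.
Proof.
have [m sm lm] := least_stable HF HW.
have [|sx lx] := @xgetPex _ (vzero E)
    (fun x => stable x /\ forall y, stable y -> preceqF x y).
  exists m; split=> [|y /(stableP HM) sy]; first exact/(stableP HM)/stable_for_sym.
  by apply/preceqF_stable => //; [apply: stable_for_sym | apply/lm/stable_for_sym].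
have sx' := (stableP HM _).1 sx; split=> // y sy.
by apply/preceqF_stable => //; apply/lx/(stableP HM).
Qed.

Lemma xmax_spec : st xmax /\ forall y, st y -> leF y xmax.
Proof.
have [m sm lm] := least_stable HW HF.
have [|sx lx] := @xgetPex _ (vzero E)
    (fun x => stable x /\ forall y, stable y -> preceqF y x).
  exists m; split=> [|y /(stableP HM) sy]; first exact/(stableP HM).
  by apply/preceqF_stable => //; apply: (below_dual HW HF) (lm _ sy).
have sx' := (stableP HM _).1 sx; split=> // y sy.
by apply/preceqF_stable => //; apply/lx/(stableP HM).
Qed.

Lemma rotation_steps : step_axioms st (@rotates M) sh leF (@potential M) (@gain M)
  (\sum_e @rank M e * cap e) xmin xmax.
Proof.
have [smin lmin] := xmin_spec; have [smax lmax] := xmax_spec.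
split=> //.
- by move=> x [xb _ fx _]; apply: below_refl.
- by move=> x y z [xb _ _ _] [yb _ _ _] [zb _ _ _]; apply: (below_trans HF).
- move=> x [xb _ _ _]; apply: leq_sum => e _; rewrite leq_mul2l.
  by have := vleP _ _ xb e; rewrite ffunE => ->; rewrite orbT.
- by move=> x L sx aL; apply: shift_stable => //; apply: shiftable1.
- by move=> x L sx aL; apply: shift_below => //; apply: shiftable1.
- by move=> x L sx aL; apply: shift_potential.
- by move=> x y; apply: next_rotation.
- by move=> x L K sx aL aK ne; split; [apply: rotates_shift | apply: shift_comm].
- by move=> x y L K; apply: both_below.
- by move=> s x y L; apply: rotates_convex.
- by move=> x L K; apply: rotates_keep.
move=> x y sx sy; exists (CW (vjoin x y)), (CF (vjoin x y)).
have sm : st (CW (vjoin x y)) := stable_choice_join HW HF sx sy.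
have sj : st (CF (vjoin x y)).
  by apply/stable_for_sym/(stable_choice_join HF HW); apply: stable_for_sym.
have [xb _ _ _] := sx; have [yb _ _ _] := sy.
split=> //.
- split; apply: (below_dual HW HF) => //; first exact: (below_choice_join HW).
  by rewrite vjoinC; apply: (below_choice_join HW).
- split; first exact: (below_choice_join HF).
  by rewrite vjoinC; apply: (below_choice_join HF).
- by move=> u [ub _ _ _]; apply: (choice_join_least HF).
rewrite /potential -!big_split /=; apply: eq_bigr => e _; rewrite -!mulnDr; congr (_ * _).
by have /ffunP/(_ e) := choices_exchange HW HF sx sy; rewrite [LHS]ffunE [RHS]ffunE.
Qed.

Let HS := rotation_steps.

Local Notation walk := (walk (@rotates M) sh).
Local Notation shk := (shk sh).
Local Notation uses := (uses (@rotates M) sh xmin).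

Lemma walk_shiftable x L k : st x -> rotates x L -> walk x (nseq k.+1 L) (shk x L k.+1) ->
  shiftable x L k.+1 /\ shk x L k.+1 = shift x L k.+1.
Proof.
move=> sx aL; elim: k => [|k IH]; first by split; [apply: shiftable1 |].
move/walk_nseqS => [/IH[fk ek] ak]; rewrite ek in ak.
by split; [apply: shiftable_succ | rewrite (shift_next HM) // -ek].
Qed.

Lemma shiftable_walk x L k : st x -> rotates x L -> shiftable x L k.+1 ->
  walk x (nseq k.+1 L) (shk x L k.+1).
Proof.
move=> sx aL; elim: k => [|k IH] fk; first by split.
have fk1 : shiftable x L k.+1 by apply: shiftable_down fk _ => //=.
have wk := IH fk1; apply/walk_nseqS; split=> //.
have [_ ->] := walk_shiftable sx aL wk.
by apply: rotates_after_part fk _ => //=.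
Qed.

(** The maximal weight of a non-excessive step is the number of unit steps
   that can be repeated below the target. *)
Lemma max_weightP x y L k : st x -> st y ->
  (applicable x L /\ max_weight x y L k <-> max_step (@rotates M) sh leF y x L k) /\
  (rotates x L -> max_step (@rotates M) sh leF y x L k -> shk x L k = shift x L k).
Proof.
move=> sx sy.
have cmp j : rotates x L -> shiftable x L j -> preceqF (shift x L j) y <-> leF (shift x L j) y.
  by move=> aL fj; apply: preceqF_stable => //; apply: shift_stable.
have app1 : max_step (@rotates M) sh leF y x L k -> rotates x L.
  by case: k => [|k] [] // _ [].
split; last first.
  by case: k {app1} => [|k] aL [] // _ wk _ _; have [] := walk_shiftable sx aL wk.
split=> [[/(applicableP HM _ sx) aL [/(feasible_shiftable HM _ sx aL) fk lk mk]]|mk].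
  case: k => [|k] in fk lk mk app1 *; first by case: fk.
  have wk := shiftable_walk sx aL fk; have [_ ek] := walk_shiftable sx aL wk.
  split=> //; first by rewrite ek; apply/cmp.
  case=> // j wj lj; have [fj ej] := walk_shiftable sx aL wj.
  by apply: mk; [apply/feasible_shiftable | apply/cmp; rewrite -?ej].
have aL := app1 mk; split; first exact/applicableP.
case: k => [|k] in mk app1 *; first by case: mk.
have [_ wk lk mmk] := mk; have [fk ek] := walk_shiftable sx aL wk.
split; [exact/feasible_shiftable | by apply/cmp; rewrite -?ek |].
case=> // j /(feasible_shiftable HM _ sx aL) fj /(cmp _ aL fj) lj.
have wj := shiftable_walk sx aL fj; have [_ ej] := walk_shiftable sx aL wj.
by apply: mmk => //; rewrite ej.
Qed.

Lemma non_excessiveP x y T : st x -> st y ->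
  non_excessive x y T <-> mroute (@rotates M) sh leF y x T y.
Proof.
move=> + sy; elim: T x => [|[L k] T IH] x sx /=.
  by split=> [[]//|xy]; split=> //; apply/(stableP HM).
have [mw ek] := max_weightP L k sx sy.
split=> [[_ aL mk /IH r]|[mk r]].
  have ms := mw.1 (conj aL mk); split=> //.
  have aL' := (applicableP HM _ sx).1 aL.
  rewrite (ek aL' ms); apply: r.
  by case: mk => /(feasible_shiftable HM _ sx aL') fk _ _; apply: shift_stable.
have [aL mk'] := mw.2 mk; have aL' := (applicableP HM _ sx).1 aL.
split=> //; first exact/(stableP HM).
rewrite -(ek aL' mk); apply/IH => //.
rewrite (ek aL' mk); apply: shift_stable => //.
by case: mk' => /(feasible_shiftable HM _ sx aL').
Qed.

(** All non-excessive routes to [x] record the use counts, so these are the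
   unique candidate for the route weights. *)
Lemma route_weightsE x : st x -> route_weights xmin x = [ffun L => uses x L].
Proof.
move=> sx; have [smin lmin] := xmin_spec.
have sxx := le_refl HS sx.
have rec T : non_excessive xmin x T -> records T [ffun L => uses x L].
  move=> /(non_excessiveP _ smin sx) r.
  have [h1 h2] := mroute_uses HS smin sx sxx r.
  by split=> [L k /h1|L /h2]; rewrite ffunE => ->; rewrite (uses_bot HS) ?add0n.
have [T0 r0] := mroute_exists HS smin sx (lmin _ sx).
have n0 := (non_excessiveP _ smin sx).2 r0.
have [|_ /(_ _ n0) [g1 g2]] := @xgetPex _ (@rzero M) (fun xi =>
    (exists T, non_excessive xmin x T) /\
    forall T, non_excessive xmin x T -> records T xi).
  by exists [ffun L => uses x L]; split=> //; exists T0.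
rewrite -/(route_weights xmin x) in g1 g2 *.
have [h1 h2] := rec _ n0; apply/ffunP => L.
have [/mapP[[K k] Kk /= ->]|nL] := boolP (L \in unzip1 T0).
  by rewrite (g1 _ _ Kk) (h1 _ _ Kk).
by rewrite (g2 _ nL) (h2 _ nL).
Qed.

Lemma omegaE x : st x -> omega x = [ffun L => uses x L].
Proof. exact: route_weightsE. Qed.

Lemma tauE L : tau M L = uses xmax L.
Proof. by rewrite /tau route_weightsE ?ffunE //; have [] := xmax_spec. Qed.

Lemma full_routeP T : full_route T <-> full (@rotates M) sh leF xmin xmax T.
Proof. by apply: non_excessiveP; [case: xmin_spec | case: xmax_spec]. Qed.

Lemma in_RP L : in_R L <-> used_in_full (@rotates M) sh leF xmin xmax L.
Proof. by split=> -[T fT LT]; exists T => //; apply/full_routeP. Qed.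

Lemma earlierP K L : earlier K L <-> precedes (@rotates M) sh leF xmin xmax K L.
Proof.
by split=> -[/in_RP rK /in_RP rL h]; split=> // T /full_routeP; apply: h.
Qed.

Lemma closed_omega x : st x -> closed_fun (omega x).
Proof.
move=> sx; rewrite omegaE //; split=> [L nR|L _|K L /earlierP p].
- rewrite ffunE; apply/eqP; rewrite -leqn0 leqNgt; apply/negP => h; apply: nR.
  apply/in_RP/(used_in_fullP HS); apply: leq_trans h _; exact: (uses_le_top HS).
- by rewrite ffunE tauE; apply: (uses_le_top HS).
- by rewrite !ffunE tauE; apply: (uses_closed HS).
Qed.

Lemma omega_onto xi : closed_fun xi -> exists2 x, st x & omega x = xi.
Proof.
move=> [c1 c2 c3]; have [L nL|L /in_RP/c2|K L /earlierP/c3 h /h|x sx ux] :=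
  @closed_realized _ _ _ _ _ _ _ _ _ _ _ HS xi.
- by apply: c1 => /in_RP.
- by rewrite tauE.
- by rewrite tauE.
by exists x => //; rewrite omegaE //; apply/ffunP => L; rewrite ffunE.
Qed.

Lemma omega_le x y : st x -> st y -> leF x y <-> rle (omega x) (omega y).
Proof.
move=> sx sy; rewrite !omegaE //; split=> [/(le_usesP HS sx sy) h L|h].
  by rewrite !ffunE.
by apply/(le_usesP HS sx sy) => L; have := h L; rewrite !ffunE.
Qed.

Lemma omega_meet x y : st x -> st y ->
  exists2 m, st m & omega m = rmeet (omega x) (omega y).
Proof.
move=> sx sy; have [m [sm _ _ um]] := meet_uses HS sx sy; exists m => //.
by rewrite !omegaE //; apply/ffunP => L; rewrite !ffunE um.
Qed.

Lemma omega_join x y : st x -> st y ->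
  exists2 j, st j & omega j = rjoin (omega x) (omega y).
Proof.
move=> sx sy; have [smin lmin] := xmin_spec.
have [w wx] := le_walk HS smin sx (lmin _ sx).
have [j [sj _ _ uj]] := join_uses HS smin wx sy (lmin _ sy); exists j => //.
by rewrite !omegaE //; apply/ffunP => L; rewrite !ffunE uj.
Qed.

End RotationSystem.

Theorem theorem5p2 (M : market) (HM : well_formed M) (HC : gapless M) :
  [/\ (forall x, stable x -> closed_fun (@omega M x)),
      (forall x y, stable x -> stable y -> @omega M x = omega y -> x = y),
      (forall xi : rfun M, closed_fun xi -> exists2 x, stable x & omega x = xi),
      (forall x y, stable x -> stable y ->
         (preceqF x y <-> rle (@omega M x) (omega y))) &
      (forall x y, stable x -> stable y ->
         (exists m, is_meet x y m /\ @omega M m = rmeet (omega x) (omega y)) /\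
         (exists j, is_join x y j /\ @omega M j = rjoin (omega x) (omega y)))].
Proof.
have sP := stableP HM.
have order x y : stable x -> stable y -> (preceqF x y <-> rle (@omega M x) (omega y)).
  move=> /sP sx /sP sy; apply: iff_trans (omega_le HM HC sx sy).
  exact: preceqF_stable.
split=> //.
- by move=> x /sP; apply: closed_omega.
- move=> x y /sP sx /sP sy e.
  by apply: (@below_anti _ (@gchoice M false)); apply/(omega_le HM HC) => //; rewrite e => L.
- by move=> xi /(omega_onto HM HC)[x sx ox]; exists x => //; apply/sP.
move=> x y hx hy; have sx := (sP _).1 hx; have sy := (sP _).1 hy; split.
  have [m sm om] := omega_meet HM HC sx sy; have hm := (sP _).2 sm.
  exists m; split=> //; split=> //.
  - by apply/order => // L; rewrite om ffunE geq_minl.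
  - by apply/order => // L; rewrite om ffunE geq_minr.
  - move=> z hz /(order _ _ hz hx) zx /(order _ _ hz hy) zy.
    by apply/order => // L; rewrite om ffunE leq_min zx zy.
have [j sj oj] := omega_join HM HC sx sy; have hj := (sP _).2 sj.
exists j; split=> //; split=> //.
- by apply/order => // L; rewrite oj ffunE leq_maxl.
- by apply/order => // L; rewrite oj ffunE leq_maxr.
- move=> z hz /(order _ _ hx hz) xz /(order _ _ hy hz) yz.
  by apply/order => // L; rewrite oj ffunE geq_max xz yz.
Qed.
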